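(* Let $n\ge 2$. For every $z\in B^n\setminus\{0\}$, $$s^{\mathbb{D}^n}_{B^n\setminus\{0\}}(z)=\tilde e^{\mathbb{D}^n}_{B^n\setminus\{0\}}(z)=\min\left\{\|z\|,\frac{1}{\sqrt n}\right\}.$$
   Context: $\|\cdot\|$ is the Euclidean norm, $B^n$ the open Euclidean unit ball and $\mathbb{D}^n$ the unit polydisk in $\mathbb{C}^n$, $\mathbb{D}=\mathbb{D}^1$; $O(X,Y)$ is the set of holomorphic maps from $X$ into $Y$. Carathéodory pseudodistance on a domain $D$: $c_D(z,w)=\sup\{\tanh^{-1}|\lambda| : f\in O(D,\mathbb{D}),\ f(z)=0,\ f(w)=\lambda\}$, with balls $B^c_D(z,r)=\{w\in D: c_D(z,w)<r\}$. For a bounded domain $D\subset\mathbb{C}^n$ and $z\in D$: generalized squeezing function $s^{\mathbb{D}^n}_D(z)=\sup\{r>0:\ \{w\in\mathbb{C}^n:\max_i|w_i|<r\}\subset f(D)$ for some injective $f\in O(D,\mathbb{D}^n)$ with $f(z)=0\}$; Fridman invariant $\tilde e^{\mathbb{D}^n}_D(z)=\sup\{\tanh(r):\ B^c_D(z,r)\subset f(\mathbb{D}^n)$ for some injective $f\in O(\mathbb{D}^n,D)\}$. *)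

(* Defs.v *)
From HB Require Import structures.
From mathcomp Require Import all_boot all_order all_algebra.
From mathcomp Require Import all_classical all_reals all_analysis.
From mathcomp Require Import complex.

Set Implicit Arguments.
Unset Strict Implicit.
Unset Printing Implicit Defensive.

Import Order.TTheory GRing.Theory Num.Theory.
Import numFieldNormedType.Exports.

Local Open Scope classical_set_scope.
Local Open Scope ring_scope.

(* C^n is 'rV[R[i]]_n, and R[i]^o is C as a normed space over itself; on these
   spaces [differentiable] is complex (Frechet) differentiability.  [normc] is
   the R-valued modulus, whereas `|x| : R[i]. *)
Notation normc := ComplexField.Normc.normc (only parsing).

Section Definitions.
Context {R : realType}.

Definition tanh (x : R) : R := (expR x - expR (- x)) / (expR x + expR (- x)).

Definition atanh (x : R) : R := ln ((1 + x) / (1 - x)) / 2.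

(* The norm `|z| of 'rV[R[i]]_n is the sup norm, hence this definition. *)
Definition enorm n (z : 'rV[R[i]]_n) : R :=
  Num.sqrt (\sum_(i < n) normc (z 0 i) ^+ 2).

Definition unit_ball n : set 'rV[R[i]]_n := [set z | enorm z < 1].

Definition polydisk n (r : R) : set 'rV[R[i]]_n :=
  [set w | forall i, normc (w 0 i) < r].

Definition unit_disk : set R[i]^o := [set x | normc x < 1].

(* O(X, Y) for X an open set: the maps are total functions, of which only the
   values on X matter. *)
Definition holo_maps (V W : normedModType R[i]) (X : set V) (Y : set W) :
  set (V -> W) := [set f | (forall x, X x -> differentiable f x) /\ f @` X `<=` Y].

Definition caratheodory n (D : set 'rV[R[i]]_n) (z w : 'rV[R[i]]_n) : \bar R :=
  ereal_sup [set (atanh (normc (f w)))%:E |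
    f in [set f | holo_maps D unit_disk f /\ f z = 0]].

Definition caratheodory_ball n (D : set 'rV[R[i]]_n) (z : 'rV[R[i]]_n) (r : R) :
  set 'rV[R[i]]_n := [set w | D w /\ (caratheodory D z w < r%:E)%E].

Definition squeezing n (D : set 'rV[R[i]]_n) (z : 'rV[R[i]]_n) : \bar R :=
  ereal_sup [set r%:E | r in [set r : R | 0 < r /\
    exists f, [/\ holo_maps D (@polydisk n 1) f, set_inj D f, f z = 0 &
      @polydisk n r `<=` f @` D]]].

Definition fridman n (D : set 'rV[R[i]]_n) (z : 'rV[R[i]]_n) : \bar R :=
  ereal_sup [set (tanh r)%:E | r in [set r : R | 0 < r /\
    exists f, [/\ holo_maps (@polydisk n 1) D f, set_inj (@polydisk n 1) f &
      caratheodory_ball D z r `<=` f @` @polydisk n 1]]].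

End Definitions.

Arguments unit_ball {R} n.
Arguments polydisk {R} n r.
Arguments unit_disk {R}.

(* Main.v *)
(* The automorphism of the ball exchanging [0] and [z] moves the problem to the
   origin of the ball punctured at [z].

   Upper bounds.  Let [F] be injective and holomorphic from the ball punctured at
   [z] into the polydisk, with [F 0 = 0] and inverse [G], and let its image contain
   the polydisk of radius [r].  The Schwarz lemma on the complex lines through [0]
   that avoid [z] bounds the sup norm of [F x] by [|x|].  Hence, if [|z| < r], [F]
   maps the points near [z] into a compact part of the image, on which [G] stays
   away from [z], a contradiction.  Moreover the columns of [F'(0)] have Euclidean
   norm at most [1], and averaging [|G'(0) w|^2] over all sign vectors [w] bounds the
   Hilbert-Schmidt norm of [G'(0)] by [1 / r]; as [n] is the trace of
   [G'(0) F'(0)], Cauchy-Schwarz gives [n <= sqrt n / r].  For the Fridman invariant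
   the argument is dual, because a Caratheodory ball of radius [r] contains the
   image of the points [x] with [|x| < tanh r].

   Lower bounds.  After a unitary map taking [z] to a multiple of a basis vector, the
   polydisk of radius [min(|z|, 1 / sqrt n)] lies in the ball and misses [z].

   That [F'] is invertible and [G] holomorphic is Osgood's theorem.  Maximality of
   the generic rank of [F'] shows that [det F'] is not identically [0].  Transported
   to the target and extended by [0], it is continuous, and holomorphic where it does
   not vanish, so that its zeros are negligible in the maximum principle; hence [G]
   is locally Lipschitz, and [F'] is injective everywhere. *)

From HB Require Import structures.
Require Import Defs.
From mathcomp Require Import all_boot all_order all_algebra.
From mathcomp Require Import all_classical all_reals all_analysis.
From mathcomp Require Import complex.
From mathcomp Require Import ring lra.

Import Order.TTheory GRing.Theory Num.Theory.
Import numFieldNormedType.Exports.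

Set Implicit Arguments.
Unset Strict Implicit.
Unset Printing Implicit Defensive.

Local Open Scope classical_set_scope.
Local Open Scope ring_scope.

Local Notation Re := complex.Re.
Local Notation Im := complex.Im.

(** * Real-valued norms *)

(** The analytic input is kept to one tool. Goursat's lemma gives the mean value property, and from
    it comes a maximum principle that tolerates an exceptional set, the zeros of an auxiliary factor
    [h]. It serves three times: with [h z = z] for the Schwarz lemma, with [z * (z - s)] for a
    second-order Taylor bound that takes the place of Cauchy's estimates, and with [z] times the
    transported Jacobian determinant for Osgood's theorem. No power series occurs; derivatives of
    holomorphic maps are handled as uniform limits of difference quotients.

    Osgood's theorem enters because the competing maps are only known to be injective and
    holomorphic, while both bounds use the inverse as a holomorphic map, on a whole polydisk or
    punctured ball and not merely at the origin.

    Extension across the puncture is never carried out: for [n >= 2] a small displacement moves any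
    complex line through the origin off a given nonzero point, and continuity does the rest. *)

Section RealNorm.
Context {R : realType}.
Local Notation C := R[i].

(** The norm has values in [R[i]] but is real, so its real part loses nothing. On rows it is the sup
    norm, whose open balls about [0] are the polydisks. *)
Definition nr {E : normedModType C} (x : E) : R := Re `|x|.

Section nr_theory.
Context {E : normedModType C}.
Implicit Types x y : E.

Lemma nrE x : `|x| = (nr x)%:C%C.
Proof. by rewrite /nr RRe_real // normr_real. Qed.

Lemma nr_ge0 x : 0 <= nr x.
Proof. by rewrite -ler0c -nrE. Qed.

Lemma nr_le x (e : R) : (nr x <= e) = (`|x| <= e%:C%C).
Proof. by rewrite nrE lecR. Qed.

Lemma nr_lt x (e : R) : (nr x < e) = (`|x| < e%:C%C).
Proof. by rewrite nrE ltcR. Qed.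

Lemma nr0 : nr (0 : E) = 0.
Proof. by rewrite /nr normr0. Qed.

Lemma nrN x : nr (- x) = nr x.
Proof. by rewrite /nr normrN. Qed.

Lemma nrB x y : nr (x - y) = nr (y - x).
Proof. by rewrite /nr distrC. Qed.

Lemma nr_eq0 x : (nr x == 0) = (x == 0).
Proof. by rewrite -(normr_eq0 x) nrE eq_complex /= eqxx andbT. Qed.

Lemma nr_gt0 x : (0 < nr x) = (x != 0).
Proof. by rewrite lt_def nr_ge0 andbT nr_eq0. Qed.

Lemma nr_triangle x y : nr (x + y) <= nr x + nr y.
Proof. by rewrite -lecR raddfD /= -!nrE ler_normD. Qed.

Lemma nr_rev x y : nr x - nr y <= nr (x - y).
Proof. by have := nr_triangle (x - y) y; rewrite subrK; lra. Qed.

Lemma nr_dist x y z : nr (x - z) <= nr (x - y) + nr (y - z).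
Proof. by have := nr_triangle (x - y) (y - z); rewrite addrA subrK. Qed.
End nr_theory.

Lemma nr_normc (x : C^o) : nr x = normc x.
Proof. by rewrite /nr normc_def; case: x. Qed.

Lemma nrZ (E : normedModType C) (a : C) (x : E) : nr (a *: x) = normc a * nr x.
Proof.
rewrite -(nr_normc a); apply: complexI; rewrite rmorphM /= -!nrE.
exact: normrZ.
Qed.

Lemma nr_coord n (v : 'rV[C]_n) i : normc (v 0 i) <= nr v.
Proof.
rewrite -(nr_normc (v 0 i)) -lecR -!nrE [leRHS]/Num.norm /= mx_normE.
exact: (@le_bigmax _ _ _ _ (fun i : 'I_1 * 'I_n => `|v i.1 i.2|%:nng) (0, i)).
Qed.

Lemma nr_row_le n (v : 'rV[C]_n) (e : R) :
  0 <= e -> (forall i, normc (v 0 i) <= e) -> nr v <= e.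
Proof.
move=> e0 h; rewrite nr_le [leLHS]/Num.norm /=.
have [->|/mx_norm_neq0 [[i j] ->]] := eqVneq (mx_norm v) 0; first by rewrite ler0c.
by have := h j; rewrite ord1 -nr_normc nr_le.
Qed.

Lemma nr_row_lt n (v : 'rV[C]_n) (e : R) :
  0 < e -> (forall i, normc (v 0 i) < e) -> nr v < e.
Proof.
move=> e0 h; rewrite nr_lt [ltLHS]/Num.norm /=.
have [->|/mx_norm_neq0 [[i j] ->]] := eqVneq (mx_norm v) 0; first by rewrite ltcR.
by have := h j; rewrite ord1 -nr_normc nr_lt.
Qed.

Lemma nbhs_nr (E : normedModType C) (x : E) (P : set E) :
  nbhs x P <-> exists2 d : R, 0 < d & forall y, nr (y - x) < d -> P y.
Proof.
split.
  move=> /nbhs_normP [e /= e0 h].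
  have eE : e = (Re e)%:C%C by rewrite RRe_real // gtr0_real.
  exists (Re e); first by rewrite -ltcR -eE.
  by move=> y; rewrite nr_lt -eE -normrN opprB => /h.
move=> [d d0 h]; apply/nbhs_normP; exists d%:C%C; first by rewrite /= ltcR.
by move=> y /= xy; apply: h; rewrite nr_lt -normrN opprB.
Qed.

Lemma nr_ball_open (E : normedModType C) (c : E) (r : R) x : nr (x - c) < r ->
  nbhs x [set y : E | nr (y - c) < r].
Proof.
move=> xr; apply/nbhs_nr; exists (r - nr (x - c)); first by rewrite subr_gt0.
by move=> y yx /=; have := nr_dist y x c; lra.
Qed.

Section eps_delta.
Context {E F : normedModType C}.
Implicit Types (x y : E) (f : E -> F).

Lemma continuous_nr f x : {for x, continuous f} <->
  forall e : R, 0 < e -> exists2 d : R, 0 < d &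
    forall y, nr (y - x) < d -> nr (f y - f x) < e.
Proof.
split.
  move=> cf e e0.
  have /nbhs_nr : nbhs x (f @^-1` [set y | nr (y - f x) < e]).
    by apply: cf; apply/nbhs_nr; exists e.
  by [].
move=> h A /nbhs_nr [e e0 eA].
by have [d d0 dh] := h e e0; apply/nbhs_nr; exists d => // y /dh /eA.
Qed.

Lemma differentiable_nr f x : differentiable f x ->
  forall e : R, 0 < e -> exists2 d : R, 0 < d &
    forall v, nr v < d -> nr (f (x + v) - f x - 'd f x v) <= e * nr v.
Proof.
move=> /diff_locally /eqaddoP df e e0.
have /df/nbhs_nr [d d0 h] : 0 < e%:C%C by rewrite ltcR.
exists d => // v vd; rewrite -lecR rmorphM /= -!nrE.
have := h v; rewrite subr0 => /(_ vd) /=.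
by rewrite !fctE /= opprD addrA (addrC v).
Qed.

(** The bound by [K] makes [L] continuous, which is what uniqueness of the differential requires of
    a candidate. *)
Lemma nr_differentiable f x (L : {linear E -> F}) (K : R) :
  (forall v, nr (L v) <= K * nr v) ->
  (forall e : R, 0 < e -> exists2 d : R, 0 < d &
    forall v, nr v < d -> nr (f (x + v) - f x - L v) <= e * nr v) ->
  differentiable f x /\ 'd f x = L :> (E -> F).
Proof.
move=> LK h.
have cL : continuous L.
  move=> y; apply/continuous_nr => e e0; exists (e / (1 + `|K|)).
    by rewrite divr_gt0 // ltr_pwDl.
  move=> z yz; rewrite -linearB; apply: le_lt_trans (LK _) _.
  have K1 : 0 < 1 + `|K| by rewrite ltr_pwDl.
  have : nr (z - y) * (1 + `|K|) < e by rewrite -ltr_pdivlMr.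
  have := ler_norm K; have := nr_ge0 (z - y); nra.
have hL : f \o shift x = cst (f x) + L +o_ 0 id.
  apply/eqaddoP => e e0.
  have eE : e = (Re e)%:C%C by rewrite RRe_real // gtr0_real.
  have /h [d d0 hd] : 0 < Re e by rewrite -ltcR -eE.
  apply/nbhs_nr; exists d => // v; rewrite subr0 => vd.
  rewrite eE !nrE -rmorphM lecR !fctE /= opprD addrA (addrC v).
  exact: hd.
have dE := diff_unique cL hL.
split=> //; apply/diff_locallyP; split; first by rewrite dE.
by rewrite hL dE.
Qed.

End eps_delta.
End RealNorm.

(** * Complex integrals and Goursat's lemma *)

Section RealCalculus.
Context {R : realType}.
Implicit Types (u G : R -> R) (a b x : R).

Lemma is_derive_eps u x d : is_derive x 1 u d <->
  forall e, 0 < e -> exists2 r, 0 < r &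
    forall h, `|h| < r -> `|u (x + h) - u x - d * h| <= e * `|h|.
Proof.
split=> [[dv dE] e e0|h].
  have := dv; rewrite /derivable => /cvg_ex [l hl].
  have lE : l = d by rewrite -dE; apply/esym; apply: cvg_lim hl.
  move: hl => /cvgrPdist_le /(_ _ e0).
  rewrite /= near_withinE => /nbhs_ballP [r r0 hr].
  exists r => // h hh.
  have [->|h0] := eqVneq h 0; first by rewrite addr0 subrr mulr0 subrr normr0 mulr0.
  have := hr h; rewrite /ball /= sub0r normrN => /(_ hh h0).
  rewrite lE [h *: 1]mulr1 (addrC h) => H.
  have -> : u (x + h) - u x - d * h = - ((d - h^-1 *: (u (x + h) - u x)) * h).
    by rewrite /GRing.scale /=; field.
  by rewrite normrN normrM ler_wpM2r.
have hl : (fun h => h^-1 *: ((u \o shift x) (h *: 1) - u x)) @ 0^' --> d.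
  apply/cvgrPdist_le => e e0; have [r r0 hr] := h e e0.
  rewrite near_withinE; apply/nbhs_ballP; exists r => // k.
  rewrite /ball /= sub0r normrN => kr k0.
  have := hr k kr; rewrite [k *: 1]mulr1 (addrC k).
  have -> : d - k^-1 *: (u (x + k) - u x) = - ((u (x + k) - u x - d * k) / k).
    by rewrite /GRing.scale /=; field.
  by rewrite normrN normrM normfV ler_pdivrMr // normr_gt0.
apply: DeriveDef; first by apply/cvg_ex; exists d.
exact: cvg_lim hl.
Qed.

Lemma exists_lt2 a b : 0 < a -> 0 < b -> exists x, [/\ 0 < x, x < a & x < b].
Proof.
move=> a0 b0; have m0 : 0 < Num.min a b by rewrite lt_min a0.
have [ma mb] : Num.min a b <= a /\ Num.min a b <= b by rewrite !ge_min !lexx orbT.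
by exists (Num.min a b / 2); move: (Num.min a b) m0 ma mb => m *; split; lra.
Qed.

Lemma primitive_exists u a b : a <= b ->
  (forall x, a <= x <= b -> {for x, continuous u}) ->
  exists G, forall x, a <= x <= b -> is_derive x 1 G (u x).
Proof.
(* Clamping extends [u] continuously to the whole line, so that the fundamental theorem applies on a
   larger interval and the derivatives at [a] and [b] are two-sided. *)
move=> ab cu; pose cl x := Num.max a (Num.min b x).
have cl_itv x : a <= cl x <= b.
  by rewrite /cl le_max lexx /= ge_max ab /= ge_min lexx.
have cl_id x : a <= x <= b -> cl x = x.
  by move=> /andP[ax xb]; rewrite /cl (min_idPr xb) (max_idPr ax).
have ccl : continuous cl.
  by move=> x; apply: continuous_max; [exact: cvg_cst|
    apply: continuous_min; [exact: cvg_cst|exact: cvg_id]].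
have cv : continuous (u \o cl).
  by move=> x; apply: continuous_comp; [exact: ccl|exact: cu].
pose F x := (\int[lebesgue_measure]_(t in `[a - 1, x]) (u \o cl) t)%R.
exists F => x /andP[ax xb].
have [dF FE] : derivable F x 1 /\ derive1 F x = (u \o cl) x.
  apply: (@continuous_FTC1_closed _ _ _ _ (b + 1)); [lra| |lra|exact: cv].
  apply: continuous_compact_integrable; first exact: segment_compact.
  by move=> y; apply: continuous_subspaceT.
apply: DeriveDef => //; move: FE; rewrite derive1E => ->.
by rewrite /= cl_id ?ax.
Qed.

Lemma derive_MVT G a b (g : R -> R) : a <= b ->
  (forall x, a <= x <= b -> is_derive x 1 G (g x)) ->
  exists2 c, a <= c <= b & G b - G a = g c * (b - a).
Proof.
move=> ab dG.
have [||c cab GE] := @MVT_segment _ G g a b ab.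
- by move=> x /[!in_itv]/= /andP[ax xb]; apply: dG; rewrite !ltW.
- apply: derivable_within_continuous => x /[!in_itv]/= xab.
  by have [] := dG x xab.
by exists c => //; move: cab; rewrite in_itv.
Qed.

End RealCalculus.

(** * Integrals of complex-valued functions of a real variable *)

Section ComplexIntegral.
Context {R : realType}.
Local Notation C := R[i].
Implicit Types (u v G : R -> C) (a b x : R).

Definition rcont u x := {for x, continuous (fun t => Re (u t))} /\
  {for x, continuous (fun t => Im (u t))}.

Definition cprim a b u : set (R -> C) := [set G | forall x, a <= x <= b ->
  is_derive x 1 (fun t => Re (G t)) (Re (u x)) /\
  is_derive x 1 (fun t => Im (G t)) (Im (u x))].

(** The increment of a chosen primitive; when one exists, all primitives give the same value.
    Algebraic rules are then checked by differentiation and bounds by the mean value theorem. *)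
Definition cint a b u : C :=
  let G := xget (fun=> 0) (cprim a b u) in G b - G a.

Lemma cprim_exists a b u : a <= b -> (forall x, a <= x <= b -> rcont u x) ->
  exists G, cprim a b u G.
Proof.
move=> ab cu.
have [G1 h1] := primitive_exists ab (fun x xab => (cu x xab).1).
have [G2 h2] := primitive_exists ab (fun x xab => (cu x xab).2).
by exists (fun t => (G1 t +i* G2 t)%C) => x xab; split; [exact: h1|exact: h2].
Qed.

Lemma cprim_uniq a b u G G' : a <= b -> cprim a b u G -> cprim a b u G' ->
  G b - G a = G' b - G' a.
Proof.
move=> ab h h'; apply/eqP; rewrite eq_complex !raddfB /=; apply/andP; split; apply/eqP.
- have H x : a <= x <= b -> is_derive x 1
      ((fun t => Re (G t)) - (fun t => Re (G' t))) 0.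
    move=> xab; have [h1 _] := h _ xab; have [h2 _] := h' _ xab.
    by apply: is_derive_eq; rewrite subrr.
  have [c _] := derive_MVT ab H.
  by rewrite mul0r !fctE; lra.
- have H x : a <= x <= b -> is_derive x 1
      ((fun t => Im (G t)) - (fun t => Im (G' t))) 0.
    move=> xab; have [_ h1] := h _ xab; have [_ h2] := h' _ xab.
    by apply: is_derive_eq; rewrite subrr.
  have [c _] := derive_MVT ab H.
  by rewrite mul0r !fctE; lra.
Qed.

Lemma cintE a b u G : a <= b -> cprim a b u G -> cint a b u = G b - G a.
Proof.
move=> ab h; apply: (cprim_uniq ab _ h).
by apply: xgetPex; exists G.
Qed.

Lemma eq_cint a b u v : a <= b -> (forall x, a <= x <= b -> u x = v x) ->
  cint a b u = cint a b v.
Proof.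
move=> ab uv; rewrite /cint; suff -> : cprim a b u = cprim a b v by [].
apply/funext => G; apply/propext; split => h x xab; have := h x xab; rewrite uv //.
Qed.

Lemma cintD a b u v : a <= b -> (forall x, a <= x <= b -> rcont u x) ->
  (forall x, a <= x <= b -> rcont v x) ->
  cint a b (fun t => u t + v t) = cint a b u + cint a b v.
Proof.
move=> ab /(cprim_exists ab) [G hG] /(cprim_exists ab) [G' hG'].
rewrite (cintE ab hG) (cintE ab hG') (@cintE _ _ _ (fun t => G t + G' t)) //.
  by ring.
move=> x xab; have [h1 h2] := hG _ xab; have [h3 h4] := hG' _ xab; split.
  rewrite (_ : (fun t => Re (G t + G' t)) = (fun t => Re (G t)) + (fun t => Re (G' t))).
    by rewrite raddfD; exact: is_deriveD.
  by apply/funext => t; rewrite raddfD.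
rewrite (_ : (fun t => Im (G t + G' t)) = (fun t => Im (G t)) + (fun t => Im (G' t))).
  by rewrite raddfD; exact: is_deriveD.
by apply/funext => t; rewrite raddfD.
Qed.

Lemma cintZ a b (c : C) u : a <= b -> (forall x, a <= x <= b -> rcont u x) ->
  cint a b (fun t => c * u t) = c * cint a b u.
Proof.
move=> ab /(cprim_exists ab) [G hG].
rewrite (cintE ab hG) (@cintE _ _ _ (fun t => c * G t)) //; first by ring.
move=> x xab; have [h1 h2] := hG _ xab; case: c => p q; split.
  rewrite (_ : (fun t => Re _) = p *: (fun t => Re (G t)) - q *: (fun t => Im (G t))).
    have -> : Re ((p +i* q)%C * u x) = p *: Re (u x) - q *: Im (u x) by case: (u x).
    exact: is_deriveB.
  by apply/funext => t; rewrite !fctE; case: (G t).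
rewrite (_ : (fun t => Im _) = p *: (fun t => Im (G t)) + q *: (fun t => Re (G t))).
  have -> : Im ((p +i* q)%C * u x) = p *: Im (u x) + q *: Re (u x) by case: (u x).
  exact: is_deriveD.
by apply/funext => t; rewrite !fctE; case: (G t).
Qed.

Lemma cint_cst a b (c : C) : a <= b -> cint a b (fun=> c) = (b - a)%:C%C * c.
Proof.
move=> ab; rewrite (@cintE _ _ _ (fun t => t%:C%C * c)) //.
  by rewrite rmorphB /=; ring.
move=> x _; case: c => p q /=; split.
  rewrite (_ : (fun t => _) = p *: id); last first.
    by apply/funext => t; rewrite fctE /= mul0r subr0 mulrC.
  by apply: is_derive_eq; rewrite [LHS]mulr1.
rewrite (_ : (fun t => _) = q *: id); last first.
  by apply/funext => t; rewrite fctE /= mul0r addr0 mulrC.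
by apply: is_derive_eq; rewrite [LHS]mulr1.
Qed.

Lemma cint_split a b c u : a <= b -> b <= c ->
  (forall x, a <= x <= c -> rcont u x) ->
  cint a c u = cint a b u + cint b c u.
Proof.
move=> ab bc /(cprim_exists (le_trans ab bc)) [G hG].
rewrite (cintE (le_trans ab bc) hG) (@cintE a b _ G) // ?(@cintE b c _ G) //.
- by ring.
- by move=> x /andP[bx xc]; apply: hG; rewrite xc (le_trans ab).
- by move=> x /andP[ax xb]; apply: hG; rewrite ax (le_trans xb).
Qed.

Lemma cint_ge0 a b u : a <= b -> (forall x, a <= x <= b -> rcont u x) ->
  (forall x, a <= x <= b -> 0 <= Re (u x)) -> 0 <= Re (cint a b u).
Proof.
move=> ab /(cprim_exists ab) [G hG] u0; rewrite (cintE ab hG) raddfB /=.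
have [c cab ->] := derive_MVT ab (fun x xab => (hG x xab).1).
by rewrite mulr_ge0 ?u0 // subr_ge0.
Qed.

Lemma normc_ReIm (z : C) (M : R) : `|Re z| <= M -> `|Im z| <= M -> normc z <= 2 * M.
Proof.
case: z => x y /= hx hy.
have M0 : 0 <= M := le_trans (normr_ge0 _) hx.
rewrite -(ler_sqr (x := Num.sqrt _)) ?nnegrE ?sqrtr_ge0 ?mulr_ge0 //.
rewrite sqr_sqrtr ?addr_ge0 ?sqr_ge0 //.
have hx2 : x ^+ 2 <= M ^+ 2 by rewrite -[x ^+ 2]real_normK ?num_real // ler_sqr ?nnegrE.
have hy2 : y ^+ 2 <= M ^+ 2 by rewrite -[y ^+ 2]real_normK ?num_real // ler_sqr ?nnegrE.
have := sqr_ge0 M; lra.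
Qed.

Lemma normc_Re (z : C) : `|Re z| <= normc z.
Proof.
case: z => x y /=; rewrite -sqrtr_sqr ler_sqrt ?addr_ge0 ?sqr_ge0 //.
by rewrite lerDl sqr_ge0.
Qed.

Lemma normc_Im (z : C) : `|Im z| <= normc z.
Proof.
case: z => x y /=; rewrite -sqrtr_sqr ler_sqrt ?addr_ge0 ?sqr_ge0 //.
by rewrite lerDr sqr_ge0.
Qed.

(** The mean value theorem is applied to the real and imaginary parts separately, whence the factor
    2. It is harmless, since only smallness of integrals is drawn from this bound. *)
Lemma cint_le a b u (M : R) : a <= b -> (forall x, a <= x <= b -> rcont u x) ->
  (forall x, a <= x <= b -> normc (u x) <= M) ->
  normc (cint a b u) <= 2 * (M * (b - a)).
Proof.
move=> ab /(cprim_exists ab) [G hG] uM; rewrite (cintE ab hG).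
have ba : `|b - a| = b - a by rewrite ger0_norm // subr_ge0.
apply: normc_ReIm; rewrite raddfB /=.
  have [c cab ->] := derive_MVT ab (fun x xab => (hG x xab).1).
  rewrite normrM ba ler_wpM2r ?subr_ge0 //.
  exact: le_trans (normc_Re _) (uM _ cab).
have [c cab ->] := derive_MVT ab (fun x xab => (hG x xab).2).
rewrite normrM ba ler_wpM2r ?subr_ge0 //.
exact: le_trans (normc_Im _) (uM _ cab).
Qed.

End ComplexIntegral.

#[local] Arguments ComplexField.Normc.normc : simpl never.

(** * Bisection of rectangles *)

Section Bisection.
Context {R : realType}.

Lemma lt_expr2 (x e : R) : 0 < e -> exists n : nat, x / 2 ^+ n < e.
Proof.
move=> e0; exists (Num.bound (`|x| / e)).
set n := Num.bound _.
have h : `|x| / e < n%:R by apply: archi_boundP; rewrite divr_ge0 // ltW.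
have n2 : n%:R < 2 ^+ n :> R by rewrite -natrX ltr_nat ltn_expl.
rewrite ltr_pdivrMr ?exprn_gt0 //.
apply: le_lt_trans (ler_norm x) _.
move: h; rewrite ltr_pdivrMr // => /lt_trans; apply.
by rewrite mulrC ltr_pM2l.
Qed.

Lemma nested_intervals (u v : nat -> R) :
  (forall n, u n <= u n.+1) -> (forall n, v n.+1 <= v n) ->
  (forall n, u n <= v n) -> exists s, forall n, u n <= s <= v n.
Proof.
move=> /nondecreasing_seqP hu /nonincreasing_seqP hv uv.
have uvm n m : u n <= v m.
  apply: le_trans (hu _ _ (leq_maxl n m)) _; apply: le_trans (uv _) _.
  exact: hv (leq_maxr n m).
have hs : has_sup (range u).
  by split; [exists (u 0%N), 0%N|exists (v 0%N) => _ [n _ <-]].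
exists (sup (range u)) => n; apply/andP; split.
  by apply: ub_le_sup; [case: hs|exists n].
by apply: ge_sup; [case: hs|move=> _ [m _ <-]].
Qed.

(** If [P] failed on the whole rectangle it would fail on a quarter, then on a quarter of that one,
    and so on; these rectangles shrink to a point, where the last hypothesis contradicts the
    failure. *)
Lemma bisection2 (P : R -> R -> R -> R -> Prop) (a b c d : R) :
  a <= b -> c <= d ->
  (forall a' b' c' d', a <= a' -> a' <= b' -> b' <= b ->
     c <= c' -> c' <= d' -> d' <= d ->
     let m := (a' + b') / 2 in let n := (c' + d') / 2 in
     P a' m c' n -> P m b' c' n -> P a' m n d' -> P m b' n d' ->
     P a' b' c' d') ->
  (forall s t, a <= s <= b -> c <= t <= d -> exists2 r, 0 < r &
     forall a' b' c' d', a <= a' -> a' <= s -> s <= b' -> b' <= b ->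
     c <= c' -> c' <= t -> t <= d' -> d' <= d ->
     b' - a' < r -> d' - c' < r -> P a' b' c' d') ->
  P a b c d.
Proof.
move=> ab cd quarter local; apply: contrapT => nP.
pose Q (r : R * R * (R * R)) := P r.1.1 r.1.2 r.2.1 r.2.2.
pose q1 (r : R * R * (R * R)) := ((r.1.1, (r.1.1 + r.1.2) / 2), (r.2.1, (r.2.1 + r.2.2) / 2)).
pose q2 (r : R * R * (R * R)) := (((r.1.1 + r.1.2) / 2, r.1.2), (r.2.1, (r.2.1 + r.2.2) / 2)).
pose q3 (r : R * R * (R * R)) := ((r.1.1, (r.1.1 + r.1.2) / 2), ((r.2.1 + r.2.2) / 2, r.2.2)).
pose q4 (r : R * R * (R * R)) := (((r.1.1 + r.1.2) / 2, r.1.2), ((r.2.1 + r.2.2) / 2, r.2.2)).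
(* A quarter where [Q] fails is selected; [q4] is taken untested after three successes, and
   [quarter] then shows that [Q] fails there. *)
pose step r := if `[< Q (q1 r) >] then if `[< Q (q2 r) >] then
  if `[< Q (q3 r) >] then q4 r else q3 r else q2 r else q1 r.
pose rs n := iter n step ((a, b), (c, d)).
have stepP r : [\/ step r = q1 r, step r = q2 r, step r = q3 r | step r = q4 r].
  rewrite /step; case: ifP => _; last by constructor 1.
  case: ifP => _; last by constructor 2.
  by case: ifP => _; [constructor 4|constructor 3].
have inv n : [/\ a <= (rs n).1.1, (rs n).1.1 <= (rs n).1.2, (rs n).1.2 <= b,
    c <= (rs n).2.1 & (rs n).2.1 <= (rs n).2.2 /\ (rs n).2.2 <= d] /\
    [/\ ~ Q (rs n), (rs n).1.2 - (rs n).1.1 = (b - a) / 2 ^+ n &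
      (rs n).2.2 - (rs n).2.1 = (d - c) / 2 ^+ n].
  elim: n => [|n [[h1 h2 h3 h4 [h5 h6]] [h7 h8 h9]]].
    by rewrite /rs /= !expr0 !divr1.
  rewrite /rs iterS -/(rs n); split; last split.
  - have [] := stepP (rs n) => ->; move: h1 h2 h3 h4 h5 h6; rewrite /q1 /q2 /q3 /q4;
      case: (rs n) => [[p q] [x y]] /=; clear; move=> h1 h2 h3 h4 h5 h6; (split; [lra|lra|lra|lra|split; lra]).
  - rewrite /step; case: asboolP => // p1; case: asboolP => // p2.
    case: asboolP => // p3; move=> p4; apply: h7.
    exact: quarter p1 p2 p3 p4.
  - rewrite exprS invfM (mulrC 2^-1) mulrA -h8.
    by have [] := stepP (rs n) => ->; rewrite /q1 /q2 /q3 /q4;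
      case: (rs n) => [[p q] [x y]] /=; field.
  - rewrite exprS invfM (mulrC 2^-1) mulrA -h9.
    by have [] := stepP (rs n) => ->; rewrite /q1 /q2 /q3 /q4;
      case: (rs n) => [[p q] [x y]] /=; field.
have mono n : [/\ (rs n).1.1 <= (rs n.+1).1.1, (rs n.+1).1.2 <= (rs n).1.2,
    (rs n).2.1 <= (rs n.+1).2.1 & (rs n.+1).2.2 <= (rs n).2.2].
  have [[_ h2 _ _ [h5 _]] _] := inv n; rewrite /rs iterS -/(rs n); move: h2 h5.
  by have [] := stepP (rs n) => ->; rewrite /q1 /q2 /q3 /q4; case: (rs n) => [[p q] [x y]] /=;
    clear; move=> h h'; split; lra.
have [s hs] : exists s, forall n, (rs n).1.1 <= s <= (rs n).1.2.
  by apply: nested_intervals => n; have [] := mono n => //; have [[]] := inv n.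
have [t ht] : exists s, forall n, (rs n).2.1 <= s <= (rs n).2.2.
  by apply: nested_intervals => n; have [] := mono n => //; have [[_ _ _ _ []]] := inv n.
have [r r0 hr] := local s t (hs 0%N) (ht 0%N).
have [n hn] := lt_expr2 ((b - a) + (d - c)) r0.
have [[h1 h2 h3 h4 [h5 h6]] [h7 h8 h9]] := inv n.
have /andP[s1 s2] := hs n; have /andP[t1 t2] := ht n.
apply: h7; apply: hr => //.
- rewrite h8; apply: le_lt_trans hn.
  by rewrite ler_wpM2r ?invr_ge0 ?exprn_ge0 // lerDl subr_ge0.
- rewrite h9; apply: le_lt_trans hn.
  by rewrite ler_wpM2r ?invr_ge0 ?exprn_ge0 // lerDr subr_ge0.
Qed.
End Bisection.

(** * Goursat's lemma on rectangles *)

Section Goursat.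
Context {R : realType}.
Local Notation C := R[i].
Implicit Types (U V : C^o -> C^o) (a b c d s t : R) (z : C^o).

Lemma normcD (x y : C) : normc (x + y) <= normc x + normc y.
Proof. exact: le_normcD. Qed.

Lemma normcM (x y : C) : normc (x * y) = normc x * normc y.
Proof. exact: ComplexField.Normc.normcM. Qed.

Lemma normcN (x : C) : normc (- x) = normc x.
Proof. exact: complex.normcN. Qed.

Lemma normcB (x y : C) : normc (x - y) = normc (y - x).
Proof. by rewrite -normcN opprB. Qed.

Lemma normc_ge0 (x : C) : 0 <= normc x.
Proof. by case: x => x y; exact: sqrtr_ge0. Qed.

Lemma normc_eq0 (x : C) : (normc x == 0) = (x == 0).
Proof.
apply/eqP/eqP => [|->]; first exact: ComplexField.Normc.eq0_normc.
exact: ComplexField.Normc.normc0.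
Qed.

Lemma normc0 : normc (0 : C) = 0.
Proof. exact: ComplexField.Normc.normc0. Qed.

Lemma normc1 : normc (1 : C) = 1.
Proof. exact: ComplexField.Normc.normc1. Qed.

Lemma normcV (x : C) : normc x^-1 = (normc x)^-1.
Proof. exact: ComplexField.Normc.normcV. Qed.

Lemma normc_gt0 (x : C) : (0 < normc x) = (x != 0).
Proof. by rewrite lt_def normc_ge0 andbT normc_eq0. Qed.

Lemma normc_real (x : R) : normc (x%:C%C) = `|x|.
Proof. by rewrite /ComplexField.Normc.normc /= expr0n addr0 sqrtr_sqr. Qed.

Lemma normc_le_eps (x : C) : (forall e : R, 0 < e -> normc x <= e) -> x = 0.
Proof.
move=> h; apply/eqP; rewrite -normc_eq0; apply/eqP/le_anti; rewrite normc_ge0 andbT.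
by apply/ler_addgt0Pr => e e0; rewrite add0r h.
Qed.

Lemma normc_i : normc ('i%C : C) = 1.
Proof. by rewrite /ComplexField.Normc.normc /= expr0n add0r expr1n sqrtr1. Qed.

Lemma normc_le_add (x y : R) : normc (x +i* y)%C <= `|x| + `|y|.
Proof.
rewrite [(x +i* y)%C]complexE; apply: le_trans (normcD _ _) _.
by rewrite normcM normc_i !normc_real mul1r.
Qed.

Lemma continuous_normc U z : {for z, continuous U} <->
  forall e : R, 0 < e -> exists2 r : R, 0 < r &
    forall y, normc (y - z) < r -> normc (U y - U z) < e.
Proof.
apply: iff_trans (continuous_nr _ _) _.
by split=> h e /h [r r0 hr]; exists r.
Qed.

Lemma diffC U z (h : C) : differentiable U z -> 'd U z h = h * 'd U z 1.
Proof. by move=> _; rewrite -[h in LHS]mulr1; exact: linearZ. Qed.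

Lemma differentiable_normc U z : differentiable U z ->
  forall e : R, 0 < e -> exists2 r : R, 0 < r & forall h, normc h < r ->
    normc (U (z + h) - U z - h * 'd U z 1) <= e * normc h.
Proof.
move=> dU e e0; have [r r0 hr] := differentiable_nr dU e0.
exists r => // h hh; rewrite -diffC // -!nr_normc.
by apply: hr; rewrite nr_normc.
Qed.

Lemma normc_differentiable U z (l : C) :
  (forall e : R, 0 < e -> exists2 r : R, 0 < r & forall h, normc h < r ->
    normc (U (z + h) - U z - h * l) <= e * normc h) ->
  differentiable U z /\ 'd U z 1 = l.
Proof.
move=> H.
have Llin : linear (fun h : C^o => h * l : C^o).
  by move=> a x y; rewrite mulrDl -scalerAl.
pose LM := GRing.isLinear.Build _ _ _ _ _ Llin.
pose L : {linear C^o -> C^o} := HB.pack (fun h : C^o => h * l : C^o) LM.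
have [||dU dE] := @nr_differentiable _ _ _ U z L (normc l).
- by move=> v; rewrite /L /= !nr_normc normcM mulrC.
- by move=> e /H [r r0 hr]; exists r.
by split=> //; rewrite dE [LHS]mul1r.
Qed.

Lemma rcont_eps (u : R -> C) x :
  (forall e : R, 0 < e -> exists2 r : R, 0 < r &
    forall y, `|y - x| < r -> normc (u y - u x) < e) -> rcont u x.
Proof.
move=> h; split; apply/cvgrPdist_lt => e /h [r r0 hr].
  apply/nbhs_ballP; exists r => // y; rewrite /ball /= distrC => /hr yx.
  by rewrite -raddfB; apply: le_lt_trans (normc_Re _) _; rewrite normcB.
apply/nbhs_ballP; exists r => // y; rewrite /ball /= distrC => /hr yx.
by rewrite -raddfB; apply: le_lt_trans (normc_Im _) _; rewrite normcB.
Qed.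

Lemma rcont_comp U (g : R -> C) x : {for g x, continuous U} ->
  (forall y, normc (g y - g x) <= `|y - x|) -> rcont (fun s => U (g s)) x.
Proof.
move=> /continuous_normc cU hg; apply: rcont_eps => e /cU [r r0 hr].
by exists r => // y yx; apply: hr; exact: le_lt_trans (hg y) yx.
Qed.

Lemma normc_subRe (a b c : R) : normc ((a +i* c) - (b +i* c))%C = `|a - b|.
Proof. by rewrite /ComplexField.Normc.normc /= subrr expr0n addr0 sqrtr_sqr. Qed.

Lemma normc_subIm (a b c : R) : normc ((c +i* a) - (c +i* b))%C = `|a - b|.
Proof. by rewrite /ComplexField.Normc.normc /= subrr expr0n add0r sqrtr_sqr. Qed.

Definition rect_cont U a b c d := forall s t, a <= s <= b -> c <= t <= d ->
  {for ((s +i* t)%C : C^o), continuous U}.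

Lemma rcontH U a b c d t : rect_cont U a b c d -> c <= t <= d ->
  forall s, a <= s <= b -> rcont (fun s => U (s +i* t)%C) s.
Proof.
move=> cU tcd s sab; apply: rcont_comp; first exact: cU.
by move=> y; rewrite normc_subRe.
Qed.

Lemma rcontV U a b c d s : rect_cont U a b c d -> a <= s <= b ->
  forall t, c <= t <= d -> rcont (fun t => U (s +i* t)%C) t.
Proof.
move=> cU tcd t sab; apply: rcont_comp; first exact: cU.
by move=> y; rewrite normc_subIm.
Qed.

(* The integral of [U z dz] along the positively oriented boundary of [a, b] x [c, d]. *)
Definition rect_int U a b c d : C :=
  cint a b (fun s => U (s +i* c)%C) - cint a b (fun s => U (s +i* d)%C) +
  'i%C * (cint c d (fun t => U (b +i* t)%C) - cint c d (fun t => U (a +i* t)%C)).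

Lemma rect_intD U V a b c d : a <= b -> c <= d ->
  rect_cont U a b c d -> rect_cont V a b c d ->
  rect_int (fun z => U z + V z) a b c d = rect_int U a b c d + rect_int V a b c d.
Proof.
move=> ab cd cU cV; rewrite /rect_int.
have aa : a <= a <= b by rewrite lexx ab.
have bb : a <= b <= b by rewrite lexx ab.
have cc : c <= c <= d by rewrite lexx cd.
have dd : c <= d <= d by rewrite lexx cd.
rewrite (cintD ab (rcontH cU cc) (rcontH cV cc)) (cintD ab (rcontH cU dd) (rcontH cV dd)).
rewrite (cintD cd (rcontV cU aa) (rcontV cV aa)) (cintD cd (rcontV cU bb) (rcontV cV bb)).
by ring.
Qed.

Lemma rect_int_le U a b c d (M : R) : a <= b -> c <= d ->
  rect_cont U a b c d ->
  (forall s t, a <= s <= b -> c <= t <= d -> normc (U (s +i* t)%C) <= M) ->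
  normc (rect_int U a b c d) <= 4 * (M * ((b - a) + (d - c))).
Proof.
move=> ab cd cU hM; rewrite /rect_int.
have aa : a <= a <= b by rewrite lexx ab.
have bb : a <= b <= b by rewrite lexx ab.
have cc : c <= c <= d by rewrite lexx cd.
have dd : c <= d <= d by rewrite lexx cd.
have h1 := cint_le ab (rcontH cU cc) (fun s sab => hM s c sab cc).
have h2 := cint_le ab (rcontH cU dd) (fun s sab => hM s d sab dd).
have h3 := cint_le cd (rcontV cU bb) (fun t tcd => hM b t bb tcd).
have h4 := cint_le cd (rcontV cU aa) (fun t tcd => hM a t aa tcd).
apply: le_trans (normcD _ _) _; rewrite normcM normc_i mul1r.
have := normcD (cint a b (fun s => U (s +i* c)%C)) (- cint a b (fun s => U (s +i* d)%C)).
have := normcD (cint c d (fun t => U (b +i* t)%C)) (- cint c d (fun t => U (a +i* t)%C)).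
rewrite !normcN; lra.
Qed.

Lemma rect_int_quarter U a m b c n d : a <= m -> m <= b -> c <= n -> n <= d ->
  rect_cont U a b c d ->
  rect_int U a b c d = rect_int U a m c n + rect_int U m b c n +
    (rect_int U a m n d + rect_int U m b n d).
Proof.
move=> am mb cn nd cU.
have ab := le_trans am mb; have cd := le_trans cn nd.
have aa : a <= a <= b by rewrite lexx ab.
have bb : a <= b <= b by rewrite lexx ab.
have cc : c <= c <= d by rewrite lexx cd.
have dd : c <= d <= d by rewrite lexx cd.
have mm : a <= m <= b by rewrite am.
have nn : c <= n <= d by rewrite cn.
rewrite /rect_int (cint_split am mb (rcontH cU cc)) (cint_split am mb (rcontH cU dd)).
rewrite (cint_split cn nd (rcontV cU aa)) (cint_split cn nd (rcontV cU bb)).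
by ring.
Qed.

Lemma cint_id a b : a <= b ->
  cint a b (fun s => s%:C%C) = ((b ^+ 2 - a ^+ 2) / 2)%:C%C.
Proof.
move=> ab; rewrite (@cintE _ _ _ _ (fun t => (t ^+ 2 / 2)%:C%C)) //.
  by rewrite -rmorphB /=; congr (_%:C)%C; ring.
move=> x _ /=; split; last exact: is_derive_cst.
have -> : (fun t : R => t ^+ 2 / 2) = 2^-1 *: (id ^+ 2).
  by apply/funext => t; rewrite !fctE mulrC.
by apply: is_derive_eq; rewrite /GRing.scale /= expr1; field.
Qed.

Lemma continuous_affine (p q : C) (z : C^o) :
  {for z, continuous (fun z : C^o => p + q * z : C^o)}.
Proof.
apply/continuous_normc => e e0; exists (e / (normc q + 1)).
  by rewrite divr_gt0 // ltr_wpDl ?normc_ge0.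
move=> y; rewrite ltr_pdivlMr ?ltr_wpDl ?normc_ge0 //.
have -> : p + q * y - (p + q * z) = q * (y - z) by ring.
rewrite normcM; have := normc_ge0 (y - z); have := normc_ge0 q; nra.
Qed.

(** Affine integrands are integrated explicitly. This is what allows a function to be replaced by
    its remainder after the first-order expansion at a point. *)
Lemma rect_int_affine (p q : C) a b c d : a <= b -> c <= d ->
  rect_int (fun z => p + q * z) a b c d = 0.
Proof.
move=> ab cd; rewrite /rect_int.
have E (u v : C) (x y : R) : x <= y ->
    cint x y (fun s => u + v * s%:C%C) =
    (y - x)%:C%C * u + v * ((y ^+ 2 - x ^+ 2) / 2)%:C%C.
  move=> xy.
  have h1 s : x <= s <= y -> rcont (fun=> u) s.
    by move=> _; apply: rcont_eps => e e0; exists 1 => // z _;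
      rewrite subrr normc0.
  have h2 s : x <= s <= y -> rcont (fun s => s%:C%C) s.
    move=> _; apply: rcont_eps => e e0; exists e => // z.
    by rewrite -rmorphB normc_real.
  have h3 s : x <= s <= y -> rcont (fun s => v * s%:C%C) s.
    move=> _; apply: (rcont_comp (U := fun z => v * z) (g := real_complex R)).
      have := @continuous_affine 0 v s%:C%C.
      rewrite (_ : (fun z => 0 + v * z) = (fun z => v * z)) //.
      by apply/funext => z; rewrite add0r.
    by move=> z; rewrite -rmorphB normc_real.
  by rewrite cintD // cint_cst // cintZ // cint_id.
have E1 (t : R) : (fun s : R => p + q * (s +i* t)%C) =
    (fun s => (p + q * ('i%C * t%:C%C)) + q * s%:C%C).
  by apply/funext => s; rewrite (complexE (s +i* t)%C) /=; ring.
have E2 (t : R) : (fun s : R => p + q * (t +i* s)%C) =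
    (fun s => (p + q * t%:C%C) + (q * 'i%C) * s%:C%C).
  by apply/funext => s; rewrite (complexE (t +i* s)%C) /=; ring.
rewrite !E1 !E2 !E // !rmorphB /=.
by ring.
Qed.

(** The bound by [e] times the squared half-perimeter passes from quarters to the whole, each
    quarter having a fourth of that square. On small rectangles around a point it holds because [U]
    is there close to its affine approximation, whose integral vanishes. Then [e] tends to 0. *)
Lemma goursat U a b c d : a <= b -> c <= d ->
  (forall s t, a <= s <= b -> c <= t <= d -> differentiable U ((s +i* t)%C : C^o)) ->
  rect_int U a b c d = 0.
Proof.
move=> ab cd dU.
have cU a' b' c' d' : a <= a' -> b' <= b -> c <= c' -> d' <= d ->
    rect_cont U a' b' c' d'.
  move=> aa' b'b cc' d'd s t /andP[a's sb'] /andP[c't td'].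
  by apply: differentiable_continuous; apply: dU; apply/andP; split; lra.
suff H e : 0 < e -> normc (rect_int U a b c d) <= e * ((b - a) + (d - c)) ^+ 2.
  apply: normc_le_eps => e e0.
  have w0 : 0 < ((b - a) + (d - c)) ^+ 2 + 1 by rewrite ltr_wpDl ?sqr_ge0.
  have := H (e / (((b - a) + (d - c)) ^+ 2 + 1)) (divr_gt0 e0 w0).
  move=> /le_trans; apply; rewrite mulrAC ler_pdivrMr //.
  by rewrite mulrDr mulr1 lerDl ltW.
move=> e0.
apply: (bisection2 (P := fun a b c d =>
  normc (rect_int U a b c d) <= e * ((b - a) + (d - c)) ^+ 2)) => //.
  move=> a' b' c' d' h1 h2 h3 h4 h5 h6 m n p1 p2 p3 p4.
  rewrite (@rect_int_quarter U a' m b' c' n d') /m /n; try lra; last exact: cU.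
  rewrite -/m -/n.
  have := normcD (rect_int U a' m c' n + rect_int U m b' c' n)
    (rect_int U a' m n d' + rect_int U m b' n d').
  have := normcD (rect_int U a' m c' n) (rect_int U m b' c' n).
  have := normcD (rect_int U a' m n d') (rect_int U m b' n d').
  have E x y : x = (b' - a') / 2 -> y = (d' - c') / 2 ->
     e * (x + y) ^+ 2 = (e * ((b' - a') + (d' - c')) ^+ 2) / 4.
    by move=> -> ->; field.
  have m1 : m - a' = (b' - a') / 2 by rewrite /m; field.
  have m2 : b' - m = (b' - a') / 2 by rewrite /m; field.
  have n1 : n - c' = (d' - c') / 2 by rewrite /n; field.
  have n2 : d' - n = (d' - c') / 2 by rewrite /n; field.
  rewrite (E _ _ m1 n1) in p1; rewrite (E _ _ m2 n1) in p2.
  rewrite (E _ _ m1 n2) in p3; rewrite (E _ _ m2 n2) in p4.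
  move: p1 p2 p3 p4; clear; lra.
move=> s t sab tcd; set z : C^o := (s +i* t)%C.
(* The quarter absorbs the factor 4 of [rect_int_le]. *)
have e4 : 0 < e / 4 by lra.
have dz := dU s t sab tcd.
have [r r0 hr] := differentiable_normc dz e4.
exists (r / 2); first by lra.
move=> a' b' c' d' aa' a's sb' b'b cc' c't td' d'd ba dc.
set l := 'd U z 1 in hr.
have a'b' := le_trans a's sb'; have c'd' := le_trans c't td'.
(* The remainder of the first-order expansion of [U] at [z]. *)
pose V (w : C^o) : C^o := U w + (- (U z - l * z) + (- l) * w).
have UE : U = (fun w => V w + ((U z - l * z) + l * w)).
  by apply/funext => w; rewrite /V; ring.
have cV : rect_cont V a' b' c' d'.
  move=> x y hx hy.
  have h := cU a' b' c' d' aa' b'b cc' d'd x y hx hy.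
  by have := continuousD h (@continuous_affine (- (U z - l * z)) (- l) _).
have cA : rect_cont (fun w => (U z - l * z) + l * w) a' b' c' d'.
  by move=> x y _ _; exact: continuous_affine.
rewrite UE (rect_intD a'b' c'd' cV cA) (rect_int_affine _ _ a'b' c'd') addr0.
apply: le_trans (rect_int_le (M := e / 4 * ((b' - a') + (d' - c'))) a'b' c'd' cV _) _.
  move=> x y /andP[hx1 hx2] /andP[hy1 hy2].
  set w := (x +i* y)%C.
  have wz : normc (w - z) <= (b' - a') + (d' - c').
    have -> : w - z = ((x - s) +i* (y - t))%C by [].
    apply: le_trans (normc_le_add _ _) _.
    by apply: lerD; rewrite ler_norml; apply/andP; split; lra.
  have wr : normc (w - z) < r by lra.
  have -> : V w = U (z + (w - z)) - U z - (w - z) * l.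
    by rewrite (_ : z + (w - z) = w) /V; ring.
  apply: le_trans (hr _ wr) _.
  by rewrite ler_pM2l.
by rewrite le_eqVlt; apply/orP; left; apply/eqP; field.
Qed.

End Goursat.

(** * The complex exponential *)

Section ComplexExponential.
Context {R : realType}.
Local Notation C := R[i].

Definition expC (z : C^o) : C^o := (expR (Re z))%:C%C * (cos (Im z) +i* sin (Im z))%C.

Lemma expCD (z w : C) : expC (z + w) = expC z * expC w.
Proof.
rewrite /expC !raddfD /= expRD cosD sinD rmorphM /=.
set a := expR _; set b := expR _.
have -> : ((cos (Im z) * cos (Im w) - sin (Im z) * sin (Im w))
    +i* (sin (Im z) * cos (Im w) + cos (Im z) * sin (Im w)))%C =
  (cos (Im z) +i* sin (Im z))%C * (cos (Im w) +i* sin (Im w))%C :> C.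
  by apply/eqP; rewrite eq_complex /= eqxx /= addrC.
by ring.
Qed.

Lemma normc_cos_sin (t : R) : normc (cos t +i* sin t)%C = 1.
Proof. by rewrite /ComplexField.Normc.normc cos2Dsin2 sqrtr1. Qed.

Lemma normc_expC (z : C) : normc (expC z) = expR (Re z).
Proof. by rewrite /expC normcM normc_real normc_cos_sin mulr1 ger0_norm ?expR_ge0. Qed.

Lemma expC_eps (e : R) : 0 < e -> exists2 r : R, 0 < r & forall h : C,
  normc h < r -> normc (expC h - 1 - h) <= e * normc h.
Proof.
(* The errors [E1] and [E2] below add up to at most [9 * d * normc h], hence the 16; [d <= 1] keeps
   [expR (Re h)] below 3. *)
move=> e0; pose d := Num.min (e / 16) 1.
have d0 : 0 < d by rewrite lt_min ltr01 andbT; lra.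
have de : d <= e / 16 by rewrite ge_min lexx.
have d1 : d <= 1 by rewrite ge_min lexx orbT.
clearbody d.
have [r1 r10 h1] := (is_derive_eps _ _ _).1 (is_derive_expR (0 : R)) _ d0.
have [r2 r20 h2] := (is_derive_eps _ _ _).1 (is_derive_cos (0 : R)) _ d0.
have [r3 r30 h3] := (is_derive_eps _ _ _).1 (is_derive_sin (0 : R)) _ d0.
exists (Num.min (Num.min r1 r2) (Num.min r3 d)); first by rewrite !lt_min r10 r20 r30 d0.
move=> h; rewrite !lt_min => /andP[/andP[hr1 hr2] /andP[hr3 hd]].
have hx := normc_Re h; have hy := normc_Im h.
have := h1 (Re h) (le_lt_trans hx hr1).
have := h2 (Im h) (le_lt_trans hy hr2).
have := h3 (Im h) (le_lt_trans hy hr3).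
rewrite !add0r expR0 cos0 sin0 oppr0 mul0r !subr0 !mul1r ?addr0.
set a := expR _; set x := Re h; set y := Im h; set c := cos y; set s := sin y.
rewrite -/x -/y in hx hy *.
move=> hs hc ha.
have -> : expC h - 1 - h = ((a * c - 1 - x) +i* (a * s - y))%C.
  rewrite /expC -/a -/x -/y; apply/eqP; rewrite eq_complex.
  by apply/andP; split; apply/eqP; rewrite !raddfB /= -/x -/y -/c -/s; ring.
apply: le_trans (normc_le_add _ _) _.
have xh0 := normr_ge0 x; have yh0 := normr_ge0 y.
have a1 : `|a - 1| <= 2 * `|x|.
  rewrite (_ : a - 1 = (a - 1 - x) + x); last by ring.
  apply: le_trans (ler_normD _ _) _; nra.
have aa : `|a| <= 3.
  rewrite (_ : a = (a - 1) + 1); last by ring.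
  apply: le_trans (ler_normD _ _) _; rewrite normr1; lra.
have E1 : `|a * c - 1 - x| <= d * `|x| + 3 * (d * `|y|).
  rewrite (_ : a * c - 1 - x = (a - 1 - x) + a * (c - 1)); last by ring.
  apply: le_trans (ler_normD _ _) _; rewrite normrM; apply: lerD => //.
  by apply: ler_pM.
have E2 : `|a * s - y| <= 2 * d * `|y| + 3 * (d * `|y|).
  rewrite (_ : a * s - y = (a - 1) * y + a * (s - y)); last by ring.
  apply: le_trans (ler_normD _ _) _; rewrite !normrM; apply: lerD.
    by rewrite ler_wpM2r //; lra.
  by apply: ler_pM.
have hn := normc_ge0 h.
have : d * `|x| <= e / 16 * normc h by apply: ler_pM => //; exact: ltW.
have : d * `|y| <= e / 16 * normc h by apply: ler_pM => //; exact: ltW.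
have := mulr_ge0 (ltW e0) hn.
lra.
Qed.

Lemma differentiable_expC (z : C^o) : differentiable expC z.
Proof.
suff [] : differentiable expC z /\ 'd expC z 1 = expC z by [].
apply: normc_differentiable => e e0.
have n0 : 0 < normc (expC z) by rewrite normc_expC expR_gt0.
have [r r0 hr] := expC_eps (divr_gt0 e0 n0).
exists r => // h /hr; rewrite mulrAC ler_pdivlMr // => H.
rewrite expCD (_ : _ - _ = (expC h - 1 - h) * expC z); last by ring.
by rewrite normcM.
Qed.

End ComplexExponential.

(** * The mean value property on circles *)

Section MeanValue.
Context {R : realType}.
Local Notation C := R[i].
Implicit Types (f : C^o -> C^o).

Definition circ (r t : R) : C^o := r%:C%C * (cos t +i* sin t)%C.

Lemma normc_circ r t : 0 <= r -> normc (circ r t) = r.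
Proof. by move=> r0; rewrite /circ normcM normc_cos_sin mulr1 normc_real ger0_norm. Qed.

Lemma circ_expC r t : 0 < r -> circ r t = expC (ln r +i* t)%C.
Proof. by move=> r0; rewrite /circ /expC /= lnK. Qed.

Lemma rcontD (u v : R -> C) t : rcont u t -> rcont v t -> rcont (fun t => u t + v t) t.
Proof.
move=> [u1 u2] [v1 v2]; split.
  rewrite (_ : (fun t => Re _) = (fun t => Re (u t)) + (fun t => Re (v t))).
    exact: continuousD.
  by apply/funext => s; rewrite raddfD.
rewrite (_ : (fun t => Im _) = (fun t => Im (u t)) + (fun t => Im (v t))).
  exact: continuousD.
by apply/funext => s; rewrite raddfD.
Qed.

Lemma rcont_circ f r t : 0 < r -> {for circ r t, continuous f} ->
  rcont (fun t => f (circ r t)) t.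
Proof.
move=> r0 cf.
have -> : (fun t => f (circ r t)) = (fun t => (f \o expC) (ln r +i* t)%C).
  by apply/funext => s /=; rewrite circ_expC.
apply: rcont_comp; last by move=> y; rewrite normc_subIm.
apply: continuous_comp; first exact/differentiable_continuous/differentiable_expC.
by rewrite -circ_expC.
Qed.

(** The exponential turns concentric circles into vertical segments of height [2 * pi]. In the
    rectangle between two of them the horizontal sides cancel by periodicity, so by Goursat's lemma
    the integral does not depend on the radius, which is then sent to 0. *)
Lemma mean_value f (r : R) : 0 < r ->
  (forall z : C^o, normc z <= r -> differentiable f z) ->
  cint 0 (2 * pi) (fun t => f (circ r t)) = (2 * pi)%:C%C * f 0.
Proof.
move=> r0 df.
have pi0 := pi_gt0 R.
have p0 : 0 <= 2 * pi :> R by lra.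
pose U : C^o -> C^o := f \o expC.
have dU s t : s <= ln r -> differentiable U ((s +i* t)%C : C^o).
  move=> sr; apply: differentiable_comp; first exact: differentiable_expC.
  by apply: df; rewrite normc_expC /= -[leRHS](@lnK _ r) ?posrE // ler_expR.
have H a : a <= ln r -> cint 0 (2 * pi) (fun t => f (circ r t)) =
    cint 0 (2 * pi) (fun t => U (a +i* t)%C).
  move=> ar.
  have := goursat ar p0 (fun s t hs _ => dU s t (proj2 (andP hs))).
  rewrite /rect_int.
  have -> : (fun s : R => U (s +i* (2 * pi))%C) = (fun s : R => U (s +i* 0)%C).
    apply/funext => s; rewrite /U /= /expC /=.
    by rewrite mulr_natl -[pi *+ 2]add0r cosD2pi sinD2pi.
  rewrite subrr add0r => /eqP; rewrite mulf_eq0.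
  have -> /= : ('i%C == 0 :> C) = false.
    by apply/negbTE; rewrite -normc_gt0 normc_i.
  rewrite subr_eq0 => /eqP <-; apply: eq_cint => // t _.
  by rewrite circ_expC.
apply/eqP; rewrite -subr_eq0; apply/eqP/normc_le_eps => e e0.
have /continuous_normc cf : {for (0 : C^o), continuous f}.
  by apply: differentiable_continuous; apply: df; rewrite normc0 ltW.
(* An interval of length [2 * pi] and the factor 2 of [cint_le] turn this into [e]. *)
have e1 : 0 < e / (4 * pi) by rewrite divr_gt0 //; lra.
have [d d0 hd] := cf _ e1.
(* The circle of radius [expR a] lies in the given disc and within [d] of the origin, where [f] is
   close to [f 0]. *)
pose a := Num.min (ln r) (ln (d / 2)).
have ar : a <= ln r by rewrite ge_min lexx.
have ad : a <= ln (d / 2) by rewrite ge_min lexx orbT.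
have rU t : rcont (fun t => U (a +i* t)%C) t.
  apply: rcont_comp; last by move=> y; rewrite normc_subIm.
  by apply: differentiable_continuous; exact: dU.
have rc (c : C) t : rcont (fun=> c) t.
  by apply: rcont_eps => e' e'0; exists 1 => // z _;
    rewrite subrr normc0.
have -> : cint 0 (2 * pi) (fun t => f (circ r t)) - (2 * pi)%:C%C * f 0 =
   cint 0 (2 * pi) (fun t => U (a +i* t)%C + (- f 0)).
  by rewrite (H _ ar) cintD // cint_cst // subr0 mulrN.
have ru t : rcont (fun t => U (a +i* t)%C + (- f 0)) t.
  exact: rcontD.
apply: le_trans (cint_le (M := e / (4 * pi)) p0 _ _) _ => //.
  move=> t _; apply: ltW; apply: hd; rewrite subr0 normc_expC /=.
  apply: le_lt_trans (_ : d / 2 < d); last by lra.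
  by rewrite -[leRHS](@lnK _ (d / 2)) ?posrE ?ler_expR //; lra.
rewrite subr0 le_eqVlt; apply/orP; left; apply/eqP.
move: (pi : R) pi0 => q q0; field.
exact: lt0r_neq0.
Qed.

End MeanValue.

(** * Maximum principle and Schwarz lemma *)

Section Compactness.
Context {R : realType}.
Local Notation C := R[i].

Lemma continuous_cball (E : normedModType C) (f : E -> R) (x : E) :
  (forall e : R, 0 < e -> exists2 d : R, 0 < d &
    forall y, nr (y - x) < d -> `|f y - f x| < e) -> {for x, continuous f}.
Proof.
move=> h; apply/cvgrPdist_lt => e /h [d d0 hd]; apply/nbhs_nr.
by exists d => // y /hd; rewrite distrC.
Qed.

Lemma nr_comp_continuous (E E' : normedModType C) (F : E -> E') (w : E') x :
  {for x, continuous F} -> {for x, continuous (fun y => nr (F y - w))}.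
Proof.
move=> /continuous_nr cF; apply: continuous_cball => e /cF [d d0 hd].
exists d => // y /hd h; apply: le_lt_trans h.
rewrite ler_norml; apply/andP; split.
  by have := nr_dist (F x) (F y) w; rewrite (nrB (F x) (F y)); lra.
by have := nr_dist (F y) (F x) w; lra.
Qed.

Lemma normc_comp_continuous (E : normedModType C) (f : E -> C^o) x :
  {for x, continuous f} -> {for x, continuous (fun y => normc (f y))}.
Proof.
move=> cf; have := @nr_comp_continuous E C^o f 0 x cf.
by rewrite (_ : (fun y => _) = (fun y => normc (f y))) // funeqE => y; rewrite subr0 nr_normc.
Qed.

Lemma closed_cball (E : normedModType C) (c : E) (r : R) :
  closed [set v : E | nr (v - c) <= r].
Proof.
have cf : continuous (fun v : E => nr (v - c)).
  by move=> x; apply: (@nr_comp_continuous E E id); exact: cvg_id.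
by move/continuous_closedP : cf => /(_ _ (@closed_le R r)).
Qed.

(** The ball is a closed subset of the continuous image of a real cube of dimension [n + n], the two
    halves holding real and imaginary parts. *)
Lemma compact_row n (c : 'rV[C]_n) (r : R) :
  compact ([set v | nr (v - c) <= r] : set ('rV[C]_n : normedModType C)).
Proof.
pose K := nr c + r.
pose B : set 'rV[R]_(n + n) := [set v | forall i, v 0 i \in `[(- K), K]%R].
have cB : compact B.
  apply: (@rV_compact R (n + n) (fun=> `[(- K), K]%classic)).
  by move=> _; apply: segment_compact.
pose f (v : 'rV[R]_(n + n)) : ('rV[C]_n : normedModType C) :=
  \row_i (v 0 (lshift n i) +i* v 0 (rshift n i))%C.
have cf : continuous f.
  move=> x A /nbhs_nr [e e0 eA]; suff : nbhs x (f @^-1` A) by [].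
  apply/nbhs_ballP; exists (e / 3); first by rewrite /=; lra.
  move=> y xy; apply: eA.
  have H j : `|y 0 j - x 0 j| < e / 3.
    by have [_ h] := xy; have := h 0 j; rewrite /ball /= distrC.
  apply: nr_row_lt => // i; rewrite !mxE.
  apply: le_lt_trans (normc_le_add _ _) _.
  by have := H (lshift n i); have := H (rshift n i); lra.
have cfB : compact (f @` B).
  by apply: continuous_compact cB; exact: continuous_subspaceT.
apply: (subclosed_compact _ cfB); first exact: closed_cball.
move=> v /= vr.
have vK i : normc (v 0 i) <= K.
  apply: le_trans (nr_coord v i) _.
  by have := nr_rev v c; rewrite /K; lra.
exists (\row_(j < n + n) match fintype.split j with inl i => Re (v 0 i) | inr i => Im (v 0 i) end).
  move=> j; rewrite mxE in_itv /=.
  by case: (fintype.split j) => i; rewrite -ler_norml; apply: le_trans (vK i);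
    [exact: normc_Re|exact: normc_Im].
apply/rowP => i; rewrite !mxE.
rewrite -[lshift n i]/(unsplit (inl i)) -[rshift n i]/(unsplit (inr i)) !unsplitK.
by case: (v 0 i).
Qed.

Lemma compact_disc (r : R) : compact [set z : C^o | normc z <= r].
Proof.
have := @compact_row 1 0 r.
pose f (v : ('rV[C]_1 : normedModType C)) : C^o := v 0 0.
move=> /(continuous_compact (f := f)) H.
have -> : [set z : C^o | normc z <= r] = f @` [set v : 'rV[C]_1 | nr (v - 0) <= r].
  apply/seteqP; split => [z zr|_ [v /= vr <-]].
    exists (\row_i z) => /=; last by rewrite /f mxE.
    rewrite subr0; apply: nr_row_le; first exact: le_trans (normc_ge0 _) zr.
    by move=> i; rewrite mxE.
  by rewrite /f /=; apply: le_trans (nr_coord v 0) _; rewrite -[v]subr0.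
by apply: H; apply: continuous_subspaceT => v; exact: coord_continuous.
Qed.

Lemma compact_max (T : topologicalType) (A : set T) (f : T -> R) :
  compact A -> A !=set0 -> (forall x, A x -> {for x, continuous f}) ->
  exists2 c, A c & forall x, A x -> f x <= f c.
Proof.
move=> cA A0 cf.
have [|c cA' h] := compact_EVT_max (f := f) A0 cA.
  by apply: continuous_in_subspaceT => x /set_mem; exact: cf.
by exists c; [exact: set_mem|move=> x Ax; apply: h; exact: mem_set].
Qed.

End Compactness.

(** * Locally uniform limits of holomorphic functions *)

Section MaximumPrinciple.
Context {R : realType}.
Local Notation C := R[i].
Implicit Types (f g h k : C^o -> C^o) (c z : C^o).

(* Bounded uniform limits of complex differentiable functions near a point: this
   class is stable under sums and products, and contains the derivatives of
   complex differentiable functions before these are known to be differentiable. *)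
Definition hol_near k c := exists2 r : R, 0 < r & exists2 M : R,
  (forall z, normc (z - c) < r -> normc (k z) <= M) &
  (forall e : R, 0 < e -> exists2 f,
    (forall z, normc (z - c) < r -> differentiable f z) &
    (forall z, normc (z - c) < r -> normc (f z - k z) <= e)).

Lemma differentiable_bounded f c : {for c, continuous f} ->
  exists2 r : R, 0 < r & forall z, normc (z - c) < r -> normc (f z) <= normc (f c) + 1.
Proof.
move=> /continuous_normc /(_ 1 ltr01) [r r0 hr]; exists r => // z /hr h.
have := normcD (f z - f c) (f c); rewrite subrK; lra.
Qed.

Lemma differentiable_hol_near f c (r : R) : 0 < r ->
  (forall z, normc (z - c) < r -> differentiable f z) -> hol_near f c.
Proof.
move=> r0 df.
have [|d d0 hd] := @differentiable_bounded f c.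
  by apply/differentiable_continuous/df; rewrite subrr normc0.
exists (Num.min r d); first by rewrite lt_min r0.
exists (normc (f c) + 1) => [z|e e0]; first by rewrite lt_min => /andP[_]; exact: hd.
exists f => z; rewrite lt_min => /andP[zr _]; first exact: df.
by rewrite subrr normc0 ltW.
Qed.

Lemma hol_nearD f g c : hol_near f c -> hol_near g c -> hol_near (fun z => f z + g z) c.
Proof.
move=> [r r0 [M hM hr]] [s s0 [N hN hs]].
exists (Num.min r s); first by rewrite lt_min r0.
exists (M + N) => [z|e e0].
  rewrite lt_min => /andP[/hM h1 /hN h2].
  by apply: le_trans (normcD _ _) _; exact: lerD.
have e2 : 0 < e / 2 by lra.
have [f' df' hf'] := hr _ e2; have [g' dg' hg'] := hs _ e2.
exists (fun z => f' z + g' z) => z; rewrite lt_min => /andP[zr zs].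
  by apply: differentiableD; [exact: df'|exact: dg'].
rewrite (_ : _ - _ = (f' z - f z) + (g' z - g z)); last by ring.
by apply: le_trans (normcD _ _) _; have := hf' z zr; have := hg' z zs; lra.
Qed.

Lemma hol_nearM f g c : hol_near f c -> hol_near g c -> hol_near (fun z => f z * g z) c.
Proof.
move=> [r r0 [M hM hr]] [s s0 [N hN hs]].
have M0 : 0 <= M.
  by apply: le_trans (hM c _); rewrite ?normc_ge0 // subrr normc0.
have N0 : 0 <= N.
  by apply: le_trans (hN c _); rewrite ?normc_ge0 // subrr normc0.
exists (Num.min r s); first by rewrite lt_min r0.
exists (M * N) => [z|e e0].
  rewrite lt_min => /andP[/hM h1 /hN h2]; rewrite normcM.
  by apply: ler_pM; rewrite ?normc_ge0.
pose d := Num.min 1 (e / (M + N + 1)).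
have d0 : 0 < d by rewrite lt_min ltr01 divr_gt0 //; lra.
have d1 : d <= 1 by rewrite ge_min lexx.
have de : d * (M + N + 1) <= e.
  by rewrite -ler_pdivlMr; [rewrite ge_min lexx orbT|lra].
have [f' df' hf'] := hr _ d0; have [g' dg' hg'] := hs _ d0.
exists (fun z => f' z * g' z) => z; rewrite lt_min => /andP[zr zs].
  by apply: differentiableM; [exact: df'|exact: dg'].
rewrite (_ : _ - _ = (f' z - f z) * (g' z - g z) + (f' z - f z) * g z + f z * (g' z - g z));
  last by ring.
apply: le_trans (normcD _ _) _.
apply: le_trans (_ : normc ((f' z - f z) * (g' z - g z)) + normc ((f' z - f z) * g z) + normc (f z * (g' z - g z)) <= _).
  by rewrite lerD2r; exact: normcD.
rewrite !normcM.
have n1 := hf' z zr; have n2 := hg' z zs; have n3 := hM z zr; have n4 := hN z zs.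
have p1 : normc (f' z - f z) * normc (g' z - g z) <= d * 1.
  by apply: ler_pM; rewrite ?normc_ge0 //; lra.
have p2 : normc (f' z - f z) * normc (g z) <= d * N by apply: ler_pM; rewrite ?normc_ge0.
have p3 : normc (f z) * normc (g' z - g z) <= M * d by apply: ler_pM; rewrite ?normc_ge0.
by move: p1 p2 p3 de; clear; lra.
Qed.

Lemma hol_near_continuous k c : hol_near k c -> exists2 r : R, 0 < r &
  forall z, normc (z - c) < r -> {for z, continuous k}.
Proof.
move=> [r r0 [M _ hr]]; exists r => // z zr; apply/continuous_normc => e e0.
have e3 : 0 < e / 3 by lra.
have [f df hf] := hr _ e3.
have /continuous_normc /(_ _ e3) [d d0 hd] := differentiable_continuous (df z zr).
exists (Num.min d (r - normc (z - c))); first by rewrite lt_min d0 subr_gt0.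
move=> y; rewrite lt_min => /andP[yd yr].
have yc : normc (y - c) < r.
  by have := normcD (y - z) (z - c); rewrite addrA subrK; lra.
rewrite (_ : k y - k z = (f y - f z) - (f y - k y) + (f z - k z)); last by ring.
apply: le_lt_trans (normcD _ _) _.
have := normcD (f y - f z) (- (f y - k y)); rewrite normcN.
by have := hd y yd; have := hf y yc; have := hf z zr; lra.
Qed.

End MaximumPrinciple.

(** * The maximum modulus principle *)

Section MaxModulus.
Context {R : realType}.
Local Notation C := R[i].
Implicit Types (f g h k : C^o -> C^o) (c z : C^o).

Lemma normcX (x : C) n : normc (x ^+ n) = normc x ^+ n.
Proof. by elim: n => [|n IH]; rewrite ?expr0 ?normc1 // !exprS normcM IH. Qed.

Lemma mean_value_at f c (r : R) : 0 < r ->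
  (forall z, normc (z - c) <= r -> differentiable f z) ->
  cint 0 (2 * pi) (fun t => f (c + circ r t)) = (2 * pi)%:C%C * f c.
Proof.
move=> r0 df; have := @mean_value R (fun z => f (c + z)) r r0.
rewrite addr0; apply => z zr; apply: differentiable_comp.
  by apply: differentiableD; [exact: differentiable_cst|exact: ex_diff].
by apply: df; rewrite addrC addKr.
Qed.

(** The mean value property of the approximants passes to the uniform limit. *)
Lemma hol_near_mean k c : hol_near k c -> exists2 d : R, 0 < d & forall r,
  0 < r -> r < d -> (forall t, rcont (fun t => k (c + circ r t)) t) /\
  cint 0 (2 * pi) (fun t => k (c + circ r t)) = (2 * pi)%:C%C * k c.
Proof.
move=> hk; have [d1 d10 hd1] := hol_near_continuous hk.
have [d2 d20 [M _ hd2]] := hk.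
exists (Num.min d1 d2); first by rewrite lt_min d10.
move=> r r0; rewrite lt_min => /andP[rd1 rd2].
have pi0 := pi_gt0 R.
have p0 : 0 <= 2 * pi :> R by lra.
have cc t : c + circ r t - c = circ r t by rewrite addrC addKr.
have rc f t : {for c + circ r t, continuous f} -> rcont (fun t => f (c + circ r t)) t.
  move=> /continuous_normc cf.
  have := @rcont_circ R (fun z => f (c + z)) r t r0; apply.
  apply/continuous_normc => e /cf [d d0 hd]; exists d => // y yd.
  by apply: hd; rewrite (_ : c + y - (c + circ r t) = y - circ r t) //; ring.
have rk t : rcont (fun t => k (c + circ r t)) t.
  by apply: rc; apply: hd1; rewrite cc normc_circ ?ltW.
split=> //.
apply/eqP; rewrite -subr_eq0; apply/eqP/normc_le_eps => e e0.
have e1 : 0 < e / (6 * pi) by rewrite divr_gt0 //; lra.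
have [f df hf] := hd2 _ e1.
have fE := @mean_value_at f c r r0.
have {}fE : cint 0 (2 * pi) (fun t => f (c + circ r t)) = (2 * pi)%:C%C * f c.
  by apply: fE => z zr; apply: df; exact: le_lt_trans zr rd2.
have rf t : rcont (fun t => f (c + circ r t)) t.
  by apply: rc; apply/differentiable_continuous/df; rewrite cc normc_circ ?ltW.
have rmf t : rcont (fun t => - 1 * f (c + circ r t)) t.
  have := rc (fun z => - 1 * f z) t; apply.
  apply: differentiable_continuous; apply: differentiableM.
    exact: differentiable_cst.
  by apply: df; rewrite cc normc_circ ?ltW.
have -> : cint 0 (2 * pi) (fun t => k (c + circ r t)) - (2 * pi)%:C%C * k c =
   cint 0 (2 * pi) (fun t => k (c + circ r t) + - 1 * f (c + circ r t)) +
   (2 * pi)%:C%C * (f c - k c).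
  rewrite cintD // cintZ // fE; ring.
apply: le_trans (normcD _ _) _.
rewrite normcM normc_real ger0_norm //.
have h1 : normc (f c - k c) <= e / (6 * pi) by apply: hf; rewrite subrr normc0.
have hb x : 0 <= x <= 2 * pi ->
   normc (k (c + circ r x) + -1 * f (c + circ r x)) <= e / (6 * pi).
  move=> _; rewrite mulN1r normcB.
  by apply: hf; rewrite cc normc_circ ?ltW.
have h2 := cint_le p0 (fun t _ => rcontD (rk t) (rmf t)) hb.
have h3 : 2 * pi * normc (f c - k c) <= 2 * pi * (e / (6 * pi)) by rewrite ler_wpM2l.
have h4 : 2 * pi * (e / (6 * pi)) = e / 3.
  by move: (pi : R) pi0 => q q0; field; exact: lt0r_neq0.
rewrite subr0 (mulrC (e / _)) h4 in h2; rewrite h4 in h3.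
by move: h2 h3 e0; clear; lra.
Qed.

Lemma normc_sqr (x : C) : normc x ^+ 2 = Re x ^+ 2 + Im x ^+ 2.
Proof. by case: x => a b; rewrite sqr_sqrtr // addr_ge0 // sqr_ge0. Qed.

(* By the mean value property [|k|^2] has mean at least [|k c|^2] on a small circle of
   radius [q] around [c], while the mean of [d |z|^2] exceeds [d |c|^2] by [d q^2]. *)
Lemma hol_near_no_max k c (d : R) : 0 < d -> hol_near k c ->
  ~ (exists2 r : R, 0 < r & forall z, normc (z - c) < r ->
     normc (k z) ^+ 2 + d * normc z ^+ 2 <= normc (k c) ^+ 2 + d * normc c ^+ 2).
Proof.
move=> d0 /hol_near_mean [s s0 hs] [r r0 hr].
have [q [q0 qr qs]] := exists_lt2 r0 s0.
have [rk kE] := hs q q0 qs.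
have pi0 := pi_gt0 R.
have p0 : 0 <= 2 * pi :> R by lra.
(* In the assumed inequality [|k|^2] is replaced by its tangent lower bound at [k c]. What remains
   is affine in [k] and in the point of the circle, whose means are known; the mean comes out as
   [- d * q ^+ 2]. *)
pose A : C := - 2 * (k c)^*%C.
pose B : C := - 2 * d%:C%C * c^*%C.
pose D : C := (2 * normc (k c) ^+ 2 - d * q ^+ 2)%:C%C.
have rcid t : rcont (fun t => circ q t) t.
  by apply: (@rcont_circ R id) => //; exact: cvg_id.
have rcZ (a : C) (u : R -> C) t : rcont u t -> rcont (fun t => a * u t) t.
  move=> [u1 u2]; split.
    rewrite (_ : (fun t => Re _) = (fun t => Re a * Re (u t) - Im a * Im (u t))).
      apply: continuousB; apply: continuousM => //; exact: cst_continuous.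
    by apply/funext => x; case: a => a b; case: (u x).
  rewrite (_ : (fun t => Im _) = (fun t => Re a * Im (u t) + Im a * Re (u t))).
    apply: continuousD; apply: continuousM => //; exact: cst_continuous.
  by apply/funext => x; case: a => a b; case: (u x).
have rcC (a : C) t : rcont (fun=> a) t by split; exact: cst_continuous.
have cid : cint 0 (2 * pi) (fun t => circ q t) = 0.
  have := @mean_value R id q q0; rewrite mulr0; apply => z _; exact: ex_diff.
have r1 t : rcont (fun t => A * k (c + circ q t) + B * circ q t) t.
  by apply: rcontD; apply: rcZ.
have : 0 <= Re (cint 0 (2 * pi) (fun t => A * k (c + circ q t) + B * circ q t + D)).
  apply: (cint_ge0 p0 (fun t _ => rcontD (r1 t) (rcC D t))) => t _.
  have := hr (c + circ q t).
  rewrite (_ : c + circ q t - c = circ q t); last by ring.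
  rewrite (normc_circ t (ltW q0)) => /(_ qr).
  have : normc (circ q t) ^+ 2 = q ^+ 2 by rewrite (normc_circ t (ltW q0)).
  rewrite /A /B /D !normc_sqr; case: (k (c + circ q t)) => x y; case: (k c) => u v.
  case: (circ q t) => w1 w2; case: (c) => m n /=.
  have := sqr_ge0 (x - u); have := sqr_ge0 (y - v).
  move: (q ^+ 2) => Q; clear; move=> h1 h2 <- h3.
  by lra.
have -> : cint 0 (2 * pi) (fun t => A * k (c + circ q t) + B * circ q t + D) =
    (2 * pi)%:C%C * (A * k c + D).
  rewrite (cintD p0 (fun t _ => r1 t) (fun t _ => rcC D t)).
  rewrite (cintD p0 (fun t _ => rcZ A _ t (rk t)) (fun t _ => rcZ B _ t (rcid t))).
  rewrite (cintZ A p0 (fun t _ => rk t)) (cintZ B p0 (fun t _ => rcid t)).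
  by rewrite (cint_cst D p0) kE cid subr0; ring.
have -> : A * k c + D = (- (d * q ^+ 2))%:C%C.
  rewrite /A /D normc_sqr; case: (k c) => x y; apply/eqP; rewrite eq_complex.
  by apply/andP; split; apply/eqP => /=; ring.
rewrite -rmorphM /= => H.
have : 0 < 2 * pi * (d * q ^+ 2) by rewrite !mulr_gt0 // ?exprn_gt0.
by lra.
Qed.

(** If [B] is exceeded at [z0], the weight [d] is chosen so that [d * |z|^2] amounts to at most half
    of the excess of [|k z0|^2] over [B^2]. A maximum of [|k|^2 + d * |z|^2] over the disc then has
    [|k| > B], so it is interior and not a zero of [k], against [hol_near_no_max]. *)
Lemma max_modulus k (r B : R) : 0 < r ->
  (forall z, normc z <= r -> {for z, continuous k}) ->
  (forall z, normc z < r -> k z != 0 -> hol_near k z) ->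
  (forall z, normc z = r -> normc (k z) <= B) ->
  forall z, normc z <= r -> normc (k z) <= B.
Proof.
move=> r0 ck hk kB.
have B0 : 0 <= B.
  apply: le_trans (normc_ge0 (k r%:C%C)) _; apply: kB.
  by rewrite normc_real gtr0_norm.
move=> z0 z0r; rewrite leNgt; apply/negP => zB.
pose d := (normc (k z0) ^+ 2 - B ^+ 2) / (2 * r ^+ 2).
have kz2 : B ^+ 2 < normc (k z0) ^+ 2 by rewrite ltr_pXn2r ?nnegrE ?normc_ge0.
have r2 : 0 < r ^+ 2 by rewrite exprn_gt0.
have d0 : 0 < d by rewrite divr_gt0 ?subr_gt0 // mulr_gt0.
have dE : d * r ^+ 2 = (normc (k z0) ^+ 2 - B ^+ 2) / 2.
  by rewrite /d; field; exact: lt0r_neq0.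
pose v z := normc (k z) ^+ 2 + d * normc z ^+ 2.
have [|c cr cmax] := compact_max (f := v) (@compact_disc R r) (ex_intro _ z0 z0r).
  move=> z zr; apply: continuousD.
    rewrite (_ : (fun z => _) = (fun z => normc (k z) * normc (k z))).
      by apply: continuousM; apply: normc_comp_continuous; exact: ck.
    by apply/funext.
  apply: continuousM; first exact: cst_continuous.
  rewrite (_ : (fun z => _) = (fun z => normc (z) * normc (z))); last by apply/funext.
  by apply: continuousM; apply: (@normc_comp_continuous R C^o id); exact: cvg_id.
have vc : normc (k z0) ^+ 2 <= v c.
  apply: le_trans (cmax _ z0r); rewrite /v lerDl.
  by rewrite mulr_ge0 ?(ltW d0) ?sqr_ge0.
have nsq z : normc z <= r -> d * normc z ^+ 2 <= d * r ^+ 2.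
  by move=> zr; rewrite ler_pM2l // ler_pXn2r ?nnegrE ?normc_ge0 // ltW.
have kc : B ^+ 2 < normc (k c) ^+ 2 by have := nsq c cr; rewrite /v in vc; lra.
have cr' : normc c < r.
  rewrite lt_neqAle cr andbT; apply/negP => /eqP /kB.
  rewrite -(ler_pXn2r (n := 2)) ?nnegrE ?normc_ge0 //; lra.
have kc0 : k c != 0.
  apply/negP => /eqP kc0; move: kc; rewrite kc0 normc0 expr0n /=.
  by have := sqr_ge0 B; lra.
apply: (hol_near_no_max d0 (hk c cr' kc0)).
exists (r - normc c); first by rewrite subr_gt0.
move=> z zc; apply: cmax; rewrite /=.
by have := normcD (z - c) c; rewrite subrK; lra.
Qed.

Lemma hol_nearX k c n : hol_near k c -> hol_near (fun z => k z ^+ n) c.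
Proof.
move=> hk; elim: n => [|n IH].
  rewrite (_ : (fun z => _) = cst 1); last by apply/funext => z; rewrite expr0.
  apply: (@differentiable_hol_near _ _ _ 1) => // z _; exact: differentiable_cst.
rewrite (_ : (fun z => _) = (fun z => k z * k z ^+ n)); first exact: hol_nearM.
by apply/funext => z; rewrite exprS.
Qed.

Lemma continuous_exprn k c n : {for c, continuous k} ->
  {for c, continuous (fun z => k z ^+ n : C^o)}.
Proof.
move=> ck; elim: n => [|n IH].
  by rewrite (_ : (fun z => _) = cst 1); [exact: cst_continuous|apply/funext => z; rewrite expr0].
rewrite (_ : (fun z => _) = (fun z => k z * k z ^+ n)); first exact: (continuousM ck IH).
by apply/funext => z; rewrite exprS.
Qed.

(** Bernoulli's inequality: the powers grow at least linearly. *)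
Lemma expr_ge_contra (x : R) (K : R) : 1 < x -> ~ (forall n : nat, x ^+ n <= K).
Proof.
move=> x1 h.
have x0 : 0 < x by apply: lt_trans x1.
have H n : 1 + n%:R * (x - 1) <= x ^+ n.
  elim: n => [|n IH]; first by rewrite mul0r addr0 expr0.
  rewrite exprS; apply: le_trans (_ : x * (1 + n%:R * (x - 1)) <= _).
    have n0 : 0 <= n%:R :> R by [].
    have : 0 <= n%:R * (x - 1) ^+ 2 by rewrite mulr_ge0 ?sqr_ge0.
    by rewrite -natr1; lra.
  by rewrite ler_pM2l.
have := h (Num.bound (`|K| / (x - 1))).
have x10 : 0 < x - 1 by rewrite subr_gt0.
have /archi_boundP : 0 <= `|K| / (x - 1) by rewrite divr_ge0 // ltW.
set n := Num.bound _; rewrite ltr_pdivrMr // => Kn.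
by have := H n; have := ler_norm K; lra.
Qed.

(* [max_modulus] for [h * k ^+ n], then [n -> oo]. *)
Lemma max_modulus_off_zeros h k (r B : R) : 0 < r ->
  (forall z, normc z <= r -> {for z, continuous h}) ->
  (forall z, normc z <= r -> {for z, continuous k}) ->
  (forall z, normc z < r -> h z != 0 -> hol_near h z) ->
  (forall z, normc z < r -> h z != 0 -> hol_near k z) ->
  (forall z, normc z = r -> normc (k z) <= B) ->
  forall z, normc z <= r -> h z != 0 -> normc (k z) <= B.
Proof.
move=> r0 ch ck hh hk kB z zr hz.
have B0 : 0 <= B.
  apply: le_trans (normc_ge0 (k r%:C%C)) _; apply: kB.
  by rewrite normc_real gtr0_norm.
have [m mr mmax] := compact_max (@compact_disc R r) (ex_intro _ z zr)
  (fun x xr => normc_comp_continuous (ch x xr)).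
have H n : normc (h z) * normc (k z) ^+ n <= normc (h m) * B ^+ n.
  rewrite -normcX -normcM.
  (* The product vanishes wherever [h] does, so the exceptional points become zeros of the function
     to which [max_modulus] is applied. *)
  apply: (@max_modulus (fun z => h z * k z ^+ n) r _ r0 _ _ _ z zr) => x xr.
  - apply: continuousM; first exact: ch.
    by apply: continuous_exprn; exact: ck.
  - move=> hkx; have hx : h x != 0.
      by apply: contraNneq hkx => ->; rewrite mul0r.
    by apply: hol_nearM; [exact: hh|apply: hol_nearX; exact: hk].
  - rewrite normcM normcX; apply: ler_pM; rewrite ?exprn_ge0 ?normc_ge0 //.
      by apply: mmax; rewrite /= xr.
    by apply: lerXn2r; rewrite ?nnegrE ?normc_ge0 // kB.
have hz0 : 0 < normc (h z) by rewrite normc_gt0.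
rewrite leNgt; apply/negP => Bk.
(* The midpoint is positive even when [B = 0], so the ratio below makes sense and exceeds 1. *)
pose B' := (B + normc (k z)) / 2.
have B'0 : 0 < B' by rewrite /B'; lra.
have BB' : B <= B' by rewrite /B'; lra.
apply: (@expr_ge_contra (normc (k z) / B') (normc (h m) / normc (h z))).
  by rewrite ltr_pdivlMr // mul1r /B'; lra.
move=> n; rewrite expr_div_n ler_pdivrMr ?exprn_gt0 // mulrAC ler_pdivlMr //.
rewrite mulrC; apply: le_trans (H n) _; apply: ler_wpM2l; first exact: normc_ge0.
by apply: lerXn2r; rewrite ?nnegrE // ltW.
Qed.

End MaxModulus.

(** * Difference quotients and the Schwarz lemma *)

Section Quotients.
Context {R : realType}.
Local Notation C := R[i].
Implicit Types (f g h k q : C^o -> C^o) (c s z : C^o).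

Lemma continuous_near_eq f k z (r : R) : 0 < r ->
  (forall y, normc (y - z) < r -> k y = f y) ->
  {for z, continuous f} -> {for z, continuous k}.
Proof.
move=> r0 kf /continuous_normc cf; apply/continuous_normc => e /cf [d d0 hd].
exists (Num.min d r); first by rewrite lt_min d0.
move=> y; rewrite lt_min => /andP[yd yr]; rewrite !kf //; first exact: hd.
by rewrite subrr normc0.
Qed.

Lemma differentiable_near_eq f k z (r : R) : 0 < r ->
  (forall y, normc (y - z) < r -> k y = f y) ->
  differentiable f z -> differentiable k z.
Proof.
move=> r0 kf df; suff [] : differentiable k z /\ 'd k z 1 = 'd f z 1 by [].
apply: normc_differentiable => e /(differentiable_normc df) [d d0 hd].
exists (Num.min d r); first by rewrite lt_min d0.
move=> v; rewrite lt_min => /andP[vd vr]; rewrite !kf.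
- exact: hd.
- by rewrite subrr normc0.
- by rewrite addrC addKr.
Qed.

(** The value at [s] makes the quotient continuous there. Its differentiability at [s] is never
    established: the maximum principle is applied with an auxiliary factor that vanishes at [s]. *)
Definition quot f s z : C^o := if z == s then 'd f s 1 else (f z - f s) / (z - s).

Lemma quot_neq f s z : z != s -> quot f s z = (f z - f s) / (z - s).
Proof. by rewrite /quot => /negbTE ->. Qed.

Lemma quot_continuous_at f s : differentiable f s -> {for s, continuous (quot f s)}.
Proof.
move=> df; apply/continuous_normc => e e0.
have e2 : 0 < e / 2 by lra.
have [d d0 hd] := differentiable_normc df e2.
exists d => // y yd; rewrite {2}/quot eqxx.
have [->|ys] := eqVneq y s; first by rewrite /quot eqxx subrr normc0.
rewrite quot_neq //; have ys0 : y - s != 0 by rewrite subr_eq0.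
have -> : (f y - f s) / (y - s) - 'd f s 1 =
   (f (s + (y - s)) - f s - (y - s) * 'd f s 1) / (y - s).
  by rewrite (_ : s + (y - s) = y); [field|ring].
have n0 : 0 < normc (y - s) by rewrite normc_gt0.
rewrite normcM normcV; apply: le_lt_trans (_ : e / 2 < e); last by lra.
by rewrite ler_pdivrMr // hd.
Qed.

Lemma near_neq s z : z != s ->
  exists2 r : R, 0 < r & forall y, normc (y - z) < r -> y != s.
Proof.
move=> zs; exists (normc (z - s)); first by rewrite normc_gt0 subr_eq0.
by move=> y; apply: contraTneq => ->; rewrite normcB ltxx.
Qed.

Lemma quot_differentiable f s z : z != s -> differentiable f z ->
  differentiable (quot f s) z.
Proof.
move=> zs df; have [r r0 hr] := near_neq zs.
apply: (@differentiable_near_eq (fun z => (f z - f s) * (z - s)^-1) _ _ r r0).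
  by move=> y /hr ys; rewrite quot_neq.
apply: differentiableM; first exact: (differentiableB df (differentiable_cst _ _)).
apply: differentiableV; last by rewrite subr_eq0.
by apply: differentiableB; [exact: ex_diff|exact: differentiable_cst].
Qed.

Lemma quot_continuous f s z : z != s -> {for z, continuous f} ->
  {for z, continuous (quot f s)}.
Proof.
move=> zs cf; have [r r0 hr] := near_neq zs.
apply: (@continuous_near_eq (fun z => (f z - f s) * (z - s)^-1) _ _ r r0).
  by move=> y /hr ys; rewrite quot_neq.
apply: continuousM.
  exact: (continuousB cf (@cst_continuous _ _ _ _)).
apply: continuousV; first by rewrite subr_eq0.
by apply: continuousB; [exact: cvg_id|exact: cst_continuous].
Qed.

Lemma schwarz_weak f (r r' M : R) : 0 < r' -> r' < r ->
  (forall z, normc z < r -> differentiable f z) ->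
  (forall z, normc z < r -> normc (f z) <= M) ->
  forall z, normc z <= r' -> z != 0 -> normc (quot f 0 z) <= (M + normc (f 0)) / r'.
Proof.
move=> r'0 r'r df fM z zr z0.
have d0 : differentiable f 0 by apply: df; rewrite normc0; exact: lt_trans r'r.
apply: (@max_modulus_off_zeros R id (quot f 0) r' _ r'0 _ _ _ _ _ z zr z0).
- by move=> x _; exact: cvg_id.
- move=> x xr; have [->|x0] := eqVneq x 0; first exact: quot_continuous_at.
  apply: (quot_continuous x0); apply/differentiable_continuous/df.
  exact: le_lt_trans r'r.
- by move=> x _ _; apply: (@differentiable_hol_near R id x 1 ltr01) => y _; exact: ex_diff.
- move=> x xr x0; have [d dd hd] := near_neq x0.
  apply: (@differentiable_hol_near _ _ _ (Num.min d (r' - normc x))).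
    by rewrite lt_min dd subr_gt0.
  move=> y; rewrite lt_min => /andP[yd yr]; apply: quot_differentiable; first exact: hd.
  by apply: df; have := normcD (y - x) x; rewrite subrK; lra.
- move=> x xr; have x0 : x != 0 by rewrite -normc_gt0 xr.
  rewrite quot_neq // subr0 normcM normcV xr ler_pM2r ?invr_gt0 //.
  by apply: le_trans (normcD _ _) _; rewrite normcN lerD2r; apply: fM; rewrite xr.
Qed.

(** The maximum principle for [quot f 0] on discs of radius [r' < r], then [r' -> r]. *)
Lemma schwarz f (r M : R) : 0 < r ->
  (forall z, normc z < r -> differentiable f z) ->
  (forall z, normc z < r -> normc (f z) <= M) -> f 0 = 0 ->
  forall z, normc z < r -> normc (f z) <= M * normc z / r.
Proof.
move=> r0 df fM f0 z zr.
have [->|z0] := eqVneq z 0; first by rewrite f0 normc0 mulr0 mul0r.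
rewrite ler_pdivlMr //.
have nz : 0 < normc z by rewrite normc_gt0.
have H r' : normc z < r' -> r' < r -> normc (f z) * r' <= M * normc z.
  move=> zr' r'r; have r'0 := lt_trans nz zr'.
  have := schwarz_weak r'0 r'r df fM (ltW zr') z0.
  rewrite quot_neq // f0 !subr0 normc0 addr0 normcM normcV.
  by rewrite ler_pdivlMr // mulrAC ler_pdivrMr.
rewrite leNgt; apply/negP => h.
have fz0 : 0 < normc (f z).
  rewrite lt_def normc_ge0 andbT; apply: contraTneq h => ->; rewrite mul0r -leNgt.
  by rewrite mulr_ge0 ?normc_ge0 //; apply: le_trans (fM _ zr); exact: normc_ge0.
(* The inequality in [H] says [r' <= a]; as [a < r], a radius strictly between [a] and [r]
   contradicts it. *)
pose a := M * normc z / normc (f z).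
have ar : a < r by rewrite /a ltr_pdivrMr // (mulrC r).
pose r' := (Num.max a (normc z) + r) / 2.
have m1 : a <= Num.max a (normc z) by rewrite le_max lexx.
have m2 : normc z <= Num.max a (normc z) by rewrite le_max lexx orbT.
have m3 : Num.max a (normc z) < r by rewrite gt_max ar zr.
have : normc (f z) * r' <= M * normc z by apply: H; rewrite /r'; lra.
rewrite mulrC -ler_pdivlMr // -/a /r'; lra.
Qed.

(** The remainder divided by [s ^+ 2] is the iterated difference quotient [quot (quot f 0) s] at
    [0], and the maximum principle on the disc of radius [r / 2] bounds that quotient. This replaces
    Cauchy's estimate for the second derivative. *)
Lemma second_order f (r M : R) : 0 < r ->
  (forall z, normc z < r -> differentiable f z) ->
  (forall z, normc z < r -> normc (f z) <= M) ->
  forall s, normc s <= r / 4 ->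
    normc (f s - f 0 - s * 'd f 0 1) <= 32 * M / r ^+ 2 * normc s ^+ 2.
Proof.
move=> r0 df fM s sr.
have [->|s0] := eqVneq s 0.
  by rewrite subrr mul0r subr0 normc0 expr0n mulr0.
have M0 : 0 <= M by apply: le_trans (fM 0 _); rewrite ?normc_ge0 // normc0.
pose r' := r / 2; have r'0 : 0 < r' by rewrite /r'; lra.
have r'r : r' < r by rewrite /r'; lra.
pose q := quot f 0.
have df0 : differentiable f 0 by apply: df; rewrite normc0.
have cq (x : C^o) : normc x <= r' -> {for x, continuous q}.
  move=> xr; have [->|x0] := eqVneq x 0; first exact: quot_continuous_at.
  apply: (quot_continuous x0); apply/differentiable_continuous/df.
  exact: le_lt_trans r'r.
have dq (x : C^o) : normc x < r -> x != 0 -> differentiable q x.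
  by move=> xr x0; exact: (quot_differentiable x0 (df x xr)).
have qb x : normc x <= r' -> x != 0 -> normc (q x) <= 4 * M / r.
  move=> xr x0; apply: le_trans (schwarz_weak r'0 r'r df fM xr x0) _.
  have := fM 0; rewrite normc0 => /(_ r0) h.
  apply: le_trans (_ : (M + M) / r' <= _); first by rewrite ler_pM2r ?invr_gt0 // lerD2l.
  by rewrite /r' le_eqVlt; apply/orP; left; apply/eqP; field; exact: lt0r_neq0.
have sr' : normc s <= r' by rewrite /r'; lra.
have dqs : differentiable q s by apply: (dq s _ s0); lra.
(* On the circle of radius [r / 2] the numerator [q z - q s] is at most [8 * M / r] and the
   denominator at least [r / 4]. *)
pose B := 32 * M / r ^+ 2.
have B0 : 0 <= B by apply: divr_ge0; [exact: mulr_ge0|exact: sqr_ge0].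
have kB x : normc x <= r' -> x != 0 -> x != s -> normc (quot q s x) <= B.
  move=> xr x0 xs.
  apply: (@max_modulus_off_zeros R (fun z => z * (z - s)) (quot q s) r' _ r'0 _ _ _ _ _ x xr).
  - move=> z _; apply: continuousM; first exact: cvg_id.
    exact: (continuousB (@cvg_id _ _) (@cst_continuous _ _ _ _)).
  - move=> z zr; have [->|zs] := eqVneq z s; first exact: quot_continuous_at.
    exact: (quot_continuous zs (cq z zr)).
  - move=> z _ _; apply: (@differentiable_hol_near R _ z 1 ltr01) => y _.
    have did : differentiable (id : C^o -> C^o) y by exact: ex_diff.
    exact: (differentiableM did (differentiableB did (differentiable_cst _ _))).
  - move=> z zr; rewrite mulf_eq0 subr_eq0 negb_or => /andP[z0 zs].
    have [d1 d10 hd1] := near_neq z0; have [d2 d20 hd2] := near_neq zs.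
    apply: (@differentiable_hol_near _ _ _ (Num.min (Num.min d1 d2) (r' - normc z))).
      by rewrite !lt_min d10 d20 subr_gt0.
    move=> y; rewrite !lt_min => /andP[/andP[/hd1 y0 /hd2 ys] yr].
    apply: (quot_differentiable ys); apply: (dq y _ y0).
    by have := normcD (y - z) z; rewrite subrK; lra.
  - move=> z zr.
    have z0 : z != 0 by rewrite -normc_gt0 zr.
    have zs : z != s.
      apply: contraTneq sr => zs; rewrite -zs zr /r' -ltNge; lra.
    rewrite quot_neq // normcM normcV.
    have h1 : r / 4 <= normc (z - s).
      have := normcD (z - s) s; rewrite subrK zr /r'; lra.
    have h2 : normc (q z - q s) <= 8 * M / r.
      apply: le_trans (normcD _ _) _; rewrite normcN.
      by have := qb s sr' s0; have := qb z; rewrite zr => /(_ (lexx _) z0); lra.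
    have n0 : 0 < normc (z - s) by rewrite normc_gt0 subr_eq0.
    rewrite ler_pdivrMr //; apply: le_trans h2 _.
    apply: le_trans (_ : B * (r / 4) <= _).
      rewrite /B le_eqVlt; apply/orP; left; apply/eqP; field; exact: lt0r_neq0.
    by rewrite ler_wpM2l.
  - by rewrite mulf_eq0 subr_eq0 negb_or x0.
(* The origin is a zero of the auxiliary factor, so the bound reaches it only by continuity. *)
have k0 : normc (quot q s 0) <= B.
  rewrite leNgt; apply/negP => h.
  have s0' : 0 != s by rewrite eq_sym.
  have c0 : {for (0 : C^o), continuous (quot q s)}.
    by apply: (quot_continuous s0'); apply: cq; rewrite normc0 ltW.
  have e0 : 0 < normc (quot q s 0) - B by rewrite subr_gt0.
  have /continuous_normc /(_ _ e0) [d d0 hd] := c0.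
  have ns : 0 < normc s by rewrite normc_gt0.
  have [t [t0 td ts]] := exists_lt2 d0 ns.
  have nt : normc t%:C%C = t by rewrite normc_real gtr0_norm.
  have := hd t%:C%C; rewrite subr0 nt => /(_ td) H.
  have h1 : normc (quot q s t%:C%C) <= B.
    apply: kB; rewrite ?nt; first by lra.
      by rewrite -normc_gt0 nt.
    by apply: contraTneq ts => <-; rewrite nt ltxx.
  have := normcD (quot q s 0 - quot q s t%:C%C) (quot q s t%:C%C).
  by rewrite subrK normcB; lra.
have s0' : 0 != s by rewrite eq_sym.
have -> : f s - f 0 - s * 'd f 0 1 = s * (- (s * (quot q s 0 * -1))).
  rewrite quot_neq // /q {1}/quot eqxx quot_neq // !subr0 sub0r; field.
  by rewrite s0.
rewrite normcM normcN normcM normcM normcN normc1 mulr1.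
have := normc_ge0 s; move: k0; rewrite /B => k0 n0.
rewrite mulrA -expr2 mulrC ler_wpM2r ?sqr_ge0 //.
Qed.

End Quotients.

(** * Inverse function theorem *)

Section FrechetCalculus.
Context {R : realType}.
Local Notation C := R[i].
Local Notation V n := ('rV[C]_n : normedModType C).

Lemma line_coord (E : normedModType C) n (F : E -> V n) (a b : E) (z : C^o) i :
  differentiable F (a + z *: b) ->
  differentiable (fun t : C^o => F (a + t *: b) 0 i : C^o) z /\
  'd (fun t : C^o => F (a + t *: b) 0 i : C^o) z 1 = ('d F (a + z *: b) b) 0 i.
Proof.
move=> dG; apply: normc_differentiable => e e0.
have nb : 0 < nr b + 1 by have := nr_ge0 b; lra.
have [d d0 hd] := differentiable_nr dG (divr_gt0 e0 nb).
exists (d / (nr b + 1)); first exact: divr_gt0.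
move=> h; rewrite ltr_pdivlMr // => hh.
have hb : nr (h *: b) < d.
  by rewrite nrZ; have := normc_ge0 h; have := nr_ge0 b; nra.
have := hd _ hb; rewrite linearZ => H.
rewrite scalerDl addrA; apply: le_trans (_ : normc ((F (a + z *: b + h *: b) - F (a + z *: b) - h *: 'd F (a + z *: b) b) 0 i) <= _).
  by rewrite !mxE.
apply: le_trans (nr_coord _ i) _; apply: le_trans H _.
rewrite nrZ mulrAC ler_pdivrMr // -!mulrA ler_pM2l //.
by have := normc_ge0 h; have := nr_ge0 b; nra.
Qed.

Lemma diff_jacobian m n (F : V m -> V n) (x v : V m) :
  'd F x v = v *m jacobian F x.
Proof. by rewrite /jacobian mul_rV_lin1. Qed.

(** A crude upper bound for the operator norm with respect to sup norms. *)
Definition mxsum m n (A : 'M[C]_(m, n)) : R := \sum_i \sum_j normc (A i j).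

Lemma mxsum_ge0 m n (A : 'M[C]_(m, n)) : 0 <= mxsum A.
Proof. by apply: sumr_ge0 => i _; apply: sumr_ge0 => j _; exact: normc_ge0. Qed.

Lemma normc_sum (I : Type) (r : seq I) (P : pred I) (f : I -> C) :
  normc (\sum_(i <- r | P i) f i) <= \sum_(i <- r | P i) normc (f i).
Proof.
elim/big_rec2: _ => [|i x y _ h]; first by rewrite normc0.
by apply: le_trans (normcD _ _) _; rewrite lerD2l.
Qed.

Lemma nr_mulmx m n (v : V m) (A : 'M[C]_(m, n)) :
  nr (v *m A : V n) <= mxsum A * nr v.
Proof.
apply: nr_row_le; first by rewrite mulr_ge0 ?mxsum_ge0 ?nr_ge0.
move=> j; rewrite mxE; apply: le_trans (normc_sum _ _ _) _.
rewrite /mxsum mulr_suml; apply: ler_sum => i _.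
rewrite normcM mulrC; apply: ler_pM; rewrite ?normc_ge0 ?nr_coord //.
by rewrite (bigD1 j) //= lerDl; apply: sumr_ge0 => k _; exact: normc_ge0.
Qed.

Lemma nr_unitmx n (v : V n) (A : 'M[C]_n) : A \in unitmx ->
  nr v <= mxsum (invmx A) * nr (v *m A : V n).
Proof. by move=> uA; have := nr_mulmx (v *m A) (invmx A); rewrite mulmxK. Qed.

(** The determinant is a polynomial in the entries. The class [Q] is left abstract to serve both
    continuity and [hol_near]. *)
Lemma det_closed (T : Type) (Q : (T -> C) -> Prop) n (A : T -> 'M[C]_n) :
  (forall c, Q (fun=> c)) ->
  (forall f g, Q f -> Q g -> Q (fun x => f x + g x)) ->
  (forall f g, Q f -> Q g -> Q (fun x => f x * g x)) ->
  (forall i j, Q (fun x => A x i j)) -> Q (fun x => \det (A x)).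
Proof.
move=> Qc QD QM QA; rewrite /determinant.
have Qsum (I : Type) (r : seq I) (f : I -> T -> C) :
    (forall i, Q (f i)) -> Q (fun x => \sum_(i <- r) f i x).
  move=> Qf; elim: r => [|i r IH].
    rewrite (_ : (fun x => _) = (fun=> 0)) //.
    by apply/funext => x; rewrite big_nil.
  rewrite (_ : (fun x => _) = (fun x => f i x + \sum_(i <- r) f i x)).
    exact: QD.
  by apply/funext => x; rewrite big_cons.
have Qprod (I : Type) (r : seq I) (f : I -> T -> C) :
    (forall i, Q (f i)) -> Q (fun x => \prod_(i <- r) f i x).
  move=> Qf; elim: r => [|i r IH].
    rewrite (_ : (fun x => _) = (fun=> 1)) //.
    by apply/funext => x; rewrite big_nil.
  rewrite (_ : (fun x => _) = (fun x => f i x * \prod_(i <- r) f i x)).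
    exact: QM.
  by apply/funext => x; rewrite big_cons.
by apply: Qsum => s; apply: QM => //; apply: Qprod.
Qed.

(** [second_order] for each coordinate on the complex line through [x] in the direction of [v], with
    radius [r / 2]; this turns 32 into 128 and [r / 4] into [r / 8]. *)
Lemma second_order_row m n (F : V m -> V n) (x0 : V m) (r M : R) : 0 < r ->
  (forall x, nr (x - x0) < r -> differentiable F x) ->
  (forall x, nr (x - x0) < r -> nr (F x) <= M) ->
  forall x v : V m, nr (x - x0) < r / 2 -> nr v <= r / 8 ->
    nr (F (x + v) - F x - 'd F x v) <= 128 * M / r ^+ 2 * nr v ^+ 2.
Proof.
move=> r0 dF FM x v xr vr.
have M0 : 0 <= M by apply: le_trans (FM x0 _); rewrite ?nr_ge0 // subrr nr0.
have K0 : 0 <= 128 * M / r ^+ 2 * nr v ^+ 2.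
  by rewrite mulr_ge0 ?sqr_ge0 // mulr_ge0 ?invr_ge0 ?sqr_ge0 // mulr_ge0.
have [->|v0] := eqVneq v 0.
  by rewrite addr0 subrr linear0 subr0 [leLHS]nr0 nr0 expr0n /= mulr0.
have nv : 0 < nr v by rewrite nr_gt0.
pose u : V m := (nr v)^-1%:C%C *: v.
have nu : nr u = 1.
  rewrite nrZ normc_real ger0_norm ?invr_ge0 ?nr_ge0 // mulVf //.
  exact: lt0r_neq0.
have vu : (nr v)%:C%C *: u = v.
  by rewrite scalerA -rmorphM /= mulfV ?scale1r //; exact: lt0r_neq0.
have inb (z : C) : normc z < r / 2 -> nr (x + z *: u - x0) < r.
  move=> zr; rewrite addrAC; apply: le_lt_trans (nr_triangle _ _) _.
  by rewrite nrZ nu mulr1; lra.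
apply: nr_row_le => // i.
pose f (z : C^o) : C^o := F (x + z *: u) 0 i.
have df (z : C^o) : normc z < r / 2 -> differentiable f z.
  by move=> zr; have [] := @line_coord _ _ F x u z i (dF _ (inb z zr)).
have fM z : normc z < r / 2 -> normc (f z) <= M.
  by move=> zr; apply: le_trans (nr_coord _ _) _; apply: FM; exact: inb.
have r2 : 0 < r / 2 by lra.
have := second_order r2 df fM (s := (nr v)%:C%C).
rewrite normc_real (ger0_norm (nr_ge0 v)).
have -> : 'd f 0 1 = ('d F x u) 0 i.
  have := @line_coord _ _ F x u 0 i; rewrite scale0r addr0 => h.
  by have [|_ ->] := h; first by apply: dF; lra.
have -> : 32 * M / (r / 2) ^+ 2 = 128 * M / r ^+ 2.
  by field; exact: lt0r_neq0.
rewrite /f scale0r addr0 vu => H.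
rewrite -[v in 'd F x v]vu linearZ !mxE; apply: H; lra.
Qed.

Lemma normc_sub3 (a b p q : C) :
  normc (b - a) <= normc (q - b) + normc (q - p) + normc (p - a).
Proof.
rewrite (_ : b - a = (b - q) + (q - p) + (p - a)); last by ring.
by rewrite [normc (q - b)]normcB; apply: le_trans (normcD _ _) _; rewrite lerD2r normcD.
Qed.

Lemma nr_scale_delta m (i : 'I_m) (t : R) : 0 < t ->
  nr (t%:C%C *: delta_mx 0 i : V m) <= t.
Proof.
move=> t0; rewrite nrZ normc_real gtr0_norm // -[leRHS]mulr1 ler_pM2l //.
apply: nr_row_le => // j; rewrite mxE eqxx /=.
by case: eqP => _; rewrite ?normc1 ?normc0.
Qed.

(** Partial derivatives are uniform limits, at a linear rate in [t], of difference quotients of [F].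
    Their continuity and their membership in [hol_near] follow without second derivatives. *)
Lemma jacobian_quotient m n (F : V m -> V n) (x0 : V m) (r M : R) (r0 : 0 < r)
  (dF : forall x, nr (x - x0) < r -> differentiable F x)
  (FM : forall x, nr (x - x0) < r -> nr (F x) <= M) :
  exists2 k : R, 0 <= k & forall i j t x,
    0 < t -> t <= r / 8 -> nr (x - x0) < r / 2 ->
    normc (t^-1%:C%C * (F (x + t%:C%C *: delta_mx 0 i) 0 j - F x 0 j)
           - jacobian F x i j) <= k * t.
Proof.
have M0 : 0 <= M by apply: le_trans (FM x0 _); rewrite ?nr_ge0 // subrr nr0.
pose K := 128 * M / r ^+ 2.
have K0 : 0 <= K by rewrite mulr_ge0 ?invr_ge0 ?sqr_ge0 // mulr_ge0.
exists K => // i j t x t0 tr xr; have et := nr_scale_delta i t0.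
have := second_order_row r0 dF FM xr (le_trans et tr).
move=> /(le_trans (nr_coord _ j)).
set e := t%:C%C *: _.
have -> : (F (x + e) - F x - 'd F x e) 0 j =
    t%:C%C * (t^-1%:C%C * (F (x + e) 0 j - F x 0 j) - jacobian F x i j).
  rewrite diff_jacobian /e -scalemxAl -rowE !mxE mulrBr mulrA -rmorphM /=.
  by rewrite mulfV ?mul1r //; exact: lt0r_neq0.
rewrite normcM normc_real gtr0_norm // -/K => H.
rewrite -(ler_pM2l t0); apply: le_trans H _.
by rewrite (mulrCA t) ler_wpM2l // -expr2 ler_pXn2r ?nnegrE ?nr_ge0 // ltW.
Qed.

Lemma jacobian_continuous m n (F : V m -> V n) (x0 : V m) (r M : R) (r0 : 0 < r)
  (dF : forall x, nr (x - x0) < r -> differentiable F x)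
  (FM : forall x, nr (x - x0) < r -> nr (F x) <= M) i j x : nr (x - x0) < r / 2 ->
  {for x, continuous (fun x => jacobian F x i j : C^o)}.
Proof.
have [k k0 qj] := jacobian_quotient r0 dF FM.
pose e_ (i : 'I_m) (t : R) : V m := t%:C%C *: delta_mx 0 i.
pose q_ i j t x : C := t^-1%:C%C * (F (x + e_ i t) 0 j - F x 0 j).
have {}qj i' j' t x' : 0 < t -> t <= r / 8 -> nr (x' - x0) < r / 2 ->
  normc (q_ i' j' t x' - jacobian F x' i' j') <= k * t by exact: qj.
have nr_e i' t : 0 < t -> nr (e_ i' t) <= t := @nr_scale_delta m i' t.
move=> xr; apply/continuous_nr => e e0.
have K1 : 0 < 3 * (k + 1) by lra.
pose t := Num.min (r / 8) (e / (3 * (k + 1))).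
have t0 : 0 < t by rewrite lt_min divr_gt0 // divr_gt0.
have tr : t <= r / 8 by rewrite ge_min lexx.
have te : k * t < e / 3.
  have : t <= e / (3 * (k + 1)) by rewrite ge_min lexx orbT.
  rewrite ler_pdivlMr // => h; nra.
clearbody t.
have xe : nr (x + e_ i t - x0) < r.
  rewrite addrAC; apply: le_lt_trans (nr_triangle _ _) _.
  by have := nr_e i _ t0; move: tr r0 xr; clear; lra.
have te0 : 0 < e * t / 6 by rewrite divr_gt0 // mulr_gt0.
have /continuous_nr /(_ _ te0) [d1 d10 hd1] := differentiable_continuous (dF _ xe).
have xr' : nr (x - x0) < r by lra.
have /continuous_nr /(_ _ te0) [d2 d20 hd2] := differentiable_continuous (dF _ xr').
exists (Num.min (Num.min d1 d2) (r / 2 - nr (x - x0))).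
  by rewrite !lt_min d10 d20 subr_gt0.
move=> y; rewrite !lt_min => /andP[/andP[yd1 yd2] yr].
have yx0 : nr (y - x0) < r / 2.
  by have := nr_dist y x x0; move: yr; clear; lra.
have h1 := qj i j _ _ t0 tr xr; have h2 := qj i j _ _ t0 tr yx0.
have h3 : normc (q_ i j t y - q_ i j t x) <= e / 3.
  have -> : q_ i j t y - q_ i j t x = t^-1%:C%C *
     ((F (y + e_ i t) - F (x + e_ i t)) 0 j - (F y - F x) 0 j).
    by rewrite /q_ !mxE; ring.
  rewrite normcM normc_real gtr0_norm ?invr_gt0 // mulrC ler_pdivrMr //.
  apply: le_trans (normcD _ _) _; rewrite normcN.
  have h5 := hd2 y yd2.
  have yxe : nr (y + e_ i t - (x + e_ i t)) < d1.
    by rewrite opprD addrACA subrr addr0.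
  have h6 := hd1 _ yxe.
  apply: le_trans (lerD (nr_coord _ j) (nr_coord _ j)) _.
  by move: h5 h6; clear; lra.
rewrite nr_normc.
apply: le_lt_trans (normc_sub3 _ _ (q_ i j t x) (q_ i j t y)) _.
apply: le_lt_trans (lerD (lerD h2 h3) h1) _.
by move: te; clear; lra.
Qed.

(** The difference quotients of [F] along the curve [g] are the differentiable approximants that
    [hol_near] asks for. *)
Lemma jacobian_hol_near m n (F : V m -> V n) (x0 : V m) (r M : R) (r0 : 0 < r)
  (dF : forall x, nr (x - x0) < r -> differentiable F x)
  (FM : forall x, nr (x - x0) < r -> nr (F x) <= M) i j (g : C^o -> V m) (c : C^o) (d : R) : 0 < d ->
  (forall z, normc (z - c) < d -> differentiable g z) ->
  (forall z, normc (z - c) < d -> nr (g z - x0) < r / 2) ->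
  hol_near (fun z => jacobian F (g z) i j : C^o) c.
Proof.
have [k k0 qj] := jacobian_quotient r0 dF FM.
pose e_ (i : 'I_m) (t : R) : V m := t%:C%C *: delta_mx 0 i.
pose q_ i j t x : C := t^-1%:C%C * (F (x + e_ i t) 0 j - F x 0 j).
have {}qj i' j' t x' : 0 < t -> t <= r / 8 -> nr (x' - x0) < r / 2 ->
  normc (q_ i' j' t x' - jacobian F x' i' j') <= k * t by exact: qj.
have nr_e i' t : 0 < t -> nr (e_ i' t) <= t := @nr_scale_delta m i' t.
move=> d0 dg gr; exists d => //; exists (2 * M / (r / 8) + k * (r / 8)).
  move=> z /gr zr; have r8 : 0 < r / 8 by lra.
  have := qj i j _ _ r8 (lexx _) zr.
  have : normc (q_ i j (r / 8) (g z)) <= 2 * M / (r / 8).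
    rewrite normcM normc_real gtr0_norm ?invr_gt0 // mulrC ler_pM2r ?invr_gt0 //.
    apply: le_trans (normcD _ _) _; rewrite normcN.
    apply: le_trans (lerD (nr_coord _ j) (nr_coord _ j)) _.
    have h1 : nr (F (g z)) <= M by apply: FM; move: zr r0; clear; lra.
    have h2 : nr (F (g z + e_ i (r / 8))) <= M.
      apply: FM; rewrite addrAC; apply: le_lt_trans (nr_triangle _ _) _.
      by have := nr_e i _ r8; move: zr r0; clear; lra.
    by move: h1 h2; clear; lra.
  move: (q_ i j (r / 8) (g z)) (jacobian F (g z) i j) => q a qM qa.
  have := normcD q (a - q); rewrite addrCA subrr addr0 (normcB a).
  by move: qM qa; clear; lra.
move=> e e0; have K1 : 0 < k + 1 by lra.
pose t := Num.min (r / 8) (e / (k + 1)).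
have t0 : 0 < t by rewrite lt_min divr_gt0 // divr_gt0.
have tr : t <= r / 8 by rewrite ge_min lexx.
have te : k * t <= e.
  have : t <= e / (k + 1) by rewrite ge_min lexx orbT.
  rewrite ler_pdivlMr // => h; nra.
clearbody t.
exists (fun z => q_ i j t (g z) : C^o) => z zc; last first.
  by apply: le_trans te; apply: qj => //; exact: gr.
have gz := gr z zc.
have dFj y : nr (y - x0) < r -> differentiable (fun x => F x 0 j : C^o) y.
  move=> yr; apply: (@differentiable_comp _ _ _ _ F (fun v : V n => v 0 j : C^o)).
    exact: dF.
  exact: differentiable_coord.
have gzt : nr (g z + e_ i t - x0) < r.
  rewrite addrAC; apply: le_lt_trans (nr_triangle _ _) _.
  by have := nr_e i _ t0; move: tr r0 gz; clear; lra.
apply: differentiableM; first exact: differentiable_cst.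
apply: differentiableB.
  apply: (@differentiable_comp _ _ _ _ (fun z => g z + e_ i t) (fun x => F x 0 j : C^o)).
    by apply: differentiableD; [exact: dg|exact: differentiable_cst].
  exact: dFj.
apply: (@differentiable_comp _ _ _ _ g (fun x => F x 0 j : C^o)); first exact: dg.
by apply: dFj; lra.
Qed.

End FrechetCalculus.

(** * Local injectivity and local surjectivity *)

Section InverseFunction.
Context {R : realType}.
Local Notation C := R[i].
Local Notation V n := ('rV[C]_n : normedModType C).

Lemma det_jacobian_continuous n (F : V n -> V n) (x0 : V n) (r M : R) : 0 < r ->
  (forall x, nr (x - x0) < r -> differentiable F x) ->
  (forall x, nr (x - x0) < r -> nr (F x) <= M) ->
  forall x, nr (x - x0) < r / 2 ->
  {for x, continuous (fun x => \det (jacobian F x) : C^o)}.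
Proof.
move=> r0 dF FM x xr.
apply: (@det_closed R (V n) (fun f => {for x, continuous (f : V n -> C^o)})).
- by move=> c; exact: cst_continuous.
- by move=> f g cf cg; exact: (continuousD cf cg).
- by move=> f g cf cg; exact: (continuousM cf cg).
- by move=> i j; exact: (jacobian_continuous r0 dF FM).
Qed.

Lemma det_jacobian_hol_near n (F : V n -> V n) (x0 : V n) (r M : R) : 0 < r ->
  (forall x, nr (x - x0) < r -> differentiable F x) ->
  (forall x, nr (x - x0) < r -> nr (F x) <= M) ->
  forall (g : C^o -> V n) (c : C^o) (d : R), 0 < d ->
  (forall z, normc (z - c) < d -> differentiable g z) ->
  (forall z, normc (z - c) < d -> nr (g z - x0) < r / 2) ->
  hol_near (fun z => \det (jacobian F (g z)) : C^o) c.
Proof.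
move=> r0 dF FM g c d d0 dg gr.
apply: (@det_closed R C^o (fun f => hol_near (f : C^o -> C^o) c)).
- move=> a; apply: (@differentiable_hol_near R (fun=> a) c 1 ltr01) => z _.
  exact: differentiable_cst.
- by move=> f h; exact: hol_nearD.
- by move=> f h; exact: hol_nearM.
- by move=> i j; exact: (jacobian_hol_near r0 dF FM i j d0 dg gr).
Qed.

Lemma local_bound m n (F : V m -> V n) (x : V m) : {for x, continuous F} ->
  exists2 r : R, 0 < r & forall y, nr (y - x) < r -> nr (F y) <= nr (F x) + 1.
Proof.
move=> /continuous_nr /(_ 1 ltr01) [r r0 hr]; exists r => // y /hr h.
by have := nr_triangle (F y - F x) (F x); rewrite subrK; lra.
Qed.

Lemma local_bound_ball m n (F : V m -> V n) (x : V m) (r : R) : 0 < r ->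
  (forall y, nr (y - x) < r -> differentiable F y) ->
  exists2 s : R, 0 < s <= r & (forall y, nr (y - x) < s -> differentiable F y) /\
  (forall y, nr (y - x) < s -> nr (F y) <= nr (F x) + 1).
Proof.
move=> r0 dF.
have [|s s0 hs] := @local_bound _ _ F x.
  by apply/differentiable_continuous/dF; rewrite subrr nr0.
exists (Num.min r s); first by rewrite lt_min r0 s0 ge_min lexx.
by split=> y; rewrite lt_min => /andP[yr ys]; [exact: dF|exact: hs].
Qed.

Lemma jacobian_close m n (F : V m -> V n) (x : V m) (r e : R) : 0 < r -> 0 < e ->
  (forall y, nr (y - x) < r -> differentiable F y) ->
  exists2 d : R, 0 < d & forall y, nr (y - x) < d ->
    mxsum (jacobian F y - jacobian F x) <= e.
Proof.
move=> r0 e0 dF; have [s /andP[s0 _] [dFs FM]] := local_bound_ball r0 dF.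
have xs : nr (x - x) < s / 2 by rewrite subrr nr0; lra.
pose K : R := (m * n)%:R + 1.
have K0 : 0 < K by rewrite ltr_wpDl.
have : \forall y \near x, forall i, forall j,
    normc (jacobian F y i j - jacobian F x i j) <= e / K.
  apply: (@filter_forall _ _ (fun i y => forall j,
    normc (jacobian F y i j - jacobian F x i j) <= e / K) _ (nbhs_filter x)) => i.
  apply: (@filter_forall _ _ (fun j y =>
    normc (jacobian F y i j - jacobian F x i j) <= e / K) _ (nbhs_filter x)) => j.
  have /continuous_nr /(_ _ (divr_gt0 e0 K0)) [d d0 hd] :=
    jacobian_continuous s0 dFs FM (i := i) (j := j) xs.
  apply/nbhs_nr; exists d => // y /hd; rewrite nr_normc; exact: ltW.
move=> /nbhs_nr [d d0 hd]; exists d => // y /hd h.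
apply: le_trans (_ : \sum_(i < m) \sum_(j < n) e / K <= _).
  apply: ler_sum => i _; apply: ler_sum => j _; rewrite mxE [X in _ + X]mxE; exact: h.
rewrite !sumr_const !card_ord -mulrnA -mulr_natl mulrCA ler_piMr ?(ltW e0) //.
by rewrite ler_pdivrMr // mul1r /K mulnC lerDl.
Qed.

(** Near [x0] the derivative differs from the one at [x0] by at most [1 / (2 * k)], which gives the
    uniform lower bound [nr v <= 2 * k * nr (v *m jacobian F x)]. The quadratic remainder cannot
    offset it for short nonzero [v]. *)
Lemma local_injective n (F : V n -> V n) (x0 : V n) (r : R) : 0 < r ->
  (forall x, nr (x - x0) < r -> differentiable F x) ->
  jacobian F x0 \in unitmx ->
  exists2 d : R, 0 < d <= r &
    (forall x, nr (x - x0) < d -> jacobian F x \in unitmx) /\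
    (forall x y, nr (x - x0) < d -> nr (y - x0) < d -> F x = F y -> x = y).
Proof.
have aux (k a b c u : R) : u <= k * a -> k * c <= u / 2 ->
    k * (a - b) <= k * c -> u <= 2 * k * b by lra.
move=> r0 dF uA.
have [s /andP[s0 sr] [dFs FM]] := local_bound_ball r0 dF.
pose k := mxsum (invmx (jacobian F x0)) + 1.
have k0 : 0 < k by rewrite /k; have := mxsum_ge0 (invmx (jacobian F x0)); lra.
have k2 : 0 < 1 / (2 * k) by rewrite divr_gt0 // mulr_gt0.
have [d d0 hd] := jacobian_close r0 k2 dF.
have lower x v : nr (x - x0) < d -> nr v <= 2 * k * nr (v *m jacobian F x : V n).
  move=> /hd xd.
  have h1 : nr v <= k * nr (v *m jacobian F x0 : V n).
    apply: le_trans (nr_unitmx v uA) _.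
    by rewrite ler_wpM2r ?nr_ge0 // /k lerDl.
  have h2 : nr (v *m (jacobian F x - jacobian F x0) : V n) <= 1 / (2 * k) * nr v.
    by apply: le_trans (nr_mulmx _ _) _; rewrite ler_wpM2r ?nr_ge0.
  have h3 := nr_rev (v *m jacobian F x0 : V n) (v *m jacobian F x).
  rewrite nrB -mulmxBr in h3.
  have h4 : k * (1 / (2 * k) * nr v) = nr v / 2 by field; exact: lt0r_neq0.
  have h5 : k * nr (v *m (jacobian F x - jacobian F x0) : V n) <= nr v / 2.
    by rewrite -h4 ler_pM2l.
  have h6 : k * (nr (v *m jacobian F x0 : V n) - nr (v *m jacobian F x : V n)) <=
      k * nr (v *m (jacobian F x - jacobian F x0) : V n) by rewrite ler_pM2l.
  exact: aux h1 h5 h6.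
have [K K0 so] : exists2 K : R, 0 <= K & forall x v : V n, nr (x - x0) < s / 2 ->
    nr v <= s / 8 -> nr (F (x + v) - F x - 'd F x v) <= K * nr v ^+ 2.
  exists (128 * (nr (F x0) + 1) / s ^+ 2); last exact: second_order_row s0 dFs FM.
  rewrite mulr_ge0 ?invr_ge0 ?sqr_ge0 // mulr_ge0 //.
  by have := nr_ge0 (F x0); lra.
have kK : 0 < 1 / (4 * k * (K + 1)) by rewrite divr_gt0 // !mulr_gt0 //; lra.
(* Two points this close to [x0] differ by less than [1 / (2 * k * (K + 1))] and by less than
   [s / 8]. *)
exists (Num.min (Num.min d (s / 32)) (1 / (4 * k * (K + 1)))).
  rewrite !lt_min d0 kK /= !ge_min; apply/andP; split; first lra.
  by apply/orP; left; apply/orP; right; lra.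
split=> [x|x y]; rewrite !lt_min.
  move=> /andP[/andP[xd _] _].
  rewrite -row_free_unit; apply/inj_row_free => v v0.
  by apply/eqP; rewrite -(nr_eq0 (v : V n)); apply/eqP/le_anti; rewrite nr_ge0 andbT;
    apply: le_trans (lower x v xd) _; rewrite v0 [nr _]nr0 mulr0.
move=> /andP[/andP[xd xs] xk] /andP[/andP[yd ys] yk] Fxy.
apply/eqP; rewrite -subr_eq0 -nr_eq0; apply/eqP.
pose v := y - x.
have vE : nr v < 1 / (2 * k * (K + 1)).
  have h := nr_dist y x0 x; rewrite (nrB x0) in h.
  have E : 1 / (2 * k * (K + 1)) = 2 * (1 / (4 * k * (K + 1))).
    by field; rewrite (lt0r_neq0 k0) lt0r_neq0 //; lra.
  by rewrite E; move: h xk yk; rewrite /v; clear; lra.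
have vs : nr v <= s / 8.
  by have := nr_dist y x0 x; rewrite (nrB x0) /v; move: ys xs s0; clear; lra.
have xs2 : nr (x - x0) < s / 2 by move: xs s0; clear; lra.
have := so x v xs2 vs.
rewrite (_ : x + v = y); last by rewrite /v addrC subrK.
rewrite -Fxy subrr sub0r nrN diff_jacobian => H.
have h := lower x v xd.
have {}h : nr v <= 2 * k * (K * nr v ^+ 2).
  by apply: le_trans h _; rewrite ler_pM2l ?mulr_gt0.
have v1 : 2 * k * (K + 1) * nr v < 1.
  by move: vE; rewrite ltr_pdivlMr ?mulr_gt0 //; [rewrite mulrC|lra].
rewrite -nrN opprB -/v.
have nv := nr_ge0 v.
apply/eqP; move: nv; rewrite le_eqVlt => /orP[/eqP <- //|nv]; exfalso.
have : 2 * k * K * nr v < 1.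
  apply: le_lt_trans v1; rewrite ler_pM2r // ler_pM2l ?mulr_gt0 //; lra.
rewrite -(ltr_pM2r nv) mul1r; move: h; move: (nr v) => u; clear; lra.
Qed.

Lemma compact_sphere n (c : V n) (r : R) : compact ([set v | nr (v - c) = r] : set (V n)).
Proof.
apply: (subclosed_compact _ (@compact_row R n c r)); last by move=> v /= ->.
have cf : continuous (fun v : V n => nr (v - c)).
  by move=> x; apply: (@nr_comp_continuous R (V n) (V n) id); exact: cvg_id.
by move/continuous_closedP : cf => /(_ _ (@closed_eq R r)).
Qed.

(** Compactness of the sphere. The factor 2 leaves room: a point within [d] of [F x0] is farther
    than [d] from the image of the sphere, so a closest value of [F] on the closed ball is attained
    inside. *)
Lemma sphere_gap m n (F : V m -> V n) (x0 : V m) (r : R) :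
  (forall x, nr (x - x0) = r -> {for x, continuous F}) ->
  (forall x, nr (x - x0) = r -> F x != F x0) ->
  exists2 d : R, 0 < d & forall x, nr (x - x0) = r -> 2 * d <= nr (F x - F x0).
Proof.
move=> cF Fx0.
have [S0|S0] := pselect ([set v : V m | nr (v - x0) = r] !=set0); last first.
  exists 1 => // x xr; exfalso; apply: S0; by exists x.
have [|c cr cmin] := @compact_max R _ _ (fun x => - nr (F x - F x0))
    (@compact_sphere m x0 r) S0.
  by move=> x xr; apply: continuousN; apply: nr_comp_continuous; exact: cF.
exists (nr (F c - F x0) / 2).
  by rewrite divr_gt0 // nr_gt0 subr_eq0; exact: Fx0.
by move=> x /cmin; rewrite lerN2; lra.
Qed.

(* At an interior minimum of [nr (F y - w)] a Newton step would decrease it. *)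
Lemma surjective_ball n (F : V n -> V n) (x0 : V n) (r d : R) : 0 < r ->
  (forall x, nr (x - x0) <= r -> differentiable F x) ->
  (forall x, nr (x - x0) < r -> jacobian F x \in unitmx) ->
  (forall x, nr (x - x0) = r -> 2 * d <= nr (F x - F x0)) ->
  forall w, nr (w - F x0) < d -> exists2 y, nr (y - x0) < r & F y = w.
Proof.
have aux (e t N N1 X : R) : 0 < t -> 0 < e -> N1 <= X -> X <= t * e / 2 ->
    e <= N -> N <= N1 + (1 - t) * e -> False.
  by move=> t0 e0; have := mulr_gt0 t0 e0; lra.
move=> r0 dF uF gap w wd.
have [||c cr cmin] := @compact_max R _ _ (fun x => - nr (F x - w))
    (@compact_row R n x0 r).
- by exists x0; rewrite /= subrr nr0 ltW.
- by move=> x xr; apply: continuousN; apply/nr_comp_continuous/differentiable_continuous/dF.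
have {}cmin x : nr (x - x0) <= r -> nr (F c - w) <= nr (F x - w).
  by move=> /cmin; rewrite lerN2.
have cr' : nr (c - x0) < r.
  rewrite lt_neqAle cr andbT; apply/negP => /eqP /gap h.
  have := cmin x0; rewrite subrr nr0 (nrB (F x0)) => /(_ (ltW r0)) h1.
  by have := nr_dist (F c) w (F x0); move: h h1 wd; clear; lra.
exists c => //; apply/eqP; rewrite -subr_eq0; apply/negPn/negP => ec.
pose A := jacobian F c; pose e := F c - w; pose v : V n := - (e *m invmx A).
have uA : A \in unitmx by exact: uF.
have vA : v *m A = - e by rewrite /v mulNmx mulmxKV.
have ne : 0 < nr e by rewrite nr_gt0.
have nv1 : 0 < 2 * (nr v + 1) by have := nr_ge0 v; lra.
have [s s0 hs] := differentiable_nr (dF c cr) (divr_gt0 ne nv1).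
have nv2 : 0 < nr v + 1 by have := nr_ge0 v; lra.
have rc : 0 < r - nr (c - x0) by rewrite subr_gt0.
(* Small enough for [c + t *: v] to stay in the ball and for the remainder to be at most half of the
   gain [t * nr e] of the linear part. *)
pose t := Num.min 1 (Num.min s (r - nr (c - x0)) / (2 * (nr v + 1))).
have ms : 0 < Num.min s (r - nr (c - x0)) by rewrite lt_min s0.
have t0 : 0 < t by rewrite lt_min ltr01 divr_gt0.
have t1 : t <= 1 by rewrite ge_min lexx.
have tv : t * nr v < Num.min s (r - nr (c - x0)).
  have : t <= Num.min s (r - nr (c - x0)) / (2 * (nr v + 1)) by rewrite ge_min lexx orbT.
  rewrite ler_pdivlMr // => h; apply: lt_le_trans h.
  by have := nr_ge0 v; move: t0; clear; move: (nr v) => u; nra.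
move: tv; rewrite lt_min => /andP[ts tr]; clearbody t.
have ntv : nr (t%:C%C *: v) = t * nr v by rewrite nrZ normc_real gtr0_norm.
have := hs (t%:C%C *: v); rewrite ntv => /(_ ts) H.
have := cmin (c + t%:C%C *: v); rewrite addrAC => H2.
have {}H2 : nr e <= nr (F (c + t%:C%C *: v) - w).
  apply: H2; apply: le_trans (nr_triangle _ _) _; rewrite ntv.
  by move: tr; clear; lra.
have E : F (c + t%:C%C *: v) - w = (F (c + t%:C%C *: v) - F c - 'd F c (t%:C%C *: v)) +
    (1 - t)%:C%C *: e.
  have -> : 'd F c (t%:C%C *: v) = - (t%:C%C *: e).
    by rewrite diff_jacobian -scalemxAl -/A vA scalerN.
  rewrite rmorphB rmorph1 scalerBl scale1r opprK -addrA [_ *: e + _]addrC subrK.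
  by rewrite /e addrA subrK.
have := nr_triangle (F (c + t%:C%C *: v) - F c - 'd F c (t%:C%C *: v)) ((1 - t)%:C%C *: e).
rewrite -E nrZ normc_real ger0_norm ?subr_ge0 // => H3.
have h4 : nr e / (2 * (nr v + 1)) * (t * nr v) <= t * nr e / 2.
  rewrite [leLHS]mulrAC ler_pdivrMr //.
  by have := nr_ge0 v; move: t0 ne; clear; move: (nr v) (nr e) => u1 u2; nra.
exact: (aux _ _ _ _ _ t0 ne H h4 H2 H3).
Qed.

End InverseFunction.

(** * Differentiability of the inverse map *)

Section LocalInverse.
Context {R : realType}.
Local Notation C := R[i].
Local Notation V n := ('rV[C]_n : normedModType C).

Lemma diff_row_linear m n (F : V m -> V n) (x : V m) (A : 'M[C]_(m, n)) :
  (forall e : R, 0 < e -> exists2 d : R, 0 < d & forall v : V m,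
    nr v < d -> nr (F (x + v) - F x - v *m A : V n) <= e * nr v) ->
  differentiable F x /\ jacobian F x = A.
Proof.
move=> h.
have [|//|dF dE] := @nr_differentiable R (V m) (V n) F x (mulmxr A) (mxsum A).
  by move=> v; exact: nr_mulmx.
by split=> //; apply/row_matrixP => i; rewrite !rowE -diff_jacobian dE.
Qed.

Lemma open_map_at n (F : V n -> V n) (x0 : V n) (r : R) : 0 < r ->
  (forall x, nr (x - x0) < r -> differentiable F x) ->
  jacobian F x0 \in unitmx ->
  forall e : R, 0 < e -> exists2 d : R, 0 < d & forall w, nr (w - F x0) < d ->
    exists2 y, nr (y - x0) < e & F y = w.
Proof.
move=> r0 dF uF e e0; have [d /andP[d0 dr] [ud injd]] := local_injective r0 dF uF.
have [s [s0 sd se]] := exists_lt2 d0 e0.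
have dFs x : nr (x - x0) <= s -> differentiable F x.
  by move=> xs; apply: dF; move: xs sd dr; clear; lra.
have [||g g0 gap] := @sphere_gap R n n F x0 s.
- by move=> x xs; apply/differentiable_continuous/dFs; rewrite xs.
- move=> x xs; apply/eqP => Fx; have xx0 : x = x0.
    by apply: injd => //; rewrite ?xs // subrr nr0.
  by move: xs; rewrite xx0 subrr nr0 => s00; move: s0; rewrite -s00 ltxx.
exists g => // w wg; have [|y ys Fy] := surjective_ball s0 dFs _ gap wg.
  by move=> x xs; apply: ud; exact: lt_trans sd.
by exists y => //; exact: lt_trans se.
Qed.

(** With [h = g (w + v) - g w], the expansion of [F] at [g w] reads [v = h *m A + o(h)].
    Invertibility of [A] gives [nr h <= 2 * k * nr v], so the error is also [o(v)]. *)
Lemma inverse_differentiable n (F g : V n -> V n) (w : V n) :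
  differentiable F (g w) -> jacobian F (g w) \in unitmx ->
  {for w, continuous g} ->
  (exists2 d : R, 0 < d & forall w', nr (w' - w) < d -> F (g w') = w') ->
  differentiable g w /\ jacobian g w = invmx (jacobian F (g w)).
Proof.
move=> dF uA /continuous_nr cg [d d0 Fg]; set A := jacobian F (g w) in uA *.
apply: diff_row_linear => e e0.
pose k := mxsum (invmx A) + 1.
have k0 : 0 < k by rewrite /k; have := mxsum_ge0 (invmx A); lra.
have kb (v : V n) : nr (v *m invmx A : V n) <= k * nr v.
  apply: le_trans (nr_mulmx _ _) _; rewrite ler_wpM2r ?nr_ge0 // /k.
  by rewrite lerDl.
have kb2 (v : V n) : nr v <= k * nr (v *m A : V n).
  by have := kb (v *m A); rewrite mulmxK.
clearbody k.
pose e' := Num.min (1 / (2 * k)) (e / (2 * k ^+ 2)).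
have k2 : 0 < 2 * k by lra.
have k3 : 0 < 2 * k ^+ 2 by rewrite mulr_gt0 // exprn_gt0.
have e'0 : 0 < e' by rewrite lt_min !divr_gt0.
have e'1 : k * e' <= 1 / 2.
  have : e' <= 1 / (2 * k) by rewrite ge_min lexx.
  by rewrite ler_pdivlMr // => h; lra.
have e'2 : 2 * (k * (e' * k)) <= e.
  have : e' <= e / (2 * k ^+ 2) by rewrite ge_min lexx orbT.
  by rewrite ler_pdivlMr // => h; lra.
clearbody e'.
have [s s0 hs] := differentiable_nr dF e'0.
have [t t0 ht] := cg _ s0.
exists (Num.min d t); first by rewrite lt_min d0.
move=> v; rewrite lt_min => /andP[vd vt].
pose h := g (w + v) - g w.
have wv : w + v - w = v by rewrite addrC addKr.
have hs' : nr h < s by apply: ht; rewrite wv.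
have := hs h hs'.
rewrite (_ : g w + h = g (w + v)); last by rewrite /h addrC subrK.
rewrite !Fg ?wv ?subrr ?nr0 // diff_jacobian -/A => H1.
have H2 := kb2 h.
have H3 : nr (h *m A : V n) <= nr v + e' * nr h.
  have := nr_triangle (h *m A - v : V n) v; rewrite subrK (nrB _ v).
  by move: H1; clear; lra.
have H4 : nr h <= 2 * k * nr v.
  have H5 : k * nr (h *m A : V n) <= k * (nr v + e' * nr h) by rewrite ler_pM2l.
  have H6 : k * e' * nr h <= 1 / 2 * nr h by rewrite ler_wpM2r ?nr_ge0.
  by move: H2 H5 H6; clear; lra.
have -> : g (w + v) - g w - v *m invmx A = - ((v - h *m A) *m invmx A) :> V n.
  by rewrite mulmxBl mulmxK // opprB /h.
rewrite nrN; apply: le_trans (kb _) _.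
apply: le_trans (_ : k * (e' * nr h) <= _); first by rewrite ler_pM2l.
apply: le_trans (_ : k * (e' * (2 * k * nr v)) <= _).
  by rewrite ler_pM2l // ler_pM2l.
rewrite (_ : k * (e' * (2 * k * nr v)) = 2 * (k * (e' * k)) * nr v); last by ring.
by rewrite ler_wpM2r ?nr_ge0.
Qed.

Definition inv_on n (D : set (V n)) (F : V n -> V n) (w : V n) : V n :=
  xget 0 [set x | D x /\ F x = w].

Lemma inv_onP n (D : set (V n)) (F : V n -> V n) x : D x ->
  D (inv_on D F (F x)) /\ F (inv_on D F (F x)) = F x.
Proof. by move=> Dx; apply: (@xgetPex _ 0 [set y | D y /\ F y = F x]); exists x. Qed.

Lemma inv_onK n (D : set (V n)) (F : V n -> V n) x : set_inj D F -> D x ->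
  inv_on D F (F x) = x.
Proof.
move=> injF Dx; have [h1 h2] := @inv_onP n D F x Dx.
by apply: injF => //; exact: mem_set.
Qed.

Section InjectiveOnOpen.
Context {n : nat} (D : set (V n)) (F : V n -> V n) (oD : forall x, D x -> nbhs x D)
  (dF : forall x, D x -> differentiable F x) (injF : set_inj D F).

Lemma open_ball x : D x -> exists2 r : R, 0 < r & forall y, nr (y - x) < r -> D y.
Proof. by move=> /oD /nbhs_nr. Qed.

Lemma open_map_on x : D x -> jacobian F x \in unitmx ->
  forall e : R, 0 < e -> exists2 d : R, 0 < d & forall w, nr (w - F x) < d ->
    exists2 y, D y /\ nr (y - x) < e & F y = w.
Proof.
move=> Dx uF e e0; have [r r0 hr] := open_ball Dx.
have m0 : 0 < Num.min r e by rewrite lt_min r0.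
have [d d0 hd] := open_map_at r0 (fun y yr => dF (hr y yr)) uF m0.
exists d => // w /hd [y]; rewrite lt_min => /andP[yr ye] Fy.
by exists y => //; split=> //; exact: hr.
Qed.

Lemma inv_on_continuous x : D x -> jacobian F x \in unitmx ->
  {for F x, continuous (inv_on D F)}.
Proof.
move=> Dx uF; apply/continuous_nr => e e0.
have [d d0 hd] := open_map_on Dx uF e0.
exists d => // w /hd [y [Dy ye] <-]; by rewrite !inv_onK.
Qed.

Lemma inv_on_differentiable x : D x -> jacobian F x \in unitmx ->
  differentiable (inv_on D F) (F x) /\
  jacobian (inv_on D F) (F x) = invmx (jacobian F x).
Proof.
move=> Dx uF; have E : inv_on D F (F x) = x by exact: inv_onK.
rewrite -[in invmx _]E; apply: inverse_differentiable; rewrite ?E //.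
- exact: dF.
- exact: inv_on_continuous.
- have [d d0 hd] := open_map_on Dx uF (ltr01 : 0 < 1 :> R).
  by exists d => // w /hd [y [Dy _] <-]; rewrite inv_onK.
Qed.

End InjectiveOnOpen.

End LocalInverse.

(** * Invertibility of the derivative of an injective holomorphic map *)

Section Straightening.
Context {K : fieldType} {n : nat}.
Implicit Types (A B E J p : 'M[K]_n) (u : 'rV[K]_n).

(** From [A = L *m pid_mx k *m U] with [L], [U] invertible: [B = U^-1 *m pid_mx k] and
    [E = L *m (1 - pid_mx k)] give [A *m B + E = L]. The projection [p] keeps the first [k]
    coordinates and [j] is the first one it kills. *)
Lemma straighten A : (\rank A < n)%N -> exists B E p (j : 'I_n),
  [/\ B *m p = B, E *m p = 0, A *m B + E \in unitmx, (\rank E <= n - \rank A)%N &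
      delta_mx 0 j *m p = 0 :> 'rV_n].
Proof.
set k := \rank A => kn; have kn' := ltnW kn.
have pidk : (pid_mx k : 'M[K]_n) *m (pid_mx k : 'M[K]_n) = pid_mx k by rewrite pid_mx_id.
exists (invmx (row_ebase A) *m pid_mx k), (col_ebase A *m copid_mx k), (pid_mx k), (Ordinal kn).
split.
- by rewrite -mulmxA pidk.
- by rewrite -mulmxA /copid_mx mulmxBl mul1mx pidk subrr mulmx0.
- rewrite -{1}(mulmx_ebase A) mulmxA mulmxK ?row_ebase_unit // -mulmxA pidk.
  by rewrite /copid_mx mulmxBr mulmx1 addrC subrK col_ebase_unit.
- by apply: leq_trans (mxrankM_maxr _ _) _; rewrite rank_copid_mx.
- by apply/rowP => j; rewrite -rowE !mxE /= ltnn andbF.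
Qed.

(** For [v = u *m invmx (J *m B + E)], applying [p] gives [v *m J *m B = u *m p = 0]. The ranks
    force [J *m B] and [J] to have the same left kernel, so already [v *m J = 0]. *)
Lemma straighten_ker k J B E p u : B *m p = B -> E *m p = 0 -> u *m p = 0 ->
  J *m B + E \in unitmx -> (k <= n)%N -> (\rank E <= n - k)%N -> (\rank J <= k)%N ->
  u *m invmx (J *m B + E) *m J = 0.
Proof.
move=> Bp Ep up uJ kn rE rJ; set v := u *m _; set X := J *m B.
have vX : v *m X = 0.
  have : v *m (J *m B + E) *m p = 0 by rewrite mulmxKV.
  by rewrite mulmxDr mulmxDl -!mulmxA Bp Ep !mulmx0 addr0.
have rX : (k <= \rank X)%N.
  have := mxrank_add X E; rewrite (mxrank_unit uJ) => h.
  by rewrite -(leq_add2r (n - k)) subnKC // (leq_trans h) // leq_add2l.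
have sub : (kermx J <= kermx X)%MS.
  by apply/sub_kermxP; rewrite mulmxA mulmx_ker mul0mx.
have sub2 : (kermx X <= kermx J)%MS.
  rewrite -(mxrank_leqif_sup sub) !mxrank_ker eqn_leq leq_sub2l ?mxrankM_maxl //=.
  exact: leq_sub2l (leq_trans rJ rX).
apply/sub_kermxP; apply: submx_trans sub2; exact/sub_kermxP.
Qed.

End Straightening.

(** * Generic rank of an injective holomorphic map *)

Section GenericRank.
Context {R : realType}.
Local Notation C := R[i].
Local Notation V n := ('rV[C]_n : normedModType C).

(** The real mean value theorem on the segment from [0] to [z], for the real and imaginary parts in
    turn. *)
Lemma zero_derivative_cst (f : C^o -> C^o) (r : R) :
  (forall z : C^o, normc z < r -> differentiable f z /\ 'd f z 1 = 0) ->
  forall z, normc z < r -> f z = f 0.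
Proof.
move=> df z zr.
have zero (p : C -> R) : (forall a b : C, p (a - b) = p a - p b) ->
    (forall a, `|p a| <= normc a) -> p (f z) = p (f 0).
  move=> pB pn.
  have H (t : R) : 0 <= t <= 1 -> is_derive t 1 (fun t : R => p (f (t%:C%C * z))) 0.
    move=> /andP[t0 t1]; apply/is_derive_eps => e e0.
    have tz : normc (t%:C%C * z) < r.
      apply: le_lt_trans zr; rewrite normcM normc_real ger0_norm //.
      by rewrite ler_piMl ?normc_ge0.
    have [dfz dfz0] := df _ tz.
    have nz : 0 < normc z + 1 by rewrite ltr_wpDl ?normc_ge0.
    have [s s0 hs] := differentiable_normc dfz (divr_gt0 e0 nz).
    exists (s / (normc z + 1)); first exact: divr_gt0.
    move=> h; rewrite ltr_pdivlMr // => hh.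
    have hzE : normc (h%:C%C * z) = `|h| * normc z by rewrite normcM normc_real.
    have hz : normc (h%:C%C * z) < s.
      apply: le_lt_trans hh; rewrite hzE ler_wpM2l //; lra.
    have := hs _ hz; rewrite dfz0 mulr0 subr0 -mulrDl -rmorphD /= => H.
    rewrite mul0r subr0 -pB; apply: le_trans (pn _) _; apply: le_trans H _.
    rewrite hzE mulrAC ler_pdivrMr // -mulrA ler_pM2l // ler_wpM2l //; lra.
  have [c _] := derive_MVT ler01 H.
  have -> : (1%:C%C * z : C) = z by exact: mul1r.
  have -> : (0%:C%C * z : C) = 0 by exact: mul0r.
  by rewrite mul0r => /eqP; rewrite subr_eq0 => /eqP.
apply/eqP; rewrite eq_complex; apply/andP; split; apply/eqP.
- by apply: zero => [a b|a]; [rewrite raddfB|exact: normc_Re].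
- by apply: zero => [a b|a]; [rewrite raddfB|exact: normc_Im].
Qed.

Lemma jacobian_comp m n p (F : V m -> V n) (G : V n -> V p) (x : V m) :
  differentiable F x -> differentiable G (F x) ->
  differentiable (G \o F) x /\
  jacobian (G \o F) x = jacobian F x *m jacobian G (F x).
Proof.
move=> dF dG; split; first exact: differentiable_comp.
apply/row_matrixP => i; rewrite !rowE mulmxA -!diff_jacobian.
by rewrite diff_comp.
Qed.

Lemma jacobian_affine_comb m n p (F : V m -> V n) (B : 'M[C]_(n, p))
    (D : 'M[C]_(m, p)) (x : V m) : differentiable F x ->
  differentiable (fun x => F x *m B + x *m D : V p) x /\
  jacobian (fun x => F x *m B + x *m D : V p) x = jacobian F x *m B + D.
Proof.
move=> dF; apply: diff_row_linear => e e0.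
have b0 : 0 < mxsum B + 1 by have := mxsum_ge0 B; lra.
have [d d0 hd] := differentiable_nr dF (divr_gt0 e0 b0).
exists d => // v /hd; rewrite diff_jacobian => H.
have -> : F (x + v) *m B + (x + v) *m D - (F x *m B + x *m D) -
    v *m (jacobian F x *m B + D) = (F (x + v) - F x - v *m jacobian F x) *m B.
  rewrite !mulmxBl mulmxDr mulmxDl mulmxA.
  move: (_ *m B) (F x *m B) (x *m D) (v *m D) (_ *m B) => a1 a2 a3 a4 a5.
  by apply/rowP => i; rewrite !mxE; ring.
apply: le_trans (nr_mulmx _ _) _.
apply: le_trans (_ : (mxsum B + 1) * (e / (mxsum B + 1) * nr v) <= _).
  apply: ler_pM; rewrite ?mxsum_ge0 ?nr_ge0 //; lra.
by rewrite mulrA mulrCA mulfV ?mulr1 //; exact: lt0r_neq0.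
Qed.

(* If the rank were generically [k < n], straightening [F] by [Phi] would give a
   curve along which [F] is constant. *)
Lemma generic_unit n (D : set (V n)) (F : V n -> V n) :
  (forall x, D x -> nbhs x D) -> (forall x, D x -> differentiable F x) ->
  set_inj D F -> forall x0 (e : R), D x0 -> 0 < e ->
  exists2 x, D x /\ nr (x - x0) < e & jacobian F x \in unitmx.
Proof.
move=> oD dF injF x0 e Dx0 e0.
have [r0 r00 hr0] := open_ball oD Dx0.
pose r := Num.min r0 e.
have r_gt0 : 0 < r by rewrite lt_min r00.
have hr y : nr (y - x0) < r -> D y /\ nr (y - x0) < e.
  by rewrite lt_min => /andP[/hr0].
clearbody r.
pose P k := `[< exists2 x, nr (x - x0) < r & \rank (jacobian F x) = k >].
have exP : exists k, P k.
  exists (\rank (jacobian F x0)); apply/asboolP; exists x0 => //.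
  by rewrite subrr nr0.
have bP k : P k -> (k <= n)%N by move=> /asboolP [x _ <-]; exact: rank_leq_row.
case: (ex_maxnP exP bP) => k /asboolP [x1 x1r rk] kmax.
have [kn|kn] := ltnP k n; last first.
  exists x1; first exact: hr.
  by rewrite -row_free_unit /row_free eqn_leq rank_leq_row rk.
exfalso.
have := kn; rewrite -rk => /straighten [B [E [p [j [Bp Ep uBE rE up]]]]].
rewrite rk in rE.
pose Phi (x : V n) : V n := F x *m B + x *m E.
have dPhi x : D x -> differentiable Phi x /\
    jacobian Phi x = jacobian F x *m B + E.
  by move=> Dx; apply: jacobian_affine_comb; exact: dF.
have uPhi : jacobian Phi x1 \in unitmx.
  by have [_ ->] := dPhi x1 (hr x1 x1r).1.
have s0 : 0 < r - nr (x1 - x0) by rewrite subr_gt0.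
have inr y : nr (y - x1) < r - nr (x1 - x0) -> nr (y - x0) < r.
  by have := nr_dist y x1 x0; lra.
have dPhi1 y : nr (y - x1) < r - nr (x1 - x0) -> differentiable Phi y.
  by move=> /inr /hr [Dy _]; have [] := dPhi y Dy.
have [d /andP[d0 ds] [ud injd]] := local_injective s0 dPhi1 uPhi.
pose D1 : set (V n) := [set y | nr (y - x1) < d].
have oD1 y : D1 y -> nbhs y D1 by exact: nr_ball_open.
have D1D y : D1 y -> nr (y - x0) < r.
  by move=> D1y; apply: inr; exact: lt_le_trans D1y ds.
have dPhiD1 y : D1 y -> differentiable Phi y.
  by move=> /D1D /hr [Dy _]; have [] := dPhi y Dy.
have injD1 : set_inj D1 Phi.
  by move=> x y /set_mem D1x /set_mem D1y; exact: injd.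
have D1x1 : D1 x1 by rewrite /D1 /= subrr nr0.
pose G := inv_on D1 Phi.
have [q q0 hq] := open_map_on oD1 dPhiD1 D1x1 uPhi (ltr01 : 0 < 1 :> R).
pose u : V n := delta_mx 0 j.
have nu : nr u <= 1 by have := @nr_scale_delta R n j 1 ltr01; rewrite scale1r.
have u0 : u != 0.
  by apply/eqP => /rowP /(_ j) /eqP; rewrite !mxE !eqxx oner_eq0.
pose w (z : C) : V n := Phi x1 + z *: u.
have wq z : normc z < q -> exists2 y, D1 y & Phi y = w z.
  move=> zq; have [|y [D1y _] yE] := hq (w z); last by exists y.
  rewrite /w addrC addKr nrZ; apply: le_lt_trans zq.
  by rewrite ler_piMr ?normc_ge0.
(* Maximality of [k] bounds the rank of the derivative of [F] at every point nearby, as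
   [straighten_ker] requires. *)
have kerF y : D1 y -> u *m invmx (jacobian Phi y) *m jacobian F y = 0.
  move=> D1y; have yr := D1D y D1y.
  have uy : jacobian Phi y \in unitmx by exact: ud.
  have [_ JE] := dPhi y (hr y yr).1.
  rewrite JE in uy *; apply: (straighten_ker Bp Ep up uy (ltnW kn) rE).
  by apply: kmax; apply/asboolP; exists y.
(* [G] maps the line [w] to a curve whose velocity is annihilated by the derivative of [F]. Its
   points are distinct, which will contradict injectivity. *)
have cst (z : C^o) : normc z < q -> F (G (w z)) = F (G (w 0)).
  move=> zq; apply/rowP => i.
  apply: (@zero_derivative_cst (fun z : C^o => F (G (w z)) 0 i : C^o) q _ z zq) => t tq.
  have [y D1y yE] := wq t tq.
  have uy : jacobian Phi y \in unitmx by exact: ud.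
  have [dG JG] := inv_on_differentiable oD1 dPhiD1 injD1 D1y uy.
  have Gy : G (Phi y) = y by exact: inv_onK.
  have dFG : differentiable F (G (Phi y)).
    by rewrite Gy; apply: dF; have [] := hr y (D1D y D1y).
  have [dFGw JFG] := jacobian_comp dG dFG.
  rewrite yE in dFGw JFG.
  have [dl dlE] := @line_coord R (V n) n (F \o G) (Phi x1) u t i dFGw.
  split; first exact: dl.
  rewrite dlE diff_jacobian -/(w t) JFG -yE -/G Gy [jacobian _ _]JG mulmxA kerF // mxE //.
have q2 : 0 < q / 2 by lra.
pose z : C := (q / 2)%:C%C.
have zn : normc z = q / 2 by rewrite normc_real gtr0_norm.
have zq : normc z < q by rewrite zn; lra.
have [y D1y yE] := wq z zq.
have Gy : G (w z) = y by rewrite -yE; exact: inv_onK.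
have Gx : G (w 0) = x1 by rewrite /w scale0r addr0; exact: inv_onK.
have Fyx : F y = F x1 := etrans (etrans (congr1 F (esym Gy)) (cst z zq)) (congr1 F Gx).
have yx : y = x1.
  by apply: injF => //; apply: mem_set; [have [] := hr y (D1D y D1y)|have [] := hr x1 x1r].
move: yE; rewrite yx /w => /eqP; rewrite eq_sym addrC -subr_eq0 addrK scaler_eq0.
by rewrite (negbTE u0) orbF -normc_eq0 zn gt_eqF.
Qed.

End GenericRank.

Lemma nr_gap (R : realType) (p q : R[i]^o) : nr (p - q) < normc q -> p != 0.
Proof. by apply: contraTneq => ->; rewrite sub0r nrN nr_normc ltxx. Qed.

Lemma lipschitz_arith (R : realType) (L h e x x1 x2 y1 y2 n n1 n2 m m1 : R) :
  0 <= L -> h * (2 + 2 * L) = e -> x <= y1 + x1 -> y1 < h -> x1 <= x2 + y2 -> y2 < h ->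
  x2 <= L * m -> m <= n1 + m1 -> n1 < h -> m1 <= n + n2 -> n2 < h -> x <= L * n + e.
Proof.
move=> L0 <- a1 a2 a3 a4 a5 a6 a7 a8 a9.
have : L * m <= L * (n + 2 * h) by rewrite ler_wpM2l //; lra.
lra.
Qed.

(** * Osgood's theorem at one point *)

Section Osgood.
Context {R : realType} {n : nat}.
Local Notation C := R[i].
Local Notation V := ('rV[C]_n : normedModType C).
Context (F : V -> V) (x0 : V) (r M d : R) (r0 : 0 < r)
  (dF : forall x, nr (x - x0) < r -> differentiable F x)
  (FM : forall x, nr (x - x0) < r -> nr (F x) <= M)
  (injF : forall x y, nr (x - x0) < r -> nr (y - x0) < r -> F x = F y -> x = y)
  (d0 : 0 < d)
  (gap : forall x, nr (x - x0) = r / 4 -> 2 * d <= nr (F x - F x0)).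

(** With radius [r / 4] even the closed ball lies within [r / 2] of [x0], where the Jacobian
    determinant is known to be continuous. *)
Let D : set V := [set x | nr (x - x0) < r / 4].
Let G := inv_on D F.
Let w0 := F x0.

Lemma osgood_open x : D x -> nbhs x D.
Proof. exact: nr_ball_open. Qed.

Lemma osgood_lt x : nr (x - x0) <= r / 4 -> nr (x - x0) < r / 2.
Proof. by move=> h; apply: le_lt_trans h _; rewrite ltr_pM2l // ltf_pV2 ?posrE // ltr_nat. Qed.

Lemma osgood_ltr x : nr (x - x0) <= r / 4 -> nr (x - x0) < r.
Proof. by move=> h; apply: le_lt_trans h _; rewrite ltr_pdivrMr // ltr_pMr // ltr1n. Qed.

Lemma osgood_diff x : D x -> differentiable F x.
Proof. by move=> Dx; apply: dF; apply: osgood_ltr; exact: ltW. Qed.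

Lemma osgood_inj : set_inj D F.
Proof.
by move=> x y /set_mem Dx /set_mem Dy; apply: injF; apply: osgood_ltr; exact: ltW.
Qed.

Lemma osgood_center : D x0.
Proof. by rewrite /D /= subrr nr0 divr_gt0. Qed.

Lemma osgood_interior x : nr (x - x0) <= r / 4 -> nr (F x - w0) < 2 * d -> D x.
Proof.
move=> xr Fx; rewrite /D /= lt_neqAle xr andbT; apply/negP => /eqP /gap.
by rewrite leNgt Fx.
Qed.

Lemma osgood_det_continuous x : nr (x - x0) <= r / 4 ->
  {for x, continuous (fun x => \det (jacobian F x) : C^o)}.
Proof. by move=> /osgood_lt; exact: (det_jacobian_continuous r0 dF FM). Qed.

Lemma osgood_min (f : V -> R) :
  (forall x, nr (x - x0) <= r / 4 -> {for x, continuous f}) ->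
  (forall x, nr (x - x0) <= r / 4 -> 0 < f x) ->
  exists2 m : R, 0 < m & forall x, nr (x - x0) <= r / 4 -> m <= f x.
Proof.
move=> cf f0.
have [||c cr cmin] := @compact_max R _ _ (fun x => - f x) (@compact_row R n x0 (r / 4)).
- by exists x0; rewrite /= subrr nr0 divr_ge0 // ltW.
- by move=> x xr; apply: continuousN; exact: cf.
by exists (f c) => [|x /cmin]; [exact: f0|rewrite lerN2].
Qed.

Lemma osgood_GF x : D x -> G (F x) = x.
Proof. by move=> Dx; apply: inv_onK => //; exact: osgood_inj. Qed.

(* Extended by 0, the Jacobian determinant is continuous on the target. *)
Definition osgood_h (w : V) : C :=
  if `[< exists2 x, D x & F x = w >] then \det (jacobian F (G w)) else 0.

Lemma osgood_hF x : D x -> osgood_h (F x) = \det (jacobian F x).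
Proof.
move=> Dx; rewrite /osgood_h asboolT; last by exists x.
by rewrite (osgood_GF Dx).
Qed.

Lemma osgood_h_neq0 w : osgood_h w != 0 ->
  exists x, [/\ D x, F x = w & jacobian F x \in unitmx].
Proof.
rewrite /osgood_h; case: asboolP => [[x Dx <-]|_]; last by rewrite eqxx.
rewrite (osgood_GF Dx).
move=> h; exists x; split; [exact: Dx|exact: erefl|by rewrite unitmxE unitfE].
Qed.

(** This sum vanishes exactly when [F y = w] and [e <= g y]. If no point of the closed ball
    satisfies both, its minimum [m] there is positive, and [nr (F y - w) < m] forces [g y < e]: a
    compactness argument without subsequences. *)
Lemma penalty_continuous (g : V -> R) (w x : V) (e : R) :
  {for x, continuous F} -> {for x, continuous g} ->
  {for x, continuous (fun y => Num.max (e - g y) 0 + nr (F y - w))}.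
Proof.
move=> cF cg; apply: continuousD; last exact: nr_comp_continuous.
apply: continuous_max; last exact: cst_continuous.
by apply: continuousB => //; exact: cst_continuous.
Qed.

Lemma penalty_gt0 (g : V -> R) (w x : V) (e : R) :
  ~ (F x = w /\ e <= g x) -> 0 < Num.max (e - g x) 0 + nr (F x - w).
Proof.
move=> h; have m0 : 0 <= Num.max (e - g x) 0 by rewrite le_max lexx orbT.
have n0 := nr_ge0 (F x - w).
rewrite lt_def addr_ge0 // andbT paddr_eq0 //; apply/negP => /andP[/eqP m /eqP fw].
apply: h; split; first by apply/eqP; rewrite -subr_eq0 -nr_eq0 fw.
by rewrite -subr_le0 -m le_max lexx.
Qed.

(** At a zero of [osgood_h] the penalty is used with [g] the modulus of the determinant: a preimage
    of [w] with [e <= g x] would lie in [D] by the gap and make [osgood_h w] nonzero. Elsewhere [F]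
    is locally open and the determinant is continuous. *)
Lemma osgood_h_continuous w : nr (w - w0) < 2 * d ->
  {for w, continuous (osgood_h : V -> C^o)}.
Proof.
move=> wd; apply/continuous_nr => e e0.
have [hw|hw] := eqVneq (osgood_h w) 0.
  pose g x := normc (\det (jacobian F x)).
  have cg x : nr (x - x0) <= r / 4 -> {for x, continuous g}.
    by move=> /osgood_det_continuous /normc_comp_continuous.
  have [x xr|x xr|m m0 hm] := @osgood_min (fun y => Num.max (e - g y) 0 + nr (F y - w)).
  - apply: penalty_continuous; last exact: cg.
    by apply/differentiable_continuous/dF; exact: osgood_ltr.
  - apply: penalty_gt0 => -[Fx ex].
    have Dx : D x by apply: osgood_interior => //; rewrite Fx.
    move: hw; rewrite -Fx osgood_hF // => h0.
    by move: ex; rewrite /g h0 normc0 leNgt e0.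
  exists m => // y yw; rewrite hw subr0 nr_normc ltNge; apply/negP => ey.
  have hy : osgood_h y != 0 by rewrite -normc_gt0; exact: lt_le_trans ey.
  have [x [Dx Fx _]] := osgood_h_neq0 hy.
  have := hm x (ltW Dx); rewrite leNgt => /negP; apply.
  rewrite (max_idPr _) ?add0r ?Fx // subr_le0.
  by move: ey; rewrite -Fx osgood_hF.
have [x [Dx Fx ux]] := osgood_h_neq0 hw.
have /continuous_nr /(_ e e0) [s s0 hs] := osgood_det_continuous (ltW Dx).
have [t t0 ht] := open_map_on osgood_open osgood_diff Dx ux s0.
exists t => // y; rewrite -[in y - w]Fx => /ht [z [Dz zx] <-].
by rewrite -Fx !osgood_hF //; exact: hs.
Qed.

Lemma hol_near_eq (f k : C^o -> C^o) (c : C^o) (s : R) : 0 < s ->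
  (forall z, normc (z - c) < s -> k z = f z) -> hol_near f c -> hol_near k c.
Proof.
move=> s0 kf [t t0 [N hN ht]]; exists (Num.min s t); first by rewrite lt_min s0.
exists N => [z|e /ht [g dg hg]]; first by rewrite lt_min => /andP[/kf -> /hN].
by exists g => z; rewrite lt_min => /andP[zs zt]; [exact: dg|rewrite kf //; exact: hg].
Qed.

Lemma osgood_near w : osgood_h w != 0 -> exists2 s : R, 0 < s &
  forall w', nr (w' - w) < s -> exists y, [/\ D y, F y = w' & jacobian F y \in unitmx].
Proof.
move=> hw; have [x [Dx Fx ux]] := osgood_h_neq0 hw.
have dx : 0 < normc (\det (jacobian F x)) by rewrite normc_gt0 -unitfE -unitmxE.
have /continuous_nr /(_ _ dx) [s s0 hs] := osgood_det_continuous (ltW Dx).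
have [t t0 ht] := open_map_on osgood_open osgood_diff Dx ux s0.
exists t; first exact: t0.
move=> w'; rewrite -Fx => /ht [y [Dy yx] Fy]; exists y; split; [exact: Dy|exact: Fy|].
rewrite unitmxE unitfE; exact: nr_gap (hs y yx).
Qed.

Lemma osgood_G_differentiable w : osgood_h w != 0 -> differentiable G w.
Proof.
move=> /osgood_h_neq0 [x [Dx <- ux]].
by have [] := inv_on_differentiable osgood_open osgood_diff osgood_inj Dx ux.
Qed.

Lemma osgood_h_near w : osgood_h w != 0 -> exists2 s : R, 0 < s &
  forall w', nr (w' - w) < s -> osgood_h w' != 0.
Proof.
move=> /osgood_near [s s0 hs]; exists s => // w' /hs [y [Dy <- uy]].
by rewrite osgood_hF // -unitfE -unitmxE.
Qed.

Lemma line_near (a b w : V) (s : R) (c : C) : 0 < s -> a + c *: b = w ->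
  exists2 t : R, 0 < t & forall z, normc (z - c) < t -> nr (a + z *: b - w) < s.
Proof.
move=> s0 <-; have b0 : 0 < nr b + 1 by rewrite ltr_wpDl ?nr_ge0.
exists (s / (nr b + 1)) => [|z]; first exact: divr_gt0.
rewrite ltr_pdivlMr // => h; apply: le_lt_trans h.
rewrite opprD addrACA subrr add0r -scalerBl nrZ ler_wpM2l ?normc_ge0 //.
by rewrite lerDl.
Qed.

(** Where [osgood_h] is nonzero [G] is differentiable, so along a line [osgood_h] is the determinant
    of the derivative of [F] taken along a differentiable curve. *)
Lemma osgood_line_hol_near (a b : V) (c : C^o) : osgood_h (a + c *: b) != 0 ->
  hol_near (fun z => osgood_h (a + z *: b) : C^o) c.
Proof.
move=> hc; have [s s0 hs] := osgood_near hc.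
have [t t0 ht] := line_near s0 (erefl (a + c *: b)).
have GE z : normc (z - c) < t -> D (G (a + z *: b)) /\
    osgood_h (a + z *: b) != 0.
  move=> /ht /hs [y [Dy <- uy]]; rewrite (osgood_hF Dy) (osgood_GF Dy).
  by rewrite -unitfE -unitmxE.
have aff z : differentiable (fun z : C^o => a + z *: b) (z : C^o).
  apply: differentiableD; first exact: differentiable_cst.
  exact: ex_diff.
apply: (@hol_near_eq (fun z => \det (jacobian F (G (a + z *: b))) : C^o) _ c t t0).
  by move=> z /ht /hs [y [Dy <- uy]]; rewrite (osgood_hF Dy) (osgood_GF Dy).
apply: (det_jacobian_hol_near r0 dF FM t0) => z zt.
  apply: (@differentiable_comp _ _ _ _ (fun z : C^o => a + z *: b) G); first exact: aff.
  by apply: osgood_G_differentiable; have [] := GE z zt.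
by apply: osgood_lt; apply: ltW; have [] := GE z zt.
Qed.

Lemma line_continuous (E : normedModType C) (f : V -> E) (a b : V) (z : C^o) :
  {for a + z *: b, continuous f} -> {for z, continuous (fun z : C^o => f (a + z *: b))}.
Proof.
move=> /continuous_nr cf; apply/continuous_nr => e /cf [s s0 hs].
have [t t0 ht] := line_near s0 (erefl (a + z *: b)).
by exists t => // y yz; apply: hs; apply: ht; rewrite -nr_normc.
Qed.

Lemma osgood_generic : exists2 w, nr (w - w0) < d / 2 & osgood_h w != 0.
Proof.
have d2 : 0 < d / 2 by rewrite divr_gt0.
have /continuous_nr /(_ _ d2) [s s0 hs] :=
  differentiable_continuous (osgood_diff osgood_center).
have [x [Dx xs] ux] :=
  generic_unit osgood_open osgood_diff osgood_inj osgood_center s0.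
by exists (F x); [exact: hs|rewrite (osgood_hF Dx) -unitfE -unitmxE].
Qed.

(* If [h] vanished near [w1], [h z / z ^ n] would violate the maximum principle on
   a line through [w1]. *)
Lemma osgood_dense w1 (e : R) : nr (w1 - w0) < d / 2 -> 0 < e ->
  exists2 w, nr (w - w1) < e & osgood_h w != 0.
Proof.
move=> w1d e0; apply: contrapT => noh.
have h0 w : nr (w - w1) < e -> osgood_h w = 0.
  by move=> we; apply/eqP/negPn/negP => hw; apply: noh; exists w.
have [w2 w2d hw2] := osgood_generic.
pose u := w2 - w1.
have nu : nr u < d.
  by have := nr_dist w2 w0 w1; rewrite (nrB w0) /u => h; apply: le_lt_trans h _;
     rewrite [ltRHS]splitr; exact: ltrD.
(* [1 < q] puts the parameter 1 of [w2] inside the disc, and [d / 2 + q * d < 2 * d] keeps the disc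
   where [osgood_h] is continuous. *)
pose q : R := 5 / 4.
have q0 : 0 < q by rewrite /q; lra.
have inq z : normc z <= q -> nr (w1 + z *: u - w0) < 2 * d.
  move=> zq; rewrite addrAC; apply: le_lt_trans (nr_triangle _ _) _.
  have : nr (z *: u) <= q * nr u by rewrite nrZ ler_wpM2r ?nr_ge0.
  move: (d0) nu w1d; rewrite /q => *; lra.
pose H (z : C^o) : C^o := osgood_h (w1 + z *: u).
have cH z : normc z <= q -> {for z, continuous H}.
  by move=> /inq zq; apply: line_continuous; exact: osgood_h_continuous.
have [t t0 Ht] : exists2 t : R, 0 < t & forall z, normc z < t -> H z = 0.
  have [|t t0 ht] := @line_near w1 u w1 e 0 e0; first by rewrite scale0r addr0.
  by exists t => // z zt; apply: h0; apply: ht; rewrite subr0.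
have [|c cq cmax] := compact_max (@compact_disc R q) _
    (fun z zq => normc_comp_continuous (cH z zq)).
  by exists 0; rewrite /= normc0 ltW.
have H1 : H 1 = osgood_h w2 by rewrite /H scale1r /u addrC subrK.
have n0 : 0 < normc (H 1) by rewrite normc_gt0 H1.
apply: (@expr_ge_contra _ q (normc (H c) / normc (H 1))); first by rewrite /q; lra.
move=> k; rewrite (ler_pdivlMr _ _ n0) mulrC -(ler_pdivlMr _ _ (exprn_gt0 k q0)).
(* Continuous at [0] because [H] vanishes around it. [K] agrees with [H] at 1 but is at most
   [normc (H c) / q ^+ k] on the circle, which fails for large [k]. *)
pose K (z : C^o) : C^o := H z * z^-1 ^+ k.
have inv1 : (1 : C)^-1 ^+ k = 1 by rewrite invr1 expr1n.
have K1 : K 1 = H 1 := etrans (congr1 (fun x : C => (H 1 : C) * x) inv1) (mulr1 _).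
rewrite -K1; apply: (@max_modulus R K q _ q0).
- move=> z zq; have [->|z0] := eqVneq z 0.
    apply: (@continuous_near_eq R (cst 0) K 0 t t0); last exact: cst_continuous.
    by move=> y; rewrite subr0 => /Ht; rewrite /K => ->; rewrite mul0r.
  apply: continuousM; first exact: cH.
  by apply: continuous_exprn; exact: (@inv_continuous C z z0).
- move=> z zq Kz.
  have Hz : H z != 0 by apply: contraNneq Kz => Hz; rewrite /K Hz mul0r.
  have z0 : z != 0.
    apply/eqP => z0; have H0 := Ht 0; rewrite normc0 in H0.
    by move: Hz; rewrite z0 (H0 t0) eqxx.
  apply: hol_nearM; first exact: osgood_line_hol_near.
  apply: hol_nearX; have [s s0 hs] := near_neq z0.
  apply: (differentiable_hol_near s0) => y /hs y0.
  by apply: differentiableV => //; exact: ex_diff.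
- move=> z zq.
  have -> : normc (K z) = normc (H z) / q ^+ k.
    by rewrite [LHS](normcM (H z)) normcX normcV zq exprVn.
  rewrite ler_pM2r; last by rewrite invr_gt0 exprn_gt0.
  by apply: cmax; rewrite /= zq.
- by rewrite normc1 /q; lra.
Qed.

Lemma osgood_F_continuous x : nr (x - x0) <= r / 4 -> {for x, continuous F}.
Proof. by move=> /osgood_ltr /dF /differentiable_continuous. Qed.

Lemma osgood_half w : nr (w - w0) < d / 2 -> nr (w - w0) < 2 * d.
Proof. by move=> h; apply: lt_trans h _; have := d0; lra. Qed.

(** The image of the closed ball is compact, and by [osgood_dense] it meets every neighbourhood of
    [w]; the gap puts the preimage found in [D]. *)
Lemma osgood_surj w : nr (w - w0) < d / 2 -> exists2 x, D x & F x = w.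
Proof.
move=> wd; apply: contrapT => nx.
have [x xr|x xr|m m0 hm] := @osgood_min (fun y => nr (F y - w)).
- by apply: nr_comp_continuous; exact: osgood_F_continuous.
- rewrite nr_gt0 subr_eq0; apply/eqP => Fx; apply: nx; exists x => //.
  by apply: osgood_interior => //; rewrite Fx osgood_half.
have [w' ww' /osgood_h_neq0 [x [Dx Fx _]]] := osgood_dense wd m0.
by have := hm x (ltW Dx); rewrite Fx leNgt ww'.
Qed.

Lemma osgood_GP w : nr (w - w0) < d / 2 -> D (G w) /\ F (G w) = w.
Proof. by move=> /osgood_surj [x Dx <-]; rewrite (osgood_GF Dx). Qed.

(** The penalty with [g] the distance to [G w], which by injectivity is the only preimage of [w]. *)
Lemma osgood_G_continuous w : nr (w - w0) < d / 2 -> {for w, continuous G}.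
Proof.
move=> wd; apply/continuous_nr => e e0; have [DG FG] := osgood_GP wd.
have [x xr|x xr|m m0 hm] :=
    @osgood_min (fun y => Num.max (e - nr (y - G w)) 0 + nr (F y - w)).
- apply: (@penalty_continuous (fun y => nr (y - G w))); first exact: osgood_F_continuous.
  by apply: (@nr_comp_continuous R V V id); exact: cvg_id.
- apply: (@penalty_gt0 (fun y => nr (y - G w))) => -[Fx ex].
  have Dx : D x by apply: osgood_interior => //; rewrite Fx osgood_half.
  by move: ex; rewrite -Fx (osgood_GF Dx) subrr nr0 leNgt e0.
exists (Num.min m (d / 2 - nr (w - w0))); first by rewrite lt_min m0 subr_gt0.
move=> y; rewrite lt_min => /andP[ym yd].
have yw : nr (y - w0) < d / 2.
  by apply: le_lt_trans (nr_dist y w w0) _; rewrite -ltrBrDr.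
have [DGy FGy] := osgood_GP yw.
rewrite ltNge; apply/negP => ey.
have := hm (G y) (ltW DGy); rewrite FGy leNgt => /negP; apply.
by rewrite (max_idPr _) ?add0r // subr_le0.
Qed.

Let M0 := nr x0 + r / 4.

Lemma osgood_GM w : nr (w - w0) < d / 2 -> nr (G w) <= M0.
Proof.
move=> /osgood_GP [DG _]; have := nr_triangle (G w - x0) x0; rewrite subrK => h.
by apply: le_trans h _; rewrite addrC lerD2l ltW.
Qed.

(** On the complex line through [w1] and [w2] a coordinate of [G] has difference quotient at most
    [2 * M0 / (d / 4)] on the circle of radius [d / 4]. The maximum principle carries this to [w2],
    with the zeros of [z] times [osgood_h] as exceptional set; neither [w1] nor [w2] may be a zero
    of [osgood_h]. *)
Lemma osgood_lip_generic w1 w2 : nr (w1 - w0) < d / 16 -> nr (w2 - w0) < d / 16 ->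
  osgood_h w1 != 0 -> osgood_h w2 != 0 ->
  nr (G w1 - G w2) <= 8 * M0 / d * nr (w1 - w2).
Proof.
move=> w1d w2d h1 h2.
have M00 : 0 <= M0 by rewrite addr_ge0 ?nr_ge0 // divr_ge0 // ltW.
have L0 : 0 <= 8 * M0 / d by rewrite divr_ge0 ?mulr_ge0 // ltW.
have [->|w12] := eqVneq w2 w1; first by rewrite !subrr !nr0 mulr0.
pose t := nr (w2 - w1); have t0 : 0 < t by rewrite nr_gt0 subr_eq0.
have td : t < d / 8.
  apply: le_lt_trans (nr_dist w2 w0 w1) _; rewrite (nrB w0).
  by move: (d0) w1d w2d; lra.
pose u := t^-1%:C%C *: (w2 - w1).
have nu : nr u = 1.
  rewrite nrZ normc_real gtr0_norm ?invr_gt0 // mulVf //; exact: lt0r_neq0.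
have tu : w1 + t%:C%C *: u = w2.
  rewrite scalerA -rmorphM /= mulfV ?scale1r; first by rewrite addrC subrK.
  exact: lt0r_neq0.
pose s := d / 4; have s0 : 0 < s by rewrite divr_gt0.
have ins z : normc z <= s -> nr (w1 + z *: u - w0) < d / 2.
  move=> zs; rewrite addrAC; apply: le_lt_trans (nr_triangle _ _) _.
  rewrite nrZ nu mulr1; apply: lt_le_trans (ltr_leD w1d zs) _; rewrite /s; have := d0; lra.
rewrite nrB (nrB w1) -/t; apply: nr_row_le; first by rewrite mulr_ge0 // ltW.
move=> i.
pose g (z : C^o) : C^o := G (w1 + z *: u) 0 i.
have cg z : normc z <= s -> {for z, continuous g}.
  move=> /ins zs; apply: (@line_continuous C^o (fun w : V => G w 0 i : C^o)).
  have := osgood_G_continuous zs => /continuous_nr cG; apply/continuous_nr => e /cG [a a0 ha].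
  exists a => // y /ha h; rewrite nr_normc; apply: le_lt_trans h.
  by have := nr_coord (G y - G (w1 + z *: u)) i; rewrite !mxE.
have dg z : osgood_h (w1 + z *: u) != 0 -> differentiable g (z : C^o).
  by move=> /osgood_G_differentiable /(@line_coord R V n G w1 u z i) [].
have dg0 : differentiable g 0 by apply: dg; rewrite scale0r addr0.
have gM z : normc z <= s -> normc (g z) <= M0.
  by move=> /ins zs; apply: le_trans (nr_coord _ _) _; exact: osgood_GM.
have ts : normc t%:C%C <= s by rewrite normc_real gtr0_norm // /s; move: (d0) td t0; lra.
have t0' : t%:C%C != 0 :> C by rewrite -normc_gt0 normc_real gtr0_norm.
have : normc (quot g 0 t%:C%C) <= 8 * M0 / d.
  apply: (@max_modulus_off_zeros R (fun z => z * (osgood_h (w1 + z *: u) : C^o))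
    (quot g 0) s _ s0 _ _ _ _ _ t%:C%C ts) => [z zs|z zs|z zs hz|z zs hz|z zs|].
  - apply: continuousM; first exact: cvg_id.
    by apply: line_continuous; apply: osgood_h_continuous; apply: osgood_half; exact: ins.
  - have [->|z0] := eqVneq z 0; first exact: quot_continuous_at.
    by apply: (quot_continuous z0); exact: cg.
  - apply: hol_nearM.
      by apply: (@differentiable_hol_near R id z 1 ltr01) => y _; exact: ex_diff.
    apply: osgood_line_hol_near; apply: contraNneq hz => ->; by rewrite mulr0.
  - have z0 : z != 0 by apply: contraNneq hz => ->; rewrite mul0r.
    have hz' : osgood_h (w1 + z *: u) != 0.
      by apply: contraNneq hz => ->; rewrite mulr0.
    have [a a0 ha] := near_neq z0.
    have [b b0 hb] := osgood_h_near hz'.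
    have [c c0 hc] := line_near b0 (erefl (w1 + z *: u)).
    apply: (@differentiable_hol_near R _ z (Num.min a c)); first by rewrite lt_min a0.
    move=> y; rewrite lt_min => /andP[/ha y0 /hc /hb /dg].
    exact: quot_differentiable.
  - have z0 : z != 0 by rewrite -normc_gt0 zs.
    rewrite (quot_neq _ z0) subr0 normcM normcV zs ler_pdivrMr //.
    apply: le_trans (normcD _ _) _; rewrite normcN.
    have g1 := gM z; rewrite zs in g1; have {}g1 := g1 (lexx s).
    have g0 := gM 0; rewrite normc0 in g0; have {}g0 := g0 (ltW s0).
    apply: le_trans (lerD g1 g0) _.
    rewrite /s le_eqVlt; apply/orP; left; apply/eqP; field; exact: lt0r_neq0.
  - by apply: mulf_neq0; [exact: t0'|rewrite tu; exact: h2].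
rewrite (quot_neq _ t0') subr0 normcM normcV normc_real (gtr0_norm t0) ler_pdivrMr //.
rewrite /g tu scale0r addr0.
by rewrite [X in _ -> normc X <= _]mxE [X in _ -> normc (_ + X) <= _]mxE.
Qed.

(** Approximation by points where [osgood_h] is nonzero, using continuity of [G]. *)
Lemma osgood_lip w1 w2 : nr (w1 - w0) < d / 16 -> nr (w2 - w0) < d / 16 ->
  nr (G w1 - G w2) <= 8 * M0 / d * nr (w1 - w2).
Proof.
move=> w1d w2d.
have M00 : 0 <= M0 by rewrite addr_ge0 ?nr_ge0 // divr_ge0 // ltW.
have L0 : 0 <= 8 * M0 / d by rewrite divr_ge0 ?mulr_ge0 // ltW.
have big w : nr (w - w0) < d / 16 -> nr (w - w0) < d / 2.
  by move=> h; apply: lt_trans h _; have := d0; lra.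
have near w e : nr (w - w0) < d / 16 -> 0 < e -> exists w',
    [/\ nr (w' - w0) < d / 16, osgood_h w' != 0, nr (w' - w) < e & nr (G w' - G w) < e].
  move=> wd e0.
  have /continuous_nr /(_ e e0) [a a0 ha] := osgood_G_continuous (big w wd).
  pose m := Num.min (Num.min a e) (d / 16 - nr (w - w0)).
  have m0 : 0 < m by rewrite !lt_min a0 e0 subr_gt0.
  have [w' ww' hw'] := osgood_dense (big w wd) m0.
  move: ww'; rewrite !lt_min => /andP[/andP[wa we] wd'].
  exists w'; split => //; last exact: ha.
  by apply: le_lt_trans (nr_dist w' w w0) _; rewrite -ltrBrDr.
move: (8 * M0 / d) L0 osgood_lip_generic => L L0 lip.
apply/ler_addgt0Pr => e e0.
have k0 : 0 < 2 + 2 * L by lra.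
have [w1' [a1 a2 a3 a4]] := near w1 (e / (2 + 2 * L)) w1d (divr_gt0 e0 k0).
have [w2' [b1 b2 b3 b4]] := near w2 (e / (2 + 2 * L)) w2d (divr_gt0 e0 k0).
have ee : e / (2 + 2 * L) * (2 + 2 * L) = e by rewrite mulfVK // lt0r_neq0.
have c2 := nr_dist (G w1) (G w1') (G w2); rewrite (nrB (G w1) (G w1')) in c2.
have c5 := nr_dist w1 w2 w2'; rewrite (nrB w2 w2') in c5.
exact: lipschitz_arith L0 ee c2 a4 (nr_dist _ (G w2') _) b4 (lip _ _ a1 b1 a2 b2)
  (nr_dist _ w1 _) a3 c5 b3.
Qed.

(** If [v] were in the kernel of the derivative, [F] would move [x0 + t *: v] by [o(t)] only, while
    the Lipschitz inverse cannot bring back the distance [t * nr v] from so little. *)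
Lemma osgood_center_unit : jacobian F x0 \in unitmx.
Proof.
rewrite -row_free_unit; apply/inj_row_free => v v0.
have M00 : 0 <= M0 by rewrite addr_ge0 ?nr_ge0 // divr_ge0 // ltW.
have L0 : 0 <= 8 * M0 / d by rewrite divr_ge0 ?mulr_ge0 // ltW.
move: (8 * M0 / d) L0 osgood_lip => L L0 lip.
apply/eqP/negPn/negP => vn0.
have nv : 0 < nr (v : V) by rewrite nr_gt0.
have L1 : 0 < 2 * (L + 1) by lra.
have [s s0 hs] := differentiable_nr (osgood_diff osgood_center) (divr_gt0 ltr01 L1).
have d16 : 0 < d / 16 by rewrite divr_gt0.
have /continuous_nr /(_ _ d16) [a a0 ha] :=
  differentiable_continuous (osgood_diff osgood_center).
pose m := Num.min (Num.min s a) (r / 4).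
have m0 : 0 < m by rewrite !lt_min s0 a0 divr_gt0.
pose t := m / 2 / nr (v : V).
have t0 : 0 < t by rewrite !divr_gt0.
have ntv : nr (t%:C%C *: v : V) = m / 2.
  by rewrite nrZ normc_real gtr0_norm // /t mulfVK // lt0r_neq0.
have : m / 2 < m by lra.
rewrite !lt_min -ntv => /andP[/andP[h1 h2] h3].
have Dx : D (x0 + t%:C%C *: v) by rewrite /D /= addrC addKr.
have := hs _ h1; rewrite diff_jacobian -scalemxAl v0 scaler0 subr0 => h4.
have h5 : nr (F (x0 + t%:C%C *: v) - w0) < d / 16 by apply: ha; rewrite addrC addKr.
have h6 : nr (w0 - w0) < d / 16 by rewrite subrr nr0.
have := lip _ _ h5 h6; rewrite (osgood_GF Dx) /w0 (osgood_GF osgood_center).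
rewrite [x0 + _]addrC addrK [_ + x0]addrC => h7.
have h8 : L * nr (F (x0 + t%:C%C *: v) - F x0) <= L * (1 / (2 * (L + 1)) * nr (t%:C%C *: v : V)).
  by rewrite ler_wpM2l.
have h9 : L * (1 / (2 * (L + 1)) * (m / 2)) <= 1 / 2 * (m / 2).
  rewrite mulrA ler_wpM2r ?divr_ge0 ?(ltW m0) //.
  by rewrite mulrA ler_pdivrMr //; lra.
rewrite ntv in h7 h8.
by move: h7 h8 h9 m0; lra.
Qed.

End Osgood.

(** A small ball around [x] meets the assumptions of the preceding section: [F] is bounded on it by
    continuity, and injectivity provides the gap on the sphere of radius [r / 4]. *)
Lemma injective_unit (R : realType) n (D : set ('rV[R[i]]_n : normedModType R[i]))
    (F : ('rV[R[i]]_n : normedModType R[i]) -> ('rV[R[i]]_n : normedModType R[i])) :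
  (forall x, D x -> nbhs x D) -> (forall x, D x -> differentiable F x) ->
  set_inj D F -> forall x, D x -> jacobian F x \in unitmx.
Proof.
move=> oD dF injF x Dx.
have [r1 r10 hr1] := open_ball oD Dx.
have [r /andP[r0 rr1] [dFr FM]] := local_bound_ball r10 (fun y yr => dF y (hr1 y yr)).
have inj y z : nr (y - x) < r -> nr (z - x) < r -> F y = F z -> y = z.
  move=> yr zr; apply: injF; apply: mem_set; apply: hr1; exact: lt_le_trans rr1.
have r4 : 0 < r / 4 by rewrite divr_gt0.
have r4r : r / 4 < r by lra.
have [||d d0 gap] := @sphere_gap R n n F x (r / 4).
- by move=> y yr; apply/differentiable_continuous/dFr; rewrite yr.
- move=> y yr; apply/eqP => Fy; have yx : y = x.
    by apply: inj; rewrite ?yr // subrr nr0.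
  by move: yr; rewrite yx subrr nr0 => r00; move: r4; rewrite -r00 ltxx.
exact: osgood_center_unit r0 dFr FM inj d0 gap.
Qed.

(** * Maps between the polydisk and the punctured ball *)

Section EuclideanNorm.
Context {R : realType} {n : nat}.
Local Notation C := R[i].
Local Notation V := ('rV[C]_n : normedModType C).
Implicit Types (v w x : V).

(** The squared Euclidean norm, polynomial in real and imaginary parts and so within reach of
    [ring]. *)
Definition e2 (v : 'rV[C]_n) : R := \sum_(i < n) normc (v 0 i) ^+ 2.

Lemma e2_ge0 v : 0 <= e2 v.
Proof. by apply: sumr_ge0 => i _; exact: sqr_ge0. Qed.

Lemma enorm_sqr v : enorm v ^+ 2 = e2 v.
Proof. by rewrite /enorm sqr_sqrtr // e2_ge0. Qed.

Lemma enorm_ge0 v : 0 <= enorm v.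
Proof. exact: sqrtr_ge0. Qed.

Lemma e2Z (a : C) v : e2 (a *: v) = normc a ^+ 2 * e2 v.
Proof.
rewrite /e2 mulr_sumr; apply: eq_bigr => i _.
by rewrite mxE normcM exprMn.
Qed.

Lemma enormZ (a : C) v : enorm (a *: v) = normc a * enorm v.
Proof.
rewrite /enorm -/(e2 _) -/(e2 v) e2Z sqrtrM ?sqr_ge0 // sqrtr_sqr.
by rewrite ger0_norm ?normc_ge0.
Qed.

Lemma e2_coord v i : normc (v 0 i) ^+ 2 <= e2 v.
Proof. by rewrite /e2 (bigD1 i) //= lerDl; apply: sumr_ge0 => j _; exact: sqr_ge0. Qed.

Lemma nr_enorm v : nr v <= enorm v.
Proof.
apply: nr_row_le => [|i]; first exact: enorm_ge0.
rewrite -(ler_pXn2r (n := 2)) ?nnegrE ?normc_ge0 ?enorm_ge0 //.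
by rewrite enorm_sqr e2_coord.
Qed.

Lemma e20 : e2 0 = 0.
Proof. by rewrite /e2 big1 // => i _; rewrite mxE normc0 expr0n. Qed.

Lemma e2_eq0 v : (e2 v == 0) = (v == 0).
Proof.
apply/eqP/eqP => [h|->]; last exact: e20.
apply/rowP => i; rewrite mxE; apply/eqP; rewrite -normc_eq0 -sqrf_eq0.
by apply/eqP/le_anti; rewrite sqr_ge0 andbT -h e2_coord.
Qed.

Lemma enorm_eq0 v : (enorm v == 0) = (v == 0).
Proof. by rewrite -e2_eq0 -enorm_sqr sqrf_eq0. Qed.

Lemma enorm0 : enorm (0 : 'rV[C]_n) = 0.
Proof. by apply/eqP; rewrite enorm_eq0. Qed.

Lemma enorm_gt0 v : (0 < enorm v) = (v != 0).
Proof. by rewrite lt_def enorm_eq0 enorm_ge0 andbT. Qed.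

Lemma enorm_lt v (r : R) : 0 <= r -> (enorm v < r) = (e2 v < r ^+ 2).
Proof. by move=> r0; rewrite -enorm_sqr ltr_pXn2r // nnegrE enorm_ge0. Qed.

Lemma enorm_le v (r : R) : 0 <= r -> (enorm v <= r) = (e2 v <= r ^+ 2).
Proof. by move=> r0; rewrite -enorm_sqr ler_pXn2r // nnegrE enorm_ge0. Qed.

Lemma e2_nr v : e2 v <= n%:R * nr v ^+ 2.
Proof.
apply: le_trans (_ : \sum_(i < n) nr v ^+ 2 <= _).
  by apply: ler_sum => i _; rewrite ler_pXn2r ?nnegrE ?normc_ge0 ?nr_ge0 // nr_coord.
by rewrite sumr_const card_ord mulr_natl.
Qed.

Lemma normc_polar (x y : C) :
  normc (x + y) ^+ 2 + normc (x - y) ^+ 2 = 2 * (normc x ^+ 2 + normc y ^+ 2).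
Proof. by rewrite !normc_sqr !raddfD !raddfN /=; ring. Qed.

Lemma parallelogram v w : e2 (v + w) + e2 (v - w) = 2 * (e2 v + e2 w).
Proof.
rewrite /e2 -!big_split /= mulr_sumr; apply: eq_bigr => i _.
by rewrite !mxE normc_polar.
Qed.

(* The mean over all signs of [e2 (\sum_j s j *: f j)] is [\sum_j e2 (f j)]. *)
Lemma exists_signs (I : eqType) (r : seq I) (f : I -> 'rV[C]_n) : uniq r ->
  exists2 s : I -> C, (forall j, normc (s j) = 1) &
    \sum_(j <- r) e2 (f j) <= e2 (\sum_(j <- r) s j *: f j).
Proof.
elim: r => [|j r IH] /=.
  by move=> _; exists (fun=> 1) => [j|]; rewrite ?normc1 // !big_nil e20.
move=> /andP[jr /IH [s s1 hs]].
pose v := \sum_(j <- r) s j *: f j.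
have E (c : C) : \sum_(k <- j :: r) (if k == j then c else s k) *: f k = c *: f j + v.
  rewrite big_cons eqxx; congr (_ + _); rewrite /v !big_seq; apply: eq_bigr => k kr.
  by case: eqP => // kj; move: jr; rewrite -kj kr.
have := parallelogram v (f j); rewrite big_cons => p.
(* By the parallelogram identity one of the two signs for [f j] does at least as well as their
   mean. *)
have [h|h] := leP (e2 (f j) + \sum_(j0 <- r) e2 (f j0)) (e2 (v + f j)).
  exists (fun k => if k == j then 1 else s k) => [k|].
    by case: eqP => _; rewrite ?normc1.
  by rewrite E scale1r [f j + v]addrC.
exists (fun k => if k == j then -1 else s k) => [k|].
  by case: eqP => _; rewrite ?normcN ?normc1.
rewrite E scaleN1r [- f j + v]addrC; move: hs h p; rewrite -/v; lra.
Qed.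

End EuclideanNorm.

(** * The trace inequality *)

Section Alexander.
Context {R : realType} {n : nat}.
Local Notation C := R[i].

(* Each column of [M] has norm at most [a], the squared Hilbert-Schmidt norm of [N]
   is at most [b ^+ 2] by averaging over signs, and [n] is the trace of [N *m M]. *)
Lemma trace_bound (N M : 'M[C]_n) (a b : R) : 0 < b ->
  N *m M = 1%:M ->
  (forall (x : 'rV[C]_n) i, normc ((x *m M) 0 i) <= a * enorm x) ->
  (forall w : 'rV[C]_n, (forall i, normc (w 0 i) <= 1) -> e2 (w *m N) <= b ^+ 2) ->
  n%:R <= a ^+ 2 * b ^+ 2.
Proof.
move=> b0 NM hM hN.
have [->|n0] := eqVneq n 0%N; first by rewrite mulr_ge0 ?sqr_ge0.
have np : 0 < n%:R :> R by rewrite ltr0n lt0n.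
have colM i : \sum_k normc (M k i) ^+ 2 <= a ^+ 2.
  (* Tested on the conjugate of column [i], [hM] reads [e2 x <= a * enorm x], that is
     [enorm x <= a]. *)
  pose x : 'rV[C]_n := \row_k (M k i)^*%C.
  have xE : e2 x = \sum_k normc (M k i) ^+ 2.
    apply: eq_bigr => k _; rewrite mxE !normc_sqr; case: (M k i) => p q /=.
    by rewrite sqrrN.
  have xM : (x *m M) 0 i = (e2 x)%:C%C.
    rewrite mxE xE rmorph_sum; apply: eq_bigr => k _.
    rewrite mxE normc_sqr; case: (M k i) => p q; apply/eqP; rewrite eq_complex /=.
    by apply/andP; split; apply/eqP; ring.
  have := hM x i; rewrite xM normc_real ger0_norm ?e2_ge0 // => h.
  rewrite -xE; have := enorm_ge0 x; rewrite le_eqVlt => /orP[/eqP x0|x0].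
    by rewrite -(enorm_sqr x) -x0 expr0n sqr_ge0.
  have {}h : enorm x <= a.
    by rewrite -(ler_pM2r x0) -expr2 (enorm_sqr x).
  by rewrite -(enorm_sqr x) ler_pXn2r ?nnegrE ?(ltW x0) // (le_trans (ltW x0)).
have allN : \sum_j \sum_k normc (N j k) ^+ 2 <= b ^+ 2.
  have [s s1 hs] := exists_signs (fun j => row j N) (index_enum_uniq 'I_n).
  apply: le_trans (hN (\row_j s j) _); last by move=> i; rewrite mxE s1.
  apply: le_trans (le_trans hs _); first by apply: ler_sum => j _; apply: ler_sum => k _; rewrite mxE.
  rewrite le_eqVlt; apply/orP; left; apply/eqP; congr e2.
  by rewrite mulmx_sum_row; apply: eq_bigr => j _; rewrite mxE.
have tr : n%:R <= \sum_j \sum_k normc (N j k) * normc (M k j).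
  have : (n%:R : R) = normc (\sum_j (N *m M) j j).
    rewrite NM (eq_bigr (fun=> 1)) => [|j _]; last by rewrite mxE eqxx.
    by rewrite sumr_const card_ord -(rmorph_nat (real_complex R)) normc_real ger0_norm.
  move=> ->; apply: le_trans (normc_sum _ _ _) _; apply: ler_sum => j _.
  rewrite mxE; apply: le_trans (normc_sum _ _ _) _; apply: ler_sum => k _.
  by rewrite normcM.
(* The weight [n / b ^+ 2] makes the part from [N] sum to at most [n / 2], half of the left-hand
   side, and the part from [M] to at most [a ^+ 2 * b ^+ 2 / 2]. *)
have amgm j k : normc (N j k) * normc (M k j) <=
    (n%:R / b ^+ 2) / 2 * normc (N j k) ^+ 2 + (b ^+ 2 / n%:R) / 2 * normc (M k j) ^+ 2.
  have t0 : 0 < n%:R / b ^+ 2 by rewrite divr_gt0 // exprn_gt0.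
  rewrite -(invf_div n%:R); move: (n%:R / b ^+ 2) t0 => t t0.
  move: (normc (N j k)) (normc (M k j)) => x y.
  have := sqr_ge0 (t * x - y) => h.
  have {}h : 0 <= t^-1 * (t * x - y) ^+ 2 by rewrite mulr_ge0 // invr_ge0 ltW.
  have E : t^-1 * (t * x - y) ^+ 2 = t * x ^+ 2 - 2 * (x * y) + t^-1 * y ^+ 2.
    by field; exact: lt0r_neq0.
  by rewrite E in h; lra.
have b2 : 0 < b ^+ 2 by rewrite exprn_gt0.
have : n%:R <= (n%:R / b ^+ 2) / 2 * b ^+ 2 + (b ^+ 2 / n%:R) / 2 * (n%:R * a ^+ 2).
  apply: le_trans tr _.
  apply: le_trans (_ : \sum_j \sum_k ((n%:R / b ^+ 2) / 2 * normc (N j k) ^+ 2 +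
      (b ^+ 2 / n%:R) / 2 * normc (M k j) ^+ 2) <= _).
    by apply: ler_sum => j _; apply: ler_sum => k _; exact: amgm.
  under eq_bigr do rewrite big_split /= -!mulr_sumr.
  rewrite big_split /= -!mulr_sumr; apply: lerD; apply: ler_wpM2l.
  - by rewrite !divr_ge0 // ltW.
  - exact: allN.
  - by rewrite !divr_ge0 // ltW.
  - apply: le_trans (_ : \sum_(i < n) a ^+ 2 <= _); first by apply: ler_sum => j _; exact: colM.
    by rewrite sumr_const card_ord mulr_natl.
have -> : n%:R / b ^+ 2 / 2 * b ^+ 2 = n%:R / 2 :> R by field; exact: lt0r_neq0.
have -> : b ^+ 2 / n%:R / 2 * (n%:R * a ^+ 2) = a ^+ 2 * b ^+ 2 / 2 :> R.
  by field; exact: lt0r_neq0.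
lra.
Qed.

End Alexander.

(** * The Hermitian product and its inequalities *)

Section HermitianProduct.
Context {R : realType} {n : nat}.
Local Notation C := R[i].
Implicit Types (u v w : 'rV[C]_n).

Definition dot u v : C := \sum_i u 0 i * (v 0 i)^*%C.

Lemma dotDl u v w : dot (u + v) w = dot u w + dot v w.
Proof. by rewrite /dot -big_split; apply: eq_bigr => i _; rewrite mxE mulrDl. Qed.

Lemma dotZl (a : C) u v : dot (a *: u) v = a * dot u v.
Proof. by rewrite /dot mulr_sumr; apply: eq_bigr => i _; rewrite mxE mulrA. Qed.

Lemma dotNl u v : dot (- u) v = - dot u v.
Proof. by rewrite -scaleN1r dotZl mulN1r. Qed.

Lemma dot0l v : dot 0 v = 0.
Proof. by rewrite -(scale0r 0) dotZl mul0r. Qed.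

Lemma dot_self v : dot v v = (e2 v)%:C%C.
Proof.
rewrite /dot /e2 rmorph_sum; apply: eq_bigr => i _; rewrite normc_sqr.
by case: (v 0 i) => p q; apply/eqP; rewrite eq_complex /=; apply/andP; split; apply/eqP; ring.
Qed.

Lemma normc_conj (z : C) : normc z^*%C = normc z.
Proof.
have h (x y : R) : 0 <= x -> 0 <= y -> x ^+ 2 = y ^+ 2 -> x = y.
  by move=> x0 y0 /eqP; rewrite eqrXn2 // => /eqP.
by apply: h; rewrite ?normc_ge0 // !normc_sqr; case: z => p q /=; rewrite sqrrN.
Qed.

Lemma e2D u v : e2 (u + v) = e2 u + e2 v + 2 * Re (dot u v).
Proof.
rewrite /dot raddf_sum mulr_sumr /e2 -!big_split; apply: eq_bigr => i _.
rewrite mxE !normc_sqr; case: (u 0 i) => p q; case: (v 0 i) => p' q' /=.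
by ring.
Qed.

Lemma dot_amgm u v : normc (dot u v) <= (e2 u + e2 v) / 2.
Proof.
apply: le_trans (normc_sum _ _ _) _; rewrite /e2 -big_split mulr_suml.
apply: ler_sum => i _ /=; rewrite normcM normc_conj.
by have := sqr_ge0 (normc (u 0 i) - normc (v 0 i)); lra.
Qed.

(** Cauchy-Schwarz from [dot_amgm], after rescaling [u] to the length of [v]. *)
Lemma dot_le u v : normc (dot u v) <= enorm u * enorm v.
Proof.
have [->|u0] := eqVneq u 0; first by rewrite dot0l normc0 mulr_ge0 ?enorm_ge0.
have [->|v0] := eqVneq v 0.
  rewrite /dot big1 => [|i _]; first by rewrite normc0 mulr_ge0 ?enorm_ge0.
  by rewrite mxE conjc0 mulr0.
have up : 0 < enorm u by rewrite enorm_gt0.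
have vp : 0 < enorm v by rewrite enorm_gt0.
have := dot_amgm ((enorm v / enorm u)%:C%C *: u) v.
rewrite dotZl normcM e2Z normc_real ger0_norm ?divr_ge0 ?enorm_ge0 // -!enorm_sqr.
rewrite expr_div_n divfK ?expf_neq0 ?gt_eqF // => h.
have {}h : enorm v / enorm u * normc (dot u v) <= enorm v * enorm v.
  by apply: le_trans h _; rewrite expr2; lra.
by rewrite mulrAC ler_pdivrMr // -mulrA ler_pM2l // (mulrC (enorm v)) in h.
Qed.

Lemma enormD u v : enorm (u + v) <= enorm u + enorm v.
Proof.
rewrite enorm_le ?addr_ge0 ?enorm_ge0 // e2D -!enorm_sqr.
have := le_trans (normc_Re (dot u v)) (dot_le u v).
by have := ler_norm (Re (dot u v)); move: (Re _) => x; lra.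
Qed.

End HermitianProduct.

(** * The Schwarz lemma on the punctured ball *)

Section BallSchwarz.
Context {R : realType} {n : nat}.
Local Notation C := R[i].
Local Notation V := ('rV[C]_n : normedModType C).
Implicit Types (f : V -> C^o) (p w x : V).

Lemma slice_differentiable f x (t : C^o) : differentiable f (t *: x) ->
  differentiable (fun s : C^o => f (s *: x)) t.
Proof.
move=> df; apply: (@differentiable_comp _ _ _ _ (fun s : C^o => s *: x) f _ _ df).
exact: (@differentiableZl _ _ _ (fun s : C^o => s) x t).
Qed.

Lemma schwarz_slice f x (r : R) : 0 < r -> x != 0 -> enorm x < r ->
  (forall t : C, enorm (t *: x) < r -> differentiable f (t *: x) /\ normc (f (t *: x)) <= 1) ->
  f 0 = 0 -> normc (f x) <= enorm x / r.
Proof.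
move=> r0 x0 xr hf f0.
have xp : 0 < enorm x by rewrite enorm_gt0.
have E (t : C) : normc t < r / enorm x -> enorm (t *: x) < r.
  by rewrite enormZ ltr_pdivlMr.
have := @schwarz R (fun t : C^o => f (t *: x)) (r / enorm x) 1 (divr_gt0 r0 xp)
  (fun t ht => slice_differentiable (proj1 (hf t (E t ht)))) (fun t ht => proj2 (hf t (E t ht))).
rewrite scale0r => /(_ f0 1); rewrite scale1r normc1 mul1r.
rewrite ltr_pdivlMr // mul1r div1r invf_div; exact.
Qed.

(* A complex line through [0] and [x] avoids [p] for a dense set of [x], and on such
   lines this is the one-variable lemma. *)
Lemma schwarz_punctured f p (r : R) : (2 <= n)%N -> p != 0 -> 0 < r ->
  (forall x, enorm x < r -> x != p -> differentiable f x /\ normc (f x) <= 1) ->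
  f 0 = 0 -> forall x, enorm x < r -> x != p -> normc (f x) <= enorm x / r.
Proof.
move=> n2 p0 r0 hf f0 x xr xp.
have H y : enorm y < r -> (forall c : C, c *: y != p) -> normc (f y) <= enorm y / r.
  move=> yr yp; have [y0|y0] := eqVneq y 0.
    by rewrite y0 f0 normc0 divr_ge0 ?enorm_ge0 // ltW.
  by apply: schwarz_slice => // t tr; apply: hf.
have [[c cx]|nc] := pselect (exists c : C, c *: x = p); last first.
  by apply: H => // c; apply/eqP => cx; apply: nc; exists c.
have [i pi] : exists i, p 0 i != 0.
  apply: contrapT => h; move/eqP: p0; apply; apply/rowP => i; rewrite mxE.
  by apply: contrapT => /eqP hi; apply: h; exists i.
(* Here [n >= 2] is used: moving [x] in a coordinate other than one where [p] is nonzero takes it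
   off the line of [p]. *)
have [j ji] : exists j : 'I_n, j != i.
  have [i0|i0] := eqVneq (val i) 0%N.
    by exists (Ordinal n2); rewrite -val_eqE i0.
  by exists (Ordinal (ltnW n2)); rewrite -val_eqE eq_sym.
rewrite leNgt; apply/negP => h.
have [df _] := hf _ xr xp.
have e0 : 0 < (normc (f x) - enorm x / r) / 2 by move: h; clear; lra.
have [d d0 hd] := (continuous_nr f x).1 (differentiable_continuous df) _ e0.
have [t [t0 td tr te]] : exists t : R, [/\ 0 < t, t < d, enorm x + t < r &
    t / r < (normc (f x) - enorm x / r) / 2].
  have xr0 : 0 < r - enorm x by rewrite subr_gt0.
  have [a [a0 ad ax]] := exists_lt2 d0 xr0.
  have [t [t0 ta te]] := exists_lt2 a0 (mulr_gt0 e0 r0).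
  exists t; split; rewrite ?ltr_pdivrMr //; first exact: lt_trans ad.
  by rewrite -ltrBrDl (lt_trans ta).
pose y : V := x + t%:C%C *: delta_mx 0 j.
have ey : enorm (t%:C%C *: (delta_mx 0 j : 'rV[C]_n)) <= t.
  rewrite enormZ normc_real gtr0_norm // ler_piMr ?(ltW t0) // enorm_le // expr1n.
  rewrite /e2 (bigD1 j) //= big1 => [|k kj]; rewrite mxE eqxx /= ?eqxx.
    by rewrite normc1 expr1n addr0.
  by rewrite (negbTE kj) normc0 expr0n.
have exy : enorm y <= enorm x + t by apply: le_trans (enormD _ _) _; rewrite lerD2l.
(* Coordinate [i] is the same for [x] and [y] and forces [k = c]; coordinate [j] then gives
   [c * t = 0]. *)
have yp (k : C) : k *: y != p.
  apply/eqP => ky; have kc : k = c.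
    have := congr1 (fun v : 'rV[C]_n => v 0 i) ky; rewrite -{1}cx !mxE eqxx /=.
    rewrite eq_sym (negbTE ji) mulr0 addr0 => /mulIf; apply.
    by apply: contraNneq pi => xi; rewrite -cx mxE xi mulr0.
  have := congr1 (fun v : 'rV[C]_n => v 0 j) ky; rewrite -{1}cx kc !mxE !eqxx mulr1 mulrDr.
  move=> /eqP; rewrite -subr_eq0 addrC addKr mulf_eq0 => /orP[/eqP c0|].
    by move: p0; rewrite -cx c0 scale0r eqxx.
  by rewrite eq_complex /= gt_eqF.
have fy := H y (le_lt_trans exy tr) yp.
have yx : nr (y - x) < d.
  by rewrite /y addrC addKr; apply: le_lt_trans td; apply: le_trans ey; exact: nr_enorm.
have := hd _ yx; rewrite nr_normc => hh.
have fxy : normc (f x) <= normc (f y) + normc (f y - f x).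
  have := normcD (f y) (- (f y - f x)).
  by rewrite normcN (_ : f y + - (f y - f x) = f x); last by ring.
have yr : enorm y / r <= enorm x / r + t / r by rewrite -mulrDl ler_pM2r ?invr_gt0.
by move: hh fy te fxy yr h; clear; lra.
Qed.

End BallSchwarz.

(** * Estimates at the origin and at the puncture *)

Section PuncturedBall.
Context {R : realType} {n : nat}.
Local Notation C := R[i].
Local Notation V := ('rV[C]_n : normedModType C).
Implicit Types (F G : V -> V) (p u w x : V).

Lemma coord_differentiable G w i : differentiable G w ->
  differentiable (fun x => G x 0 i : C^o) w.
Proof.
move=> dG.
have := @differentiable_comp _ V V C^o G (fun y : V => y 0 i : C^o) w dG.
by apply; exact: differentiable_coord.
Qed.

Lemma dot_differentiable G u w : differentiable G w ->
  differentiable (fun x => dot (G x) u : C^o) w.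
Proof.
move=> dG.
rewrite (_ : (fun x : V => dot (G x) u : C^o) =
  \sum_i (fun x : V => (u 0 i)^*%C *: (G x 0 i : C^o))); last first.
  apply/funext => x; rewrite fct_sumE; apply: eq_bigr => i _.
  by rewrite /GRing.scale /= mulrC.
apply: differentiable_sum => i; apply: differentiableZ.
exact: coord_differentiable.
Qed.

(** [F (t *: x)] is [t] times the derivative up to [o(t)], so a bound linear in [t] passes to the
    derivative. The vector [u] reduces vector-valued estimates to scalar ones. *)
Lemma derivative_bound F u x (K d : R) : differentiable F 0 -> F 0 = 0 -> 0 < d ->
  (forall t : R, 0 < t -> t < d -> normc (dot (F (t%:C%C *: x)) u) <= t * K) ->
  normc (dot (x *m jacobian F 0) u) <= K.
Proof.
move=> dF F0 d0 h; rewrite leNgt; apply/negP => lt.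
pose S : R := \sum_i normc (u 0 i).
have S0 : 0 <= S by apply: sumr_ge0 => i _; exact: normc_ge0.
have dS (v : V) : normc (dot v u) <= S * nr v.
  apply: le_trans (normc_sum _ _ _) _; rewrite mulr_suml; apply: ler_sum => i _.
  by rewrite normcM normc_conj mulrC ler_wpM2l ?normc_ge0 ?nr_coord.
have x0 := nr_ge0 x.
pose g := normc (dot (x *m jacobian F 0) u) - K.
have g0 : 0 < g by rewrite subr_gt0.
have q0 : 0 < (S + 1) * (nr x + 1) by apply: mulr_gt0; move: S0 x0; clear; lra.
have [r r0 hr] := differentiable_nr dF (divr_gt0 g0 q0).
have [t [t0 td tr]] : exists t : R, [/\ 0 < t, t < d & t * nr x < r].
  have x1 : 0 < nr x + 1 by rewrite ltr_wpDl.
  have [t [t0 td]] := exists_lt2 d0 (divr_gt0 r0 x1); rewrite ltr_pdivlMr // => tr.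
  by exists t; split => //; move: t0 tr; clear; lra.
have ntx : nr (t%:C%C *: x) = t * nr x by rewrite nrZ normc_real gtr0_norm.
have := hr (t%:C%C *: x); rewrite ntx => /(_ tr).
rewrite add0r F0 subr0 diff_jacobian -scalemxAl => hF.
have := h t t0 td.
have E : t%:C%C * dot (x *m jacobian F 0) u =
    dot (F (t%:C%C *: x)) u - dot (F (t%:C%C *: x) - t%:C%C *: (x *m jacobian F 0)) u.
  by rewrite dotDl dotNl dotZl; ring.
have := congr1 (fun z : C => normc z) E; rewrite /= normcM normc_real gtr0_norm // => {}E.
have := normcD (dot (F (t%:C%C *: x)) u)
  (- dot (F (t%:C%C *: x) - t%:C%C *: (x *m jacobian F 0)) u).
rewrite -E normcN => h1 h2.
have h3 := dS (F (t%:C%C *: x) - t%:C%C *: (x *m jacobian F 0)).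
have h4 : S * nr (F (t%:C%C *: x) - t%:C%C *: (x *m jacobian F 0)) <=
    S * (g / ((S + 1) * (nr x + 1)) * (t * nr x)) by rewrite ler_wpM2l.
have h5 : S * (g / ((S + 1) * (nr x + 1)) * (t * nr x)) =
   t * (g * (S * nr x / ((S + 1) * (nr x + 1)))) by ring.
have h6 : S * nr x / ((S + 1) * (nr x + 1)) < 1.
  by rewrite ltr_pdivrMr // mul1r; move: S0 x0; clear; nra.
have h7 : t * (g * (S * nr x / ((S + 1) * (nr x + 1)))) < t * g.
  by rewrite ltr_pM2l // gtr_pMr.
rewrite h5 in h4; have := lt_le_trans (le_lt_trans h4 h7) (lexx _).
by rewrite /g mulrBr; move: h1 h2 h3; clear; lra.
Qed.

(** The one-variable lemma on the line through [w], paired with [u]; [enorm_dual] later recovers the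
    Euclidean norm from these pairings. *)
Lemma polydisk_schwarz G u (r : R) : 0 < r ->
  (forall w, nr w < r -> differentiable G w /\ enorm (G w) <= 1) -> G 0 = 0 ->
  enorm u <= 1 -> forall w, nr w < r -> normc (dot (G w) u) <= nr w / r.
Proof.
move=> r0 hG G0 u1 w wr.
have [->|w0] := eqVneq w 0; first by rewrite G0 dot0l normc0 nr0 mul0r.
have wp : 0 < nr w by rewrite nr_gt0.
have E (t : C) : normc t < r / nr w -> nr (t *: w) < r by rewrite nrZ ltr_pdivlMr.
have := @schwarz R (fun t : C^o => dot (G (t *: w)) u) (r / nr w) 1 (divr_gt0 r0 wp)
  (fun t ht => slice_differentiable (dot_differentiable u (proj1 (hG _ (E t ht))))).
rewrite scale0r G0 dot0l => H.
have {H} := H _ (erefl _) 1; rewrite scale1r normc1 mul1r ltr_pdivlMr // mul1r div1r invf_div.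
apply => // t ht; apply: le_trans (dot_le _ _) _.
by rewrite mulr_ile1 ?enorm_ge0 //; have [] := hG _ (E t ht).
Qed.

Lemma enorm_dual (v : 'rV[C]_n) : exists2 u, enorm u <= 1 & enorm v = normc (dot v u).
Proof.
have [->|v0] := eqVneq v 0.
  by exists 0; rewrite ?dot0l ?normc0 enorm0.
have vp : 0 < enorm v by rewrite enorm_gt0.
exists ((enorm v)^-1%:C%C *: v).
  by rewrite enormZ normc_real ger0_norm ?invr_ge0 ?enorm_ge0 // mulVf // gt_eqF.
rewrite /dot (eq_bigr (fun i => (enorm v)^-1%:C%C * (v 0 i * (v 0 i)^*%C))).
  rewrite -mulr_sumr -/(dot v v) dot_self normcM !normc_real.
  rewrite !ger0_norm ?e2_ge0 ?invr_ge0 ?enorm_ge0 // -enorm_sqr expr2 mulKf //.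
  by rewrite gt_eqF.
move=> i _; rewrite mxE mulrCA; congr (_ * _); case: (v 0 i) => x y; move: (_^-1) => a.
by apply/eqP; rewrite eq_complex /=; apply/andP; split; apply/eqP; ring.
Qed.

(** Two radii let one statement serve both invariants: [r = 1] for the squeezing function, [s = 1]
    for the Fridman invariant. *)
Lemma alexander_bound F G p (r s : R) : (2 <= n)%N -> p != 0 -> 0 < r -> 0 < s ->
  (forall x, enorm x < r -> x != p -> differentiable F x /\ nr (F x) <= 1) -> F 0 = 0 ->
  (forall w, nr w < s -> differentiable G w /\ enorm (G w) <= 1) -> G 0 = 0 ->
  jacobian G 0 *m jacobian F 0 = 1%:M -> n%:R * (r * s) ^+ 2 <= 1.
Proof.
move=> n2 p0 r0 s0 hF F0 hG G0 GF.
have [dF _] : differentiable F 0 /\ nr (F 0) <= 1 by apply: hF; rewrite ?enorm0 // eq_sym.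
have [dG _] : differentiable G 0 /\ enorm (G 0) <= 1 by apply: hG; rewrite nr0.
have pp : 0 < enorm p by rewrite enorm_gt0.
have coordE (v : V) i : dot v (delta_mx 0 i) = v 0 i.
  rewrite /dot (bigD1 i) //= big1 => [|k ki]; rewrite mxE eqxx /= ?eqxx.
    by rewrite conjc1 mulr1 addr0.
  by rewrite (negbTE ki) conjc0 mulr0.
have hFi i (y : V) : enorm y < r -> y != p ->
    differentiable (fun x => F x 0 i : C^o) y /\ normc (F y 0 i) <= 1.
  move=> yr yp; have [dy ny] := hF y yr yp.
  split; [exact: coord_differentiable | exact: le_trans (nr_coord _ _) ny].
have hM (x : V) i : normc ((x *m jacobian F 0) 0 i) <= r^-1 * enorm x.
  rewrite -coordE; have x0 := enorm_ge0 x.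
  (* For [t] below this bound [t *: x] stays in the ball and is shorter than [p], hence different
     from it. *)
  apply: (@derivative_bound F _ x _ (Num.min r (enorm p) / (enorm x + 1)) dF F0).
    by rewrite divr_gt0 ?lt_min ?r0 //; move: x0; clear; lra.
  move=> t t0; rewrite ltr_pdivlMr; last by move: x0; clear; lra.
  rewrite lt_min coordE => /andP[tr tp].
  have tx : enorm (t%:C%C *: x) = t * enorm x by rewrite enormZ normc_real gtr0_norm.
  have Fi0 : F 0 0 i = 0 by rewrite F0 mxE.
  have txr : enorm (t%:C%C *: x) < r by rewrite tx; move: tr t0; clear; lra.
  have txp : t%:C%C *: x != p.
    by apply/eqP => E; move: tp; rewrite -E tx; move: t0; clear; lra.
  have H := @schwarz_punctured R n (fun x => F x 0 i) p r n2 p0 r0 (hFi i) Fi0 _ txr txp.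
  by rewrite tx -mulrA in H; rewrite (mulrC r^-1).
have hN (w : V) : (forall i, normc (w 0 i) <= 1) -> e2 (w *m jacobian G 0) <= s^-1 ^+ 2.
  have s10 : 0 <= s^-1 by rewrite invr_ge0 ltW.
  move=> w1; rewrite -enorm_le //.
  have [u u1 ->] := enorm_dual (w *m jacobian G 0).
  apply: (@derivative_bound G u w _ s dG G0 s0) => t t0 ts.
  have nw : nr (t%:C%C *: w) <= t.
    rewrite nrZ normc_real gtr0_norm // ler_piMr ?(ltW t0) //.
    exact: nr_row_le.
  apply: le_trans (polydisk_schwarz s0 hG G0 u1 (le_lt_trans nw ts)) _.
  by rewrite ler_pM2r ?invr_gt0.
have s1 : 0 < s^-1 by rewrite invr_gt0.
have := trace_bound s1 GF hM hN => h.
have rs : 0 < (r * s) ^+ 2 by rewrite exprn_gt0 // mulr_gt0.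
rewrite -ler_pdivlMr // div1r; apply: le_trans h _.
by rewrite -exprMn -invfM exprVn.
Qed.

(** The points [(1 - t) *: p] are sent by [g] into a compact ball on which [G] stays at positive
    distance from [p], yet [G] returns them arbitrarily close to [p]. *)
Lemma puncture_bound g G p (r : R) : p != 0 -> enorm p < r ->
  (forall x, enorm x < r -> x != p -> nr (g x) <= enorm x / r /\ G (g x) = x) ->
  ~ (forall w, nr w <= enorm p / r -> {for w, continuous G} /\ G w != p).
Proof.
move=> p0 pr hg hG.
have pp : 0 < enorm p by rewrite enorm_gt0.
have r0 := lt_trans pp pr.
have np : 0 < nr p by rewrite nr_gt0.
have K0 : [set w : V | nr (w - 0) <= enorm p / r] !=set0.
  by exists 0; rewrite /= subrr nr0 divr_ge0 ?enorm_ge0 // ltW.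
have KE (w : V) : nr (w - 0) <= enorm p / r -> nr w <= enorm p / r by rewrite subr0.
have [|c cK hc] := @compact_max R _ _ (fun w => - nr (G w - p))
    (@compact_row R n 0 (enorm p / r)) K0.
  move=> w /KE wr; apply: continuousN; apply: nr_comp_continuous.
  exact: (hG w wr).1.
have m0 : 0 < nr (G c - p).
  by rewrite nr_gt0 subr_eq0; exact: (hG c (KE c cK)).2.
have [t [t0 t1]] := exists_lt2 ltr01 (divr_gt0 m0 np); rewrite ltr_pdivlMr // => tm.
pose x : V := (1 - t)%:C%C *: p.
have ex : enorm x = (1 - t) * enorm p.
  by rewrite enormZ normc_real ger0_norm // subr_ge0 ltW.
have exp : enorm x <= enorm p by rewrite ex; move: t0 pp; clear; nra.
have xE : x - p = - (t%:C%C *: p) by rewrite /x rmorphB rmorph1 scalerBl scale1r addrC addKr.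
have xp : x != p.
  rewrite -subr_eq0 xE oppr_eq0 scaler_eq0 negb_or p0 andbT.
  by rewrite eq_complex /= gt_eqF.
have [g1 g2] := hg x (le_lt_trans exp pr) xp.
have : nr (g x - 0) <= enorm p / r.
  by rewrite subr0; apply: le_trans g1 _; rewrite ler_pM2r ?invr_gt0.
move/hc; rewrite g2 xE nrN nrZ normc_real gtr0_norm //.
by move: tm; clear; lra.
Qed.

End PuncturedBall.

(** * Upper bounds for both invariants, moved to the origin *)

Section UpperBounds.
Context {R : realType} {n : nat}.
Local Notation C := R[i].
Local Notation V := ('rV[C]_n : normedModType C).
Implicit Types (F G : V -> V) (p w x : V).

Lemma enorm_nr (v : 'rV[C]_n) : enorm v <= n%:R * nr v.
Proof.
rewrite enorm_le ?mulr_ge0 ?nr_ge0 //; apply: le_trans (e2_nr v) _.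
rewrite exprMn ler_wpM2r ?sqr_ge0 // expr2 -natrM ler_nat.
by case: (n) => // m; rewrite leq_pmulr.
Qed.

Definition punctured_ball (r : R) p : set V := [set x | enorm x < r /\ x != p].

Lemma punctured_ball_open (r : R) p x : punctured_ball r p x -> nbhs x (punctured_ball r p).
Proof.
move=> [xr xp]; apply/nbhs_nr.
have d0 : 0 < (r - enorm x) / (n%:R + 1).
  by rewrite divr_gt0 ?subr_gt0 // ltr_wpDl.
exists (Num.min ((r - enorm x) / (n%:R + 1)) (nr (x - p))).
  by rewrite lt_min d0 nr_gt0 subr_eq0.
move=> y; rewrite lt_min => /andP[yx yp]; split.
  have := enormD x (y - x); rewrite addrC subrK => h.
  apply: le_lt_trans h _; rewrite -ltrBrDl.
  move: yx; rewrite ltr_pdivlMr => [yx|]; last by rewrite ltr_wpDl.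
  by apply: le_lt_trans (enorm_nr _) _; have := nr_ge0 (y - x); move: yx; clear; lra.
by apply/eqP => yE; move: yp; rewrite yE nrB ltxx.
Qed.

Lemma polydisk_open (r : R) x : nr x < r -> nbhs x [set y : V | nr y < r].
Proof.
move=> xr; have := @nr_ball_open R V 0 r x; rewrite subr0 => /(_ xr).
by apply: filterS => y /=; rewrite subr0.
Qed.

Lemma schwarz_punctured_row F p (r : R) : (2 <= n)%N -> p != 0 -> 0 < r ->
  (forall x, punctured_ball r p x -> differentiable F x /\ nr (F x) <= 1) -> F 0 = 0 ->
  forall x, punctured_ball r p x -> nr (F x) <= enorm x / r.
Proof.
move=> n2 p0 r0 hF F0 x [xr xp]; apply: nr_row_le => [|i].
  by rewrite divr_ge0 ?enorm_ge0 // ltW.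
have Fi0 : F 0 0 i = 0 by rewrite F0 mxE.
apply: (@schwarz_punctured R n (fun x => F x 0 i) p r n2 p0 r0 _ Fi0 _ xr xp) => y yr yp.
have [dy ny] := hF y (conj yr yp).
split; [exact: coord_differentiable | exact: le_trans (nr_coord _ _) ny].
Qed.

Lemma punctured_ball0 p (r : R) : p != 0 -> 0 < r -> punctured_ball r p 0.
Proof.
move=> p0 r0; split; last by rewrite eq_sym.
by rewrite enorm0.
Qed.

Lemma ball_to_polydisk_bound F p (r : R) : (2 <= n)%N -> p != 0 -> enorm p < 1 -> 0 < r ->
  (forall x, punctured_ball 1 p x -> differentiable F x /\ nr (F x) <= 1) ->
  set_inj (punctured_ball 1 p) F -> F 0 = 0 ->
  (forall w, nr w < r -> exists2 x, punctured_ball 1 p x & F x = w) ->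
  r <= enorm p /\ n%:R * r ^+ 2 <= 1.
Proof.
move=> n2 p0 p1 r0 hF injF F0 surF.
have D0 := punctured_ball0 p0 (@ltr01 R).
have dF x (Dx : punctured_ball 1 p x) := (hF x Dx).1.
have uF := injective_unit (@punctured_ball_open 1 p) dF injF.
pose G : V -> V := inv_on (punctured_ball 1 p) F.
have GF x : punctured_ball 1 p x -> G (F x) = x by exact: inv_onK.
have dG w : nr w < r -> differentiable G w.
  move=> /surF[x Dx <-].
  exact: (inv_on_differentiable (@punctured_ball_open 1 p) dF injF Dx (uF x Dx)).1.
have GD w : nr w < r -> punctured_ball 1 p (G w) by move=> /surF[x Dx <-]; rewrite GF.
have G0 : G 0 = 0 by rewrite -{1}F0 GF.
split.
  rewrite leNgt; apply/negP => pr.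
  apply: (@puncture_bound R n F G p 1 p0 p1).
    move=> x x1 xp; split; last by apply: GF.
    exact: (schwarz_punctured_row n2 p0 ltr01 hF F0 (conj x1 xp)).
  move=> w; rewrite divr1 => wp; have wr := le_lt_trans wp pr.
  by split; [exact: differentiable_continuous (dG w wr) | have [] := GD w wr].
have JJ : jacobian G 0 *m jacobian F 0 = 1%:M.
  have [_] := inv_on_differentiable (@punctured_ball_open 1 p) dF injF D0 (uF 0 D0).
  by rewrite F0 -/G => ->; rewrite mulVmx // uF.
have := @alexander_bound R n F G p 1 r n2 p0 ltr01 r0 (fun x xr xp => hF x (conj xr xp)) F0
  (fun w wr => conj (dG w wr) (ltW (GD w wr).1)) G0 JJ.
by rewrite mul1r.
Qed.

Lemma polydisk_to_ball_bound G p (r : R) : (2 <= n)%N -> p != 0 -> 0 < r ->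
  (forall w, nr w < 1 -> differentiable G w /\ punctured_ball 1 p (G w)) ->
  set_inj [set w | nr w < 1] G -> G 0 = 0 ->
  (forall x, punctured_ball r p x -> exists2 w, nr w < 1 & G w = x) ->
  r <= enorm p /\ n%:R * r ^+ 2 <= 1.
Proof.
move=> n2 p0 r0 hG injG G0 surG.
have D0 := punctured_ball0 p0 r0.
have dG w (w1 : nr w < 1) := (hG w w1).1.
have oP w : [set w : V | nr w < 1] w -> nbhs w [set w : V | nr w < 1].
  exact: polydisk_open.
have uG := injective_unit oP dG injG.
pose F : V -> V := inv_on [set w : V | nr w < 1] G.
have FG w : nr w < 1 -> F (G w) = w by exact: inv_onK.
have hF x : punctured_ball r p x -> differentiable F x /\ nr (F x) <= 1.
  move=> /surG[w w1 <-]; split; last by rewrite FG // ltW.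
  exact: (inv_on_differentiable oP dG injG w1 (uG w w1)).1.
have F0 : F 0 = 0 by rewrite -{1}G0 FG // nr0.
split.
  rewrite leNgt; apply/negP => pr.
  apply: (@puncture_bound R n F G p r p0 pr).
    move=> x xr xp; split; first exact: (schwarz_punctured_row n2 p0 r0 hF F0 (conj xr xp)).
    by have [w w1 wx] := surG x (conj xr xp); rewrite -wx FG.
  move=> w wp; have w1 : nr w < 1 by apply: le_lt_trans wp _; rewrite ltr_pdivrMr ?mul1r.
  by have [dw [_ wp']] := hG w w1; split; [exact: differentiable_continuous | ].
have N0 : nr (0 : V) < 1 by rewrite nr0.
have JJ : jacobian G 0 *m jacobian F 0 = 1%:M.
  have [_] := inv_on_differentiable oP dG injG N0 (uG 0 N0).
  by rewrite G0 -/F => ->; rewrite mulmxV // uG.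
have := @alexander_bound R n F G p r 1 n2 p0 r0 ltr01 (fun x xr xp => hF x (conj xr xp)) F0
  (fun w wr => conj (dG w wr) (ltW (hG w wr).2.1)) G0 JJ.
by rewrite mulr1.
Qed.

End UpperBounds.

(** * Automorphisms of the ball and of the polydisk *)

Section BallAutomorphism.
Context {R : realType} {n : nat}.
Local Notation C := R[i].
Local Notation V := ('rV[C]_n : normedModType C).
Implicit Types (z w x : V).

Lemma dotZr (a : C) (u v : 'rV[C]_n) : dot u (a *: v) = a^*%C * dot u v.
Proof.
rewrite /dot mulr_sumr; apply: eq_bigr => i _; rewrite mxE.
by rewrite (_ : (a * v 0 i)^*%C = a^*%C * (v 0 i)^*%C) 1?mulrCA // rmorphM.
Qed.

Lemma row_differentiable (g : V -> V) w :
  (forall i, differentiable (fun x => g x 0 i : C^o) w) -> differentiable g w.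
Proof.
move=> dg.
rewrite (_ : g = \sum_i (fun x : V => (g x 0 i : C^o) *: (delta_mx 0 i : V))).
  by apply: differentiable_sum => i; exact: differentiableZl.
by apply/funext => x; rewrite fct_sumE [LHS]row_sum_delta.
Qed.

(* The involution of the ball exchanging [0] and [z]; in the usual notation it is
   [(z - P w - s Q w) / (1 - <w, z>)] with [P] the orthogonal projection onto the
   line of [z], [Q = 1 - P], and [1 - s = (1 + s)^-1 * e2 z] has been used to
   eliminate [P]. *)
Definition ball_aut z w : V :=
  let s := (Num.sqrt (1 - e2 z))%:C%C in
  (1 - dot w z)^-1 *: ((1 - dot w z / (1 + s)) *: z - s *: w).

Section Fixed_z.
Variable z : V.
Hypothesis z1 : enorm z < 1.
Let s : R := Num.sqrt (1 - e2 z).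

Let sp : 0 < s.
Proof. by rewrite sqrtr_gt0 subr_gt0 -(expr1n _ 2) -enorm_lt. Qed.

Let s2 : e2 z = 1 - s ^+ 2.
Proof.
rewrite sqr_sqrtr; first by rewrite subKr.
by rewrite subr_ge0 -(expr1n _ 2) -enorm_le // ltW.
Qed.

Let s1 : 1 + s%:C%C != 0.
Proof. by rewrite eq_complex /= negb_and gt_eqF // ltr_wpDr // ltW. Qed.

Let s0 : s%:C%C != 0.
Proof. by rewrite eq_complex /= negb_and gt_eqF. Qed.

Lemma ball_aut_den w : enorm w < 1 -> 1 - dot w z != 0.
Proof.
move=> w1; rewrite subr_eq0 eq_sym; apply/eqP => h.
by have := dot_le w z; rewrite h normc1 leNgt mulr_ilt1 ?enorm_ge0.
Qed.

(** The classical identity [1 - |phi w|^2 = (1 - |z|^2) (1 - |w|^2) / |1 - <w, z>|^2], cleared of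
    its denominator. *)
Lemma e2_ball_aut w : enorm w < 1 ->
  e2 (ball_aut z w) * normc (1 - dot w z) ^+ 2 =
  normc (1 - dot w z) ^+ 2 - s ^+ 2 * (1 - e2 w).
Proof.
move=> w1; have t1 := ball_aut_den w1.
rewrite /ball_aut e2Z -/s normcV exprVn mulrC mulVKf; last first.
  by rewrite expf_neq0 // normc_eq0.
rewrite addrC -scaleNr e2D !e2Z dotZl dotZr s2 normcN normc_real !normc_sqr.
have s1' : 1 + s != 0 by rewrite gt_eqF // ltr_wpDr // ltW.
have -> : (1 + s%:C%C)^-1 = ((1 + s)^-1)%:C%C by rewrite fmorphV rmorphD rmorph1.
rewrite real_normK ?num_real //.
by case: (dot w z) => a b /=; move: (e2 w) => W; move: s s1' => q q1; field.
Qed.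

Lemma ball_aut_lt1 w : enorm w < 1 -> enorm (ball_aut z w) < 1.
Proof.
move=> w1; have t1 := ball_aut_den w1; have := e2_ball_aut w1.
move: w1; rewrite !enorm_lt // expr1n => w1 h.
have t0 : 0 < normc (1 - dot w z) ^+ 2 by rewrite exprn_gt0 // normc_gt0.
rewrite -(ltr_pM2r t0) mul1r h gtrBl mulr_gt0 ?exprn_gt0 //.
by rewrite subr_gt0.
Qed.

Lemma ball_autK w : enorm w < 1 -> ball_aut z (ball_aut z w) = w.
Proof.
move=> w1; have t1 := ball_aut_den w1.
rewrite {1}/ball_aut -/s.
(* The second application involves [w] only through this product and the coordinates of the image;
   once it is known, each coordinate is a rational identity. *)
set t' := dot (ball_aut z w) z.
have Ht' : t' = (1 - dot w z)^-1 * ((1 - dot w z / (1 + s%:C%C)) * (1 - s%:C%C ^+ 2)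
    - s%:C%C * dot w z).
  rewrite /t' /ball_aut -/s dotZl dotDl dotNl !dotZl dot_self s2.
  by rewrite rmorphB rmorph1 rmorphXn.
have t1' : 1 - t' = s%:C%C ^+ 2 / (1 - dot w z).
  by rewrite Ht'; move: (s%:C%C) (dot w z) s1 t1 => a b a1 b1; field; rewrite b1.
have {1}-> : ball_aut z w = (1 - dot w z)^-1 *: ((1 - dot w z / (1 + s%:C%C)) *: z - s%:C%C *: w).
  by [].
rewrite t1' Ht'; apply/rowP => i; rewrite !mxE; move: (z 0 i) (w 0 i) => x y.
by move: (s%:C%C) (dot w z) s1 s0 t1 => a b a1 a0 b1; field; rewrite a1 a0 b1.
Qed.

Lemma ball_aut0 : ball_aut z 0 = z.
Proof. by rewrite /ball_aut dot0l mul0r subr0 invr1 !scale1r scaler0 subr0. Qed.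

Lemma ball_aut_center : ball_aut z z = 0.
Proof. by rewrite -{2}ball_aut0 ball_autK // -(expr1n _ 2) enorm_lt // e20 expr1n. Qed.

Lemma ball_aut_differentiable w : enorm w < 1 -> differentiable (ball_aut z) w.
Proof.
move=> w1; have t1 := ball_aut_den w1; have dx i : differentiable (fun x : V => x 0 i : C^o) w.
  exact: (@coord_differentiable R n (fun x => x) w i).
have dt : differentiable (fun x : V => dot x z : C^o) w.
  exact: (@dot_differentiable R n (fun x => x) z w).
have dc (c : C^o) : differentiable (fun _ : V => c) w by exact: differentiable_cst.
have dk : differentiable (fun x : V => (1 - dot x z)^-1 : C^o) w.
  exact: (differentiableV (differentiableB (dc 1) dt) t1).
apply: row_differentiable => i.
rewrite (_ : (fun x => _) = (fun x : V => (1 - dot x z)^-1 *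
    (((1 - dot x z * (1 + s%:C%C)^-1) * z 0 i) - s%:C%C * x 0 i) : C^o)); last first.
  by apply/funext => x; rewrite !mxE.
apply: (differentiableM dk); apply: differentiableB.
  apply: differentiableM (dc _).
  exact: (differentiableB (dc 1) (differentiableM dt (dc _))).
exact: (differentiableM (dc _) (dx i)).
Qed.

End Fixed_z.
End BallAutomorphism.

(** * Automorphisms of the disc and of the polydisk *)

Section Mobius.
Context {R : realType}.
Local Notation C := R[i].

Definition mobius (a x : C) : C := (x + a) / (1 + a^*%C * x).

Lemma mobius_den (a x : C) : normc a < 1 -> normc x < 1 -> 1 + a^*%C * x != 0.
Proof.
move=> a1 x1; rewrite addrC addr_eq0; apply/eqP => h.
have := congr1 (fun y : C => normc y) h.
rewrite /= normcM normcN normc1 normc_conj => {}h.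
have : normc a * normc x < 1 by rewrite mulr_ilt1 ?normc_ge0.
by rewrite h ltxx.
Qed.

Lemma mobius_lt1 (a x : C) : normc a < 1 -> normc x < 1 -> normc (mobius a x) < 1.
Proof.
move=> a1 x1; rewrite /mobius normcM normcV ltr_pdivrMr ?normc_gt0 ?mobius_den // mul1r.
rewrite -(ltr_pXn2r (n := 2)) ?nnegrE ?normc_ge0 // -subr_gt0.
have -> : normc (1 + a^*%C * x) ^+ 2 - normc (x + a) ^+ 2 =
    (1 - normc a ^+ 2) * (1 - normc x ^+ 2).
  by rewrite !normc_sqr; case: a {a1} => p q; case: x {x1} => p' q' /=; ring.
by rewrite mulr_gt0 // subr_gt0 expr_lt1 ?normc_ge0.
Qed.

Lemma mobius0 (a : C) : mobius a 0 = a.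
Proof. by rewrite /mobius mulr0 addr0 divr1 add0r. Qed.

Lemma mobiusK (a x : C) : normc a < 1 -> normc x < 1 -> mobius (- a) (mobius a x) = x.
Proof.
move=> a1 x1; have d0 := mobius_den a1 x1.
have d1 : 1 - a^*%C * a != 0.
  rewrite subr_eq0; apply/eqP => h; have := congr1 (fun y : C => normc y) h.
  rewrite /= normcM normc_conj normc1 => {}h.
  have : normc a * normc a < 1 by rewrite mulr_ilt1 ?normc_ge0.
  by rewrite -h ltxx.
rewrite /mobius; have -> : (- a)^*%C = - a^*%C.
  by case: (a) => p q; apply/eqP; rewrite eq_complex /= !eqxx.
move: (a^*%C) d0 d1 => b d0 d1.
have E : 1 + - b * ((x + a) / (1 + b * x)) = (1 - b * a) / (1 + b * x) by field.
by rewrite E; field; rewrite d0 d1.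
Qed.

Context {n : nat}.
Local Notation V := ('rV[C]_n : normedModType C).

(** Serves to normalize at the origin: a map competing for the Fridman invariant may reach the base
    point from any point [c] of the polydisk. *)
Definition polydisk_aut (c w : V) : V := \row_i mobius (c 0 i) (w 0 i).

Lemma nr_coords (w : V) (r : R) : 0 < r -> nr w < r <-> forall i, normc (w 0 i) < r.
Proof.
move=> r0; split=> [wr i|]; first exact: le_lt_trans (nr_coord _ _) wr.
exact: nr_row_lt.
Qed.

Lemma polydisk_aut_lt1 (c w : V) : nr c < 1 -> nr w < 1 -> nr (polydisk_aut c w) < 1.
Proof.
move=> /(nr_coords _ ltr01) c1 /(nr_coords _ ltr01) w1; apply/(nr_coords _ ltr01) => i.
by rewrite mxE mobius_lt1.
Qed.

Lemma polydisk_aut0 (c : V) : polydisk_aut c 0 = c.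
Proof. by apply/rowP => i; rewrite !mxE mobius0. Qed.

Lemma polydisk_autK (c w : V) : nr c < 1 -> nr w < 1 ->
  polydisk_aut (- c) (polydisk_aut c w) = w.
Proof.
move=> /(nr_coords _ ltr01) c1 /(nr_coords _ ltr01) w1; apply/rowP => i.
by rewrite !mxE mobiusK.
Qed.

Lemma polydisk_aut_differentiable (c w : V) : nr c < 1 -> nr w < 1 ->
  differentiable (polydisk_aut c) w.
Proof.
move=> /(nr_coords _ ltr01) c1 /(nr_coords _ ltr01) w1.
apply: row_differentiable => i.
have dx : differentiable (fun x : V => x 0 i : C^o) w.
  exact: (@coord_differentiable R n (fun x => x) w i).
have dc (a : C^o) : differentiable (fun _ : V => a) w by exact: differentiable_cst.
rewrite (_ : (fun x => _) =
    (fun x : V => (x 0 i + c 0 i) * (1 + (c 0 i)^*%C * x 0 i)^-1 : C^o)); last first.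
  by apply/funext => x; rewrite mxE.
apply: (differentiableM (differentiableD dx (dc (c 0 i)))).
exact: (differentiableV (differentiableD (dc 1) (differentiableM (dc _) dx))
  (mobius_den (c1 i) (w1 i))).
Qed.

End Mobius.

(** * Unitary reflections *)

Section Reflection.
Context {R : realType} {n : nat}.
Local Notation C := R[i].
Local Notation V := ('rV[C]_n : normedModType C).

(* For [u = 0] this is the identity, because [0^-1 = 0]. *)
Definition reflection (u w : V) : V := w - (2 * dot w u / (e2 u)%:C%C) *: u.

Lemma e2_reflection (u w : V) : e2 (reflection u w) = e2 w.
Proof.
have [->|u0] := eqVneq u 0; first by rewrite /reflection scaler0 subr0.
have E0 : e2 u != 0 by rewrite e2_eq0.
rewrite /reflection -scaleNr e2D e2Z dotZr -fmorphV normcN !normcM !normc_real.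
rewrite (_ : normc 2 = 2) ?normr_id; last first.
  by rewrite -(rmorph_nat (real_complex R)) normc_real ger0_norm.
rewrite !exprMn real_normK ?num_real // !normc_sqr.
case: (dot w u) => a b /=; move: (e2 w) (e2 u) E0 => W E E0; by field.
Qed.

Lemma reflectionK (u w : V) : reflection u (reflection u w) = w.
Proof.
have [->|u0] := eqVneq u 0; first by rewrite /reflection !scaler0 !subr0.
have E0 : (e2 u)%:C%C != 0 by rewrite eq_complex /= negb_and e2_eq0 u0.
have H : dot (reflection u w) u = - dot w u.
  by rewrite /reflection dotDl dotNl dotZl dot_self; field.
by rewrite {1}/reflection H /reflection mulrN mulNr scaleNr opprK subrK.
Qed.

(** When the lengths agree and [<z, v>] is real, [2 <z, z - v> = |z - v|^2], so the reflection
    subtracts exactly [z - v] from [z]. *)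
Lemma reflection_swap (v z : V) : e2 v = e2 z -> Im (dot z v) = 0 ->
  reflection (z - v) z = v.
Proof.
move=> vz im; have [->|u0] := eqVneq z v; first by rewrite /reflection subrr scaler0 subr0.
have E0 : (e2 (z - v))%:C%C != 0 by rewrite eq_complex /= negb_and e2_eq0 subr_eq0 u0.
have dE : dot z (- v) = - dot z v.
  by rewrite -scaleN1r dotZr rmorphN rmorph1 mulN1r.
have dzE : 2 * dot z (z - v) = (e2 (z - v))%:C%C.
  rewrite e2D -(scaleN1r v) e2Z normcN normc1 expr1n mul1r vz scaleN1r dE.
  have -> : dot z (z - v) = (e2 z)%:C%C - dot z v.
    rewrite -dot_self /dot -sumrB; apply: eq_bigr => i _; rewrite !mxE.
    by rewrite -mulrBr; congr (_ * _); rewrite rmorphB.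
  case: (dot z v) im => a b /= ->; apply/eqP; rewrite eq_complex /=.
  by apply/andP; split; apply/eqP; ring.
by rewrite /reflection dzE mulfV // scale1r opprB addrC subrK.
Qed.

(* A unitary map taking [z] to a vector with one nonzero coordinate. *)
Lemma exists_reflection (z : V) : (0 < n)%N -> exists u : V, nr (reflection u z) = enorm z.
Proof.
move=> n0; pose i0 := Ordinal n0.
(* The phase of the coordinate [z 0 i0]; it makes the product of [z] with the vector [v] below
   real. *)
have [c c1 hc] : exists2 c : C, normc c = 1 & Im (z 0 i0 * c^*%C) = 0.
  have [z0|z0] := eqVneq (z 0 i0) 0.
    by exists 1; rewrite ?normc1 // z0 mul0r.
  have nz : normc (z 0 i0) != 0 by rewrite normc_eq0.
  exists (z 0 i0 * (normc (z 0 i0))^-1%:C%C).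
    by rewrite normcM normc_real ger0_norm ?invr_ge0 ?normc_ge0 // mulfV.
  by case: (z 0 i0) => a b /=; ring.
pose v : V := (c * (enorm z)%:C%C) *: delta_mx 0 i0.
have vi i : v 0 i = (c * (enorm z)%:C%C) * (i == i0)%:R by rewrite !mxE eqxx.
have cz : normc (c * (enorm z)%:C%C) = enorm z.
  by rewrite normcM c1 mul1r normc_real ger0_norm // enorm_ge0.
have e2v : e2 v = e2 z.
  rewrite /e2 (bigD1 i0) //= big1 => [|i ii]; rewrite vi.
    by rewrite eqxx mulr1 addr0 cz enorm_sqr.
  by rewrite (negbTE ii) mulr0 normc0 expr0n.
have im : Im (dot z v) = 0.
  rewrite /dot (bigD1 i0) //= big1 => [|i ii]; rewrite vi; last first.
    by rewrite (negbTE ii) mulr0 conjc0 mulr0.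
  rewrite eqxx mulr1 addr0.
  have -> : z 0 i0 * (c * (enorm z)%:C%C)^*%C = z 0 i0 * c^*%C * (enorm z)%:C%C.
    case: (z 0 i0) => a b; case: (c) => p q; apply/eqP; rewrite eq_complex /=.
    by apply/andP; split; apply/eqP; ring.
  by move: hc; case: (z 0 i0 * c^*%C) => a b /= ->; rewrite mul0r mulr0 addr0.
exists (z - v); rewrite reflection_swap //; apply/eqP; rewrite eq_le.
apply/andP; split.
  apply: nr_row_le => [|i]; first exact: enorm_ge0.
  rewrite vi; case: (i == i0); first by rewrite mulr1 cz.
  by rewrite mulr0 normc0 enorm_ge0.
by rewrite -{1}cz; have := nr_coord v i0; rewrite vi eqxx mulr1.
Qed.

Lemma reflection_differentiable (u w : V) : differentiable (reflection u) w.
Proof.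
have dc (a : C^o) : differentiable (fun _ : V => a) w by exact: differentiable_cst.
apply: row_differentiable => i.
rewrite (_ : (fun x => _) =
    (fun x : V => x 0 i - 2 * dot x u * (e2 u)%:C%C^-1 * u 0 i : C^o)); last first.
  by apply/funext => x; rewrite !mxE.
have dx : differentiable (fun x : V => x 0 i : C^o) w.
  exact: (@coord_differentiable R n (fun x => x) w i).
have dt : differentiable (fun x : V => dot x u : C^o) w.
  exact: (@dot_differentiable R n (fun x => x) u w).
exact: (differentiableB dx (differentiableM (differentiableM (differentiableM (dc 2) dt) (dc _)) (dc _))).
Qed.

End Reflection.

(** * Squeezing function and Fridman invariant *)

Section Tanh.
Context {R : realType}.
Implicit Types x y r : R.

Lemma tanhE r : tanh r = (expR (2 * r) - 1) / (expR (2 * r) + 1).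
Proof.
have -> : 2 * r = r + r by ring.
rewrite /tanh expRD expRN; have := expR_gt0 r; move: (expR r) => e e0.
have e1 : e * e + 1 != 0 by rewrite gt_eqF // ltr_wpDl // mulr_ge0 // ltW.
by field; rewrite e1 gt_eqF.
Qed.

Lemma tanh_lt1 r : tanh r < 1.
Proof.
rewrite tanhE; have := expR_gt0 (2 * r); move: (expR _) => e e0.
by rewrite ltr_pdivrMr; [lra | lra].
Qed.

Lemma atanh_lt x r : -1 < x -> x < 1 -> (atanh x < r) = (x < tanh r).
Proof.
move=> x0 x1; have p1 : 0 < 1 - x by lra. have p2 : 0 < 1 + x by lra.
rewrite /atanh tanhE ltr_pdivrMr // (mulrC r) -{1}(expRK (2 * r)).
rewrite ltr_ln ?posrE ?divr_gt0 ?expR_gt0 // ltr_pdivrMr //.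
have := expR_gt0 (2 * r); move: (expR _) => e e0.
by rewrite ltr_pdivlMr; [apply/idP/idP; lra | lra].
Qed.

Lemma atanhK x : -1 < x -> x < 1 -> tanh (atanh x) = x.
Proof.
move=> x0 x1; have p1 : 0 < 1 - x by lra. have p2 : 0 < 1 + x by lra.
have -> : tanh (atanh x) = ((1 + x) / (1 - x) - 1) / ((1 + x) / (1 - x) + 1).
  by rewrite tanhE /atanh (mulrC 2) divfK // lnK // posrE divr_gt0.
have p3 : 1 + x + (1 - x) != 0 by rewrite gt_eqF //; lra.
by field; rewrite p3 gt_eqF.
Qed.

Lemma atanh0 : atanh 0 = 0 :> R.
Proof. by rewrite /atanh addr0 subr0 divr1 ln1 mul0r. Qed.

Lemma tanh_gt0 r : 0 < r -> 0 < tanh r.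
Proof. by move=> r0; rewrite -atanh_lt ?atanh0; [ | lra | lra]. Qed.

Lemma le_atanh x y : -1 < x -> x <= y -> y < 1 -> atanh x <= atanh y.
Proof.
move=> x0 xy y1; rewrite leNgt; apply/negP.
rewrite atanh_lt; [ | lra | lra]; rewrite atanhK; lra.
Qed.

End Tanh.

(** * Both invariants of the punctured unit ball *)

Section PuncturedUnitBall.
Context {R : realType} {n : nat}.
Local Notation C := R[i].
Local Notation V := ('rV[C]_n : normedModType C).
Implicit Types (w x y : V) (f g h : V -> V).
Context (n2 : (2 <= n)%N) (z : V) (z1 : enorm z < 1) (z0 : z != 0).

Local Notation D := (unit_ball n `\ 0 : set V).
Let r0 : R := Num.min (enorm z) (1 / Num.sqrt n%:R).

Let n0 : 0 < n%:R :> R.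
Proof. by rewrite ltr0n ltnW. Qed.

Let zp : 0 < enorm z.
Proof. by rewrite enorm_gt0. Qed.

Let r0_gt0 : 0 < r0.
Proof. by rewrite lt_min zp divr_gt0 // sqrtr_gt0. Qed.

Let r0_le_z : r0 <= enorm z.
Proof. by rewrite ge_min lexx. Qed.

Let r0_lt1 : r0 < 1 := le_lt_trans r0_le_z z1.

Let r0_sqr : n%:R * r0 ^+ 2 <= 1.
Proof.
have : r0 <= 1 / Num.sqrt n%:R by rewrite ge_min lexx orbT.
rewrite ler_pdivlMr ?sqrtr_gt0 // -(ler_pXn2r (n := 2)) ?nnegrE ?ler01 //; last first.
  by rewrite mulr_ge0 ?sqrtr_ge0 // (ltW r0_gt0).
by rewrite expr1n exprMn sqr_sqrtr ?(ltW n0) // mulrC.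
Qed.

Let le_r0 (r : R) : 0 < r -> r <= enorm z /\ n%:R * r ^+ 2 <= 1 -> r <= r0.
Proof.
move=> rp [rz rn]; rewrite le_min rz ler_pdivlMr ?sqrtr_gt0 //=.
rewrite -(ler_pXn2r (n := 2)) ?nnegrE ?ler01 //; last first.
  by rewrite mulr_ge0 ?sqrtr_ge0 // (ltW rp).
by rewrite expr1n exprMn sqr_sqrtr ?(ltW n0) // mulrC.
Qed.

Lemma punctured_unit_ball x : D x <-> enorm x < 1 /\ x != 0.
Proof.
split=> [[x1 x0]|[x1 x0]]; split => //; first by apply/eqP => x00; apply: x0.
exact/eqP.
Qed.

Let aut_D w : punctured_ball 1 z w -> D (ball_aut z w).
Proof.
move=> [w1 wz]; apply/punctured_unit_ball; split; first exact: ball_aut_lt1.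
apply: contra_neq wz => h; rewrite -(ball_autK z1 w1) h; exact: ball_aut0.
Qed.

Let aut_punctured x : D x -> punctured_ball 1 z (ball_aut z x).
Proof.
move=> /punctured_unit_ball[x1 x0]; split; first exact: ball_aut_lt1.
apply: contra_neq x0 => h; rewrite -(ball_autK z1 x1) h; exact: ball_aut_center.
Qed.

Let autK w : punctured_ball 1 z w -> ball_aut z (ball_aut z w) = w.
Proof. by move=> [w1 _]; exact: ball_autK. Qed.

Let autDK x : D x -> ball_aut z (ball_aut z x) = x.
Proof. by move=> /punctured_unit_ball[x1 _]; exact: ball_autK. Qed.

Let daut (x : V) : enorm x < 1 -> differentiable (ball_aut z) x.
Proof. exact: ball_aut_differentiable. Qed.

Let Dz : D z.
Proof. by apply/punctured_unit_ball. Qed.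

Let polydiskP (r : R) (w : V) : 0 < r -> polydisk n r w <-> nr w < r.
Proof. by move=> rp; split => /(nr_coords w rp). Qed.

Lemma squeezing_candidate_le (r : R) (f : V -> V) : 0 < r ->
  holo_maps D (polydisk n 1) f -> set_inj D f -> f z = 0 ->
  polydisk n r `<=` f @` D -> r <= r0.
Proof.
move=> rp [df fD] injf fz surf; apply: (le_r0 rp).
apply: (@ball_to_polydisk_bound R n (fun x => f (ball_aut z x)) z r n2 z0 z1 rp).
- move=> x Px; have Dx := aut_D Px; split.
    exact: (differentiable_comp (daut Px.1) (df _ Dx)).
  by apply/ltW/(polydiskP _ ltr01)/fD; exists (ball_aut z x).
- move=> x y /set_mem Px /set_mem Py h; rewrite -(autK Px) -(autK Py); congr ball_aut.
  by apply: injf h; apply/mem_set/aut_D.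
- by rewrite ball_aut0 // fz.
- move=> w /(polydiskP _ rp) /surf[x Dx <-]; exists (ball_aut z x); first exact: aut_punctured.
  by rewrite autDK.
Qed.

(** A competitor composed with the automorphism vanishes at the origin of the ball punctured at [z],
    where [schwarz_punctured] bounds it by [enorm x]. *)
Lemma caratheodory_punctured_le x : punctured_ball 1 z x ->
  (caratheodory D z (ball_aut z x) <= (atanh (enorm x))%:E)%E.
Proof.
move=> Px; apply: ge_ereal_sup => _ [h [[dh hD] hz] <-]; rewrite lee_fin.
apply: le_atanh; last exact: Px.1.
  by apply: lt_le_trans (normc_ge0 _); rewrite ltrN10.
have := @schwarz_punctured R n (fun y => h (ball_aut z y)) z 1 n2 z0 ltr01 _ _ x Px.1 Px.2.
rewrite divr1; apply; last by rewrite ball_aut0.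
move=> y y1 yz; have Dy := aut_D (conj y1 yz); split.
  exact: (differentiable_comp (daut y1) (dh _ Dy)).
by apply/ltW/hD; exists (ball_aut z y).
Qed.

Lemma caratheodory_center : (caratheodory D z z <= 0%:E)%E.
Proof.
by apply: ge_ereal_sup => _ [h [_ hz] <-]; rewrite hz normc0 atanh0.
Qed.

Lemma fridman_candidate_le (r : R) (f : V -> V) : 0 < r ->
  holo_maps (polydisk n 1) D f -> set_inj (polydisk n 1) f ->
  caratheodory_ball D z r `<=` f @` polydisk n 1 -> tanh r <= r0.
Proof.
move=> rp [df fD] injf surf; have tp := tanh_gt0 rp; apply: (le_r0 tp).
(* The base point lies in its own Caratheodory ball and so has a preimage [t]; composing with
   [polydisk_aut t] places that preimage at the origin. *)
have [t /(polydiskP _ ltr01) t1 ftz] : (f @` polydisk n 1) z.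
  by apply: surf; split => //; apply: le_lt_trans caratheodory_center _; rewrite lte_fin.
have t1N : nr (- t) < 1 by rewrite nrN.
have Df (w : V) : nr w < 1 -> D (f w) by move=> /(polydiskP _ ltr01) w1; apply: fD; exists w.
apply: (@polydisk_to_ball_bound R n (fun w => ball_aut z (f (polydisk_aut t w))) z
  (tanh r) n2 z0 tp).
- move=> w w1; have w1' := polydisk_aut_lt1 t1 w1; have Dw := Df _ w1'.
  split; last exact: aut_punctured.
  have dg : differentiable (fun w => f (polydisk_aut t w)) w.
    apply: (differentiable_comp (polydisk_aut_differentiable t1 w1)).
    by apply: df; exact/(polydiskP _ ltr01).
  by apply: (differentiable_comp dg); apply: daut; have /punctured_unit_ball[] := Dw.
- move=> w v /set_mem /= w1 /set_mem /= v1 h.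
  have w1' := polydisk_aut_lt1 t1 w1; have v1' := polydisk_aut_lt1 t1 v1.
  rewrite -(polydisk_autK t1 w1) -(polydisk_autK t1 v1); congr polydisk_aut.
  apply: injf; rewrite ?inE; [exact/(polydiskP _ ltr01) | exact/(polydiskP _ ltr01) |].
  exact: (etrans (esym (autDK (Df _ w1'))) (etrans (congr1 (ball_aut z) h) (autDK (Df _ v1')))).
- by rewrite polydisk_aut0 ftz ball_aut_center.
- move=> x [xr xz]; have x1 : enorm x < 1 := lt_trans xr (tanh_lt1 r).
  have Px : punctured_ball 1 z x by split.
  have [w /(polydiskP _ ltr01) w1 fw] : (f @` polydisk n 1) (ball_aut z x).
    apply: surf; split; first exact: aut_D.
    apply: le_lt_trans (caratheodory_punctured_le Px) _; rewrite lte_fin atanh_lt //.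
    by apply: lt_le_trans (enorm_ge0 _); rewrite ltrN10.
  exists (polydisk_aut (- t) w); first exact: polydisk_aut_lt1.
  have E := polydisk_autK t1N w1; rewrite opprK in E.
  by rewrite E fw autK.
Qed.

(** One pair of maps is extremal for both invariants. The reflection gives the puncture a sup norm
    equal to its Euclidean norm, hence at least [r0], so the polydisk of radius [r0] misses it. *)
Lemma exists_embedding : exists h g : V -> V,
  [/\ holo_maps D (polydisk n 1) h, h z = 0, forall x, D x -> g (h x) = x &
    forall w, nr w < r0 -> [/\ differentiable g w, D (g w) & h (g w) = w]].
Proof.
have [u hu] := exists_reflection z (ltnW n2).
have en (w : V) : enorm (reflection u w) = enorm w by rewrite /enorm -!/(e2 _) e2_reflection.
exists (fun x => reflection u (ball_aut z x)), (fun w => ball_aut z (reflection u w)).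
split.
- split=> [x Dx|_ [x Dx <-]].
    apply: (differentiable_comp (daut _)); last exact: reflection_differentiable.
    by have /punctured_unit_ball[] := Dx.
  apply/(polydiskP _ ltr01); apply: le_lt_trans (nr_enorm _) _; rewrite en.
  exact: (aut_punctured Dx).1.
- rewrite ball_aut_center //; apply/eqP.
  by rewrite -enorm_eq0 en enorm_eq0.
- by move=> x Dx; rewrite reflectionK autDK.
- move=> w wr.
  have Pw : punctured_ball 1 z (reflection u w).
    split.
      rewrite en enorm_lt // expr1n; apply: le_lt_trans (e2_nr w) _.
      apply: lt_le_trans r0_sqr; rewrite ltr_pM2l // ltr_pXn2r // nnegrE ?nr_ge0 //.
      exact: (ltW r0_gt0).
    apply: contraTneq wr => h; rewrite -(reflectionK u w) h -leNgt hu.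
    exact: r0_le_z.
  split; last by rewrite autK // reflectionK.
    exact: (differentiable_comp (reflection_differentiable u w) (daut Pw.1)).
  exact: aut_D.
Qed.

Lemma squeezing_candidate : exists f : V -> V,
  [/\ holo_maps D (polydisk n 1) f, set_inj D f, f z = 0 & polydisk n r0 `<=` f @` D].
Proof.
have [h [g [hh hz gh hg]]] := exists_embedding; exists h; split => //.
- by move=> x y /set_mem Dx /set_mem Dy e; rewrite -(gh _ Dx) -(gh _ Dy) e.
- by move=> w /(polydiskP _ r0_gt0) /hg[_ Dg hgw]; exists (g w).
Qed.

(** Every coordinate of [h] competes in the supremum defining the Caratheodory distance, so a
    distance below [atanh r0] puts [h x] in the polydisk of radius [r0], which [g] maps back to
    [x]. *)
Lemma fridman_candidate : exists f : V -> V,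
  [/\ holo_maps (polydisk n 1) D f, set_inj (polydisk n 1) f &
    caratheodory_ball D z (atanh r0) `<=` f @` polydisk n 1].
Proof.
have r0N1 : -1 < r0 by apply: lt_trans r0_gt0; rewrite ltrN10.
have r0C : r0%:C%C != 0 by rewrite eq_complex /= gt_eqF.
have nZ (w : V) : nr (r0%:C%C *: w) = r0 * nr w by rewrite nrZ normc_real gtr0_norm.
have dsc (w : V) : differentiable (fun x : V => r0%:C%C *: x) w.
  exact: (@differentiableZ _ _ _ (fun x : V => x)).
have [h [g [[dh hP] hz gh hg]]] := exists_embedding.
have lt_r0 (w : V) : polydisk n 1 w -> nr (r0%:C%C *: w) < r0.
  by move=> /(polydiskP _ ltr01) w1; rewrite nZ gtr_pMr.
exists (fun w => g (r0%:C%C *: w)); split.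
- split=> [w /lt_r0 /hg[dg _ _]|_ [w /lt_r0 /hg[_ Dg _] <-]]; last exact: Dg.
  exact: (differentiable_comp (dsc w) dg).
- move=> w v /set_mem /lt_r0 /hg[_ _ hw] /set_mem /lt_r0 /hg[_ _ hv] e.
  by apply: (scalerI r0C); rewrite -hw e hv.
- move=> x [Dx cx]; exists (r0%:C%C^-1 *: h x); last by rewrite scalerA mulfV // scale1r gh.
  have hx1 : polydisk n 1 (h x) by apply: hP; exists x.
  apply/(polydiskP _ ltr01); rewrite nrZ -fmorphV normc_real gtr0_norm ?invr_gt0 //.
  rewrite mulrC ltr_pdivrMr // mul1r; apply/(polydiskP _ r0_gt0) => i.
  have N1 : -1 < normc (h x 0 i) by apply: lt_le_trans (normc_ge0 _); rewrite ltrN10.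
  rewrite -(atanhK r0N1 r0_lt1) -atanh_lt //.
  rewrite -lte_fin; apply: le_lt_trans cx; apply: ereal_sup_ubound.
  exists (fun y => h y 0 i) => //; split; last by rewrite hz mxE.
  split=> [y Dy|_ [y Dy <-]]; first exact: (coord_differentiable i (dh y Dy)).
  by apply: hP; exists y.
Qed.

Lemma squeezing_punctured_ball : squeezing D z = r0%:E.
Proof.
apply/eqP; rewrite eq_le; apply/andP; split.
  apply: ge_ereal_sup => _ [r [rp [f [hf injf fz surf]]] <-]; rewrite lee_fin.
  exact: squeezing_candidate_le surf.
by apply: ereal_sup_ubound; exists r0 => //; split; [exact: r0_gt0 | exact: squeezing_candidate].
Qed.

Lemma fridman_punctured_ball : fridman D z = r0%:E.
Proof.
have r0N1 : -1 < r0 by apply: lt_trans r0_gt0; rewrite ltrN10.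
apply/eqP; rewrite eq_le; apply/andP; split.
  apply: ge_ereal_sup => _ [r [rp [f [hf injf surf]]] <-]; rewrite lee_fin.
  exact: fridman_candidate_le surf.
apply: ereal_sup_ubound; exists (atanh r0); last by rewrite atanhK.
split; last exact: fridman_candidate.
rewrite ltNge; apply/negP => h.
have := r0_gt0; rewrite -{1}(atanhK r0N1 r0_lt1) -atanh_lt ?ltrN10 ?ltr01 //.
by rewrite atanh0 ltNge h.
Qed.

End PuncturedUnitBall.

Theorem theorem3p6 (R : realType) (n : nat) (n_ge2 : (2 <= n)%N)
    (z : 'rV[R[i]]_n) (zB : (unit_ball n `\ 0) z) :
  squeezing (unit_ball n `\ 0) z = fridman (unit_ball n `\ 0) z /\
  fridman (unit_ball n `\ 0) z =
    (Num.min (enorm z) (1 / Num.sqrt n%:R))%:E.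
Proof.
have /punctured_unit_ball[z1 z0] := zB.
by rewrite squeezing_punctured_ball // fridman_punctured_ball.
Qed.
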